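(* Let $d\ge 2$, let $C\subset\mathbb R^d$ be a closed convex cone that is pointed (contains no line) and has non-empty interior, and let $\mathbf k\in \mathbb Z^d\cap\operatorname{Int} C$. Let $q(C,\mathbf k)>0$ be the number defined in the context. Then $$\lim_{n\to\infty} n^{-\frac d{d+1}}\log p(C,n\mathbf k)= c_d\,q(C,\mathbf k),\qquad c_d=\left(\frac{\zeta(d+1)}{\zeta(d)}(d+1)!\right)^{1/(d+1)},$$ where $\zeta$ is the Riemann zeta function and $n$ ranges over the positive integers.
   Context: An integral zonotope in $C$ is a set of the form $T=\{\sum_{i=1}^m\alpha_i\mathbf v_i : (\alpha_1,\dots,\alpha_m)\in[0,1]^m\}$ with $m\in\mathbb N$ and $\mathbf v_1,\dots,\mathbf v_m\in\mathbb Z^d\cap C$; its endpoint is $\sum_{i=1}^m\mathbf v_i$. For $\mathbf m\in\mathbb Z^d\cap\operatorname{Int}C$, $\mathcal T(C,\mathbf m)$ denotes the (finite) family of all integral zonotopes in $C$ (as sets) whose endpoint is $\mathbf m$, and $p(C,\mathbf m)=\operatorname{card}\mathcal T(C,\mathbf m)$. Definition of $q(C,\mathbf k)$. Let $C^\circ=\{\mathbf u\in\mathbb R^d:\mathbf u\cdot\mathbf x>0\ \forall\mathbf x\in C\setminus\{0\}\}$ and, for $\mathbf u\in C^\circ$, $t>0$, $C(\mathbf u\le t)=\{\mathbf x\in C:\mathbf u\cdot\mathbf x\le t\}$ (a cap of $C$). For $\mathbf a\in\operatorname{Int}C$ there is (by a theorem of Gigena) a unique $\mathbf u=\mathbf u(C,\mathbf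 a)\in C^\circ$ such that $\mathbf a$ is the center of gravity of the section $\{\mathbf x\in C:\mathbf u\cdot\mathbf x=1\}$; moreover $C(\mathbf u\le1)$ is the unique cap of minimal volume among caps of $C$ containing $\mathbf a$. There is a unique $\lambda>0$ with $\int_{C(\mathbf u\le\lambda)}\mathbf x\,d\mathbf x=\mathbf a$. Put $Q(C,\mathbf a)=C(\mathbf u\le\lambda)$ and $q(C,\mathbf a)=\operatorname{Vol}Q(C,\mathbf a)$; equivalently $q(C,\mathbf a)=\big((1+\frac1d)^d\operatorname{Vol}C(\mathbf u\le 1)\big)^{1/(d+1)}$. *)

(* Defs.v *)
From HB Require Import structures.
From mathcomp Require Import all_boot all_order all_algebra finmap.
From mathcomp Require Import all_classical all_reals all_analysis.

Set Implicit Arguments.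
Unset Strict Implicit.
Unset Printing Implicit Defensive.

Import Order.TTheory GRing.Theory Num.Theory.
Import numFieldNormedType.Exports.

Local Open Scope classical_set_scope.
Local Open Scope ring_scope.

(* The product sigma-algebra on row vectors, generated by the coordinates. *)
Definition rV_display : measure_display.
Proof. exact: default_measure_display. Qed.

Section rV_measurable.
Context {R : realType} {n : nat}.

Definition rV_coord (i : 'I_n) (x : 'rV[R]_n) : R := x ord0 i.

Let rV_set0 : g_sigma_preimage rV_coord set0.
Proof. exact: sigma_algebra0. Qed.

Let rV_setC A : g_sigma_preimage rV_coord A -> g_sigma_preimage rV_coord (~` A).
Proof. exact: sigma_algebraC. Qed.

Let rV_bigcup (F : (set 'rV[R]_n)^nat) :
  (forall i, g_sigma_preimage rV_coord (F i)) ->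
  g_sigma_preimage rV_coord (\bigcup_i F i).
Proof. exact: sigma_algebra_bigcup. Qed.

HB.instance Definition _ := @isMeasurable.Build rV_display
  'rV[R]_n (g_sigma_preimage rV_coord) rV_set0 rV_setC rV_bigcup.

End rV_measurable.

Lemma measurable_fun_rV_coordP (R : realType) (d : measure_display)
    (T : measurableType d) (n : nat) (f : T -> 'rV[R]_n) :
  measurable_fun [set: T] f <->
  forall i, measurable_fun [set: T] (rV_coord i \o f).
Proof.
apply: (@iff_trans _ (g_sigma_preimage
    (fun i => rV_coord i \o f) `<=` measurable)).
  rewrite g_sigma_preimage_comp; split=> [mf A [/= C preC <-]|prefS].
    exact: mf.
  by move=> _ A mA; apply: prefS; exists A.
split=> [fS i|mf].
- move=> _ A mA; apply: fS; apply: sub_sigma_algebra.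
  case: n i => [[] []//|n i] in f *.
  rewrite -bigcup_mkord_ord.
  exists i; first exact: ltn_ord.
  by exists A => //; rewrite inord_val.
- apply: smallest_sub; first exact: sigma_algebra_measurable.
  case: n => [|n] in f mf *; first by rewrite big_ord0.
  rewrite -bigcup_mkord_ord; apply: bigcup_sub => i Ii.
  by move=> A [B mB <-]; exact: mf.
Qed.

Lemma measurable_rV_coord (R : realType) (n : nat) (i : 'I_n) :
  measurable_fun [set: 'rV[R]_n] (rV_coord i).
Proof.
by have /measurable_fun_rV_coordP/(_ i) := @measurable_id _ 'rV[R]_n setT.
Qed.

Section lebesgue_rV.
Context {R : realType}.

(* the vector y with the value a inserted at position j *)
Definition rV_insert n (j : 'I_n) (a : R) (y : 'rV[R]_n.-1) : 'rV[R]_n :=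
  \row_i if unlift j i is Some i' then y ord0 i' else a.

Definition rV_cons n (x : measurableTypeR R * 'rV[R]_n) : 'rV[R]_n.+1 :=
  rV_insert ord0 x.1 x.2.

Lemma measurable_rV_cons n : measurable_fun setT (@rV_cons n).
Proof.
apply/measurable_fun_rV_coordP => i.
case: (@unliftP n.+1 ord0 i) => [j|] ->.
  rewrite (_ : _ \o _ = rV_coord j \o snd).
    by apply: measurableT_comp => //; exact: measurable_rV_coord.
  by apply/funext => x /=; rewrite /rV_coord mxE liftK.
rewrite (_ : _ \o _ = fst)//.
by apply/funext => x /=; rewrite /rV_coord mxE unlift_none.
Qed.

Definition rV_uncons n (x : 'rV[R]_n.+1) : measurableTypeR R * 'rV[R]_n :=
  (x ord0 ord0, \row_(i < n) x ord0 (lift ord0 i)).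

Lemma rV_consK n : cancel (@rV_cons n) (@rV_uncons n).
Proof.
move=> [a x]; rewrite /rV_uncons mxE unlift_none; congr (_, _).
by apply/rowP => i; rewrite !mxE liftK.
Qed.

Lemma measurable_rV_uncons n : measurable_fun setT (@rV_uncons n).
Proof.
apply/measurable_fun_pairP; split; first exact: (measurable_rV_coord ord0).
apply/measurable_fun_rV_coordP => i.
rewrite (_ : _ \o _ = rV_coord (lift ord0 i)); first exact: measurable_rV_coord.
by apply/funext => x /=; rewrite /rV_coord mxE.
Qed.

Section cons_measure.
Context (n : nat) (mu : {sigma_finite_measure set 'rV[R]_n -> \bar R}).

Definition rV_cons_measure : set 'rV[R]_n.+1 -> \bar R :=
  pushforward (lebesgue_measure \x mu)%E (@rV_cons n).

Let cons0 : rV_cons_measure set0 = 0%E.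
Proof. by rewrite /rV_cons_measure /pushforward preimage_set0 measure0. Qed.

Let cons_ge0 A : (0 <= rV_cons_measure A)%E.
Proof. exact: (measure_ge0 (lebesgue_measure \x mu)%E). Qed.

Let cons_sigma_additive : semi_sigma_additive rV_cons_measure.
Proof.
move=> F mF tF mUF; rewrite /rV_cons_measure /pushforward preimage_bigcup.
apply: measure_semi_sigma_additive.
- by move=> i; rewrite -[X in measurable X]setTI; exact: measurable_rV_cons.
- apply/trivIsetP => /= i j _ _ ij; rewrite -preimage_setI.
  by move/trivIsetP : tF => /(_ _ _ _ _ ij) ->//; rewrite preimage_set0.
- rewrite -preimage_bigcup -[X in measurable X]setTI.
  exact: measurable_rV_cons.
Qed.

HB.instance Definition _ := isMeasure.Build _ _ _
  rV_cons_measure cons0 cons_ge0 cons_sigma_additive.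

Let cons_sigma_finite : sigma_finite setT rV_cons_measure.
Proof.
have /sigma_finiteP[F [TF ndF mF]] := sigma_finiteT (@lebesgue_measure R).
have /sigma_finiteP[G [TG ndG mG]] := sigma_finiteT mu.
exists (fun i => @rV_uncons n @^-1` (F i `*` G i)) => [|i].
  rewrite -preimage_bigcup -[LHS](preimage_setT (@rV_uncons n)); congr (_ @^-1` _).
  rewrite -setXTT TF TG predeqE => -[x y]; split.
    move=> [/= [i _ Fix] [j _ Gjy]]; exists (maxn i j) => //; split.
    - by move: x Fix; exact/subsetPset/ndF/leq_maxl.
    - by move: y Gjy; exact/subsetPset/ndG/leq_maxr.
  by move=> [i _ []/= ? ?]; split; exists i.
have [mFi Fi] := mF i; have [mGi Gi] := mG i; split.
  rewrite -[X in measurable X]setTI; apply: measurable_rV_uncons => //.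
  exact: measurableX.
rewrite /rV_cons_measure /pushforward -comp_preimage.
rewrite (_ : _ \o _ = id) ?preimage_id.
  by rewrite product_measure1E// lte_mul_pinfty// ge0_fin_numE.
by apply/funext => x /=; rewrite rV_consK.
Qed.

HB.instance Definition _ := Measure_isSigmaFinite.Build _ _ _
  rV_cons_measure cons_sigma_finite.

End cons_measure.

(* Lebesgue measure on R^n, as the n-fold product of the one-dimensional one *)
Fixpoint lebesgue_rV n : {sigma_finite_measure set 'rV[R]_n -> \bar R} :=
  if n is m.+1 then rV_cons_measure (lebesgue_rV m) else \d_(0 : 'rV[R]_0).

End lebesgue_rV.
Arguments lebesgue_rV {R} n.

Section real_vectors.
Context {R : realType}.

Definition vol n (A : set 'rV[R]_n) : R := fine (lebesgue_rV n A).

Definition vec_integral n m (A : set 'rV[R]_n) (f : 'rV[R]_n -> 'rV[R]_m) :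
    'rV[R]_m :=
  \row_i \int[lebesgue_rV n]_(x in A) f x ord0 i.

Definition dotr n (u x : 'rV[R]_n) : R := \sum_i u ord0 i * x ord0 i.

Definition intvec n (v : 'rV[int]_n) : 'rV[R]_n := map_mx intr v.

End real_vectors.

Section cones.
Context {R : realType} {d : nat}.
Implicit Types (C : set 'rV[R]_d) (u a : 'rV[R]_d).

Definition is_cone C := forall (t : R) x, 0 <= t -> C x -> C (t *: x).

Definition contains_no_line C :=
  forall p v : 'rV[R]_d, v != 0 -> ~ (forall t : R, C (p + t *: v)).

(* the set written C^o; strict inequality, so this is the interior of the
   usual dual cone *)
Definition strict_dual C : set 'rV[R]_d :=
  [set u | forall x, C x -> x != 0 -> 0 < dotr u x].

Definition cap C u (t : R) : set 'rV[R]_d := [set x | C x /\ dotr u x <= t].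

Definition cone_section C u : set 'rV[R]_d := [set x | C x /\ dotr u x = 1].

(* When u_j != 0, this parametrizes the hyperplane u.x = 1 by the coordinates
   other than the j-th. *)
Definition hyperplane_chart u (j : 'I_d) (y : 'rV[R]_d.-1) : 'rV[R]_d :=
  rV_insert j ((1 - \sum_i u ord0 (lift j i) * y ord0 i) / u ord0 j) y.

(* The (d-1)-dimensional measure of the hyperplane u.x = 1 is the image of the
   Lebesgue measure of R^(d-1) by the chart, times the constant |u| / |u_j|;
   this constant cancels in the center of gravity, which therefore does not
   depend on j either. *)
Definition hyperplane_centroid u (j : 'I_d) (S : set 'rV[R]_d) : 'rV[R]_d :=
  let S' := hyperplane_chart u j @^-1` S in
  (vol S')^-1 *: vec_integral S' (hyperplane_chart u j).

Definition is_section_centroid C u a :=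
  exists2 j, u ord0 j != 0 & hyperplane_centroid u j (cone_section C u) = a.

(* u(C,a): get picks an element of a set, here a singleton when C is a closed
   convex pointed cone and a is interior to C *)
Definition gigena C a : 'rV[R]_d :=
  get [set u | strict_dual C u /\ is_section_centroid C u a].

Definition Qlevel C a : R :=
  get [set l : R | 0 < l /\ vec_integral (cap C (gigena C a) l) id = a].

Definition Q C a : set 'rV[R]_d := cap C (gigena C a) (Qlevel C a).

Definition q C a : R := vol (Q C a).

Definition zonotope m (v : 'I_m -> 'rV[int]_d) : set 'rV[R]_d :=
  [set \sum_i alpha i *: intvec (v i) |
    alpha in [set alpha : 'I_m -> R | forall i, 0 <= alpha i <= 1]].

Definition zonotopes C (k : 'rV[int]_d) : set (set 'rV[R]_d) :=
  [set T | exists (m : nat) (v : 'I_m -> 'rV[int]_d),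
    [/\ forall i, C (intvec (v i)), T = zonotope v & \sum_i v i = k]].

(* fset_set is empty on infinite sets, but the family is finite when C is a
   closed convex pointed cone *)
Definition p C (k : 'rV[int]_d) : nat := #|` fset_set (zonotopes C k)|%fset.

End cones.

(* for s > 1 *)
Definition zeta {R : realType} (s : R) : R :=
  limn (series (fun n : nat => n.+1%:R `^ (- s))).

Definition c_ (R : realType) (d : nat) : R :=
  (zeta d.+1%:R / zeta d%:R * (d.+1)`!%:R) `^ d.+1%:R^-1.

(* Main.v *)
(** A zonotope in [C] is determined by the multiplicities of its primitive directions [w], so for [th]
    in the open dual cone the generating function of [p C] at [expR (- dotr th _)] is dominated by the
    product of the [1 / (1 - expR (- dotr th w))]. Summing the values of its logarithm
    [prim_log_sum] at all integer dilates of [th] gives the corresponding sum over all lattice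
    vectors, which is compared with an integral. As [zeta d < 2], this relation can be inverted by
    a contraction argument rather than by Moebius inversion, which gives
    [prim_log_sum u t ~ t ^ (- d) zeta (d + 1) / zeta d * L u], where [L] is the Laplace transform of
    [C].

    The Gigena functional of [a] is, up to scaling, the minimiser of [L] plus the linear form
    [dotr _ a]: its critical point equation says that the first moment of the section is
    proportional to [a]. Evaluating at [th = t u] with the optimal [t] gives the upper bound. For
    the lower bound, weight the multiplicity functions by [expR (- t * dotr u x)], [x] being their
    endpoint. The gradient of [L] at [u] places the mean of [x] near [(1 - eps) n k], exponential
    tilting shows concentration, and each typical zonotope is completed to one with endpoint [n k]
    by adding a single further lattice vector of [C]; this forgets only polynomially many choices. *)

Require Import Defs.
From mathcomp Require Import all_boot all_order all_algebra finmap.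
From mathcomp Require Import all_classical all_reals all_analysis.
From mathcomp Require Import measurable_realfun.
From mathcomp Require Import ring lra zify.

Set Implicit Arguments.
Unset Strict Implicit.
Unset Printing Implicit Defensive.

Import Order.TTheory GRing.Theory Num.Theory.
Import numFieldNormedType.Exports.

Local Open Scope classical_set_scope.
Local Open Scope ring_scope.

(** * Lebesgue measure on row vectors *)

(** The two zeta values come from two dilations. Expanding [log_factor] in powers gives lattice sums
    at [j t] with weight [1 / j]; these are of order [(j t) ^ (- d)], so the normalised weight is
    [j ^ (- (d + 1))]. Grouping lattice vectors by primitive direction gives the weight [i ^ (- d)].

    With [t = s N ^ (- 1 / (d + 1))], both [t N] and the logarithm of the generating function are of
    order [N ^ (d / (d + 1))]. Minimising [s + D / s ^ d], with [D] the [log_density] of the Gigena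
    functional, yields the exponent and the constant.

    The obstacle in the lower bound is to correct a random endpoint [x] to [N k] without identifying
    distinct zonotopes. Aiming at [(1 - eps) N k] leaves a margin proportional to [N], so [N k - x]
    lies in [C] for all [x] in a box of linear size, and concentration at that coarse scale is
    enough. Zonotopes with the same [x] receive the same extra generator; it cancels from their
    support functions, whose kinks then recover the multiplicities. *)

Section affine.
Context {R : realType}.
Local Notation mu := (@lebesgue_measure R).
Local Open Scope ereal_scope.

Let aff (a b : R) : measurableTypeR R -> measurableTypeR R := fun x => (a * x + b)%R.

Let maff a b : measurable_fun setT (aff a b).
Proof.
by apply: measurable_funD => //; apply: measurable_funM => //.
Qed.

Let preim_aff_pos a b c e : (0 < a)%R ->
  aff a b @^-1` `]c, e] = [set` `]((c - b) / a)%R, ((e - b) / a)%R]%R].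
Proof.
move=> a0; apply/seteqP; split=> x /=; rewrite !in_itv/= /aff;
by rewrite ltr_pdivrMr// ler_pdivlMr// ltrBlDr lerBrDr [(x * a)%R]mulrC.
Qed.

Let preim_aff_neg a b c e : (a < 0)%R ->
  aff a b @^-1` `]c, e] = [set` `[((e - b) / a)%R, ((c - b) / a)%R[%R].
Proof.
move=> a0; apply/seteqP; split=> x /=; rewrite !in_itv/= /aff;
by rewrite ler_ndivrMr// ltr_ndivlMr// ltrBlDr lerBrDr [(x * a)%R]mulrC andbC.
Qed.

(** Both sides are measures in [A] that agree on half-open intervals; for [a < 0] the preimage is
    closed at the other end, which does not change its length. *)
Lemma lebesgue_measure_affine (a b : R) (A : set R) : a != 0%R -> measurable A ->
  mu A = `|a|%:E * mu ((fun x => a * x + b)%R @^-1` A).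
Proof.
move=> a0 mA.
pose pf := measure_function_pushforward__canonical__measure_function_Measure mu (maff a b).
pose nu := mscale (NngNum (normr_ge0 a)) pf.
have a0' : (0 < `|a|)%R by rewrite normr_gt0.
suff -> : mu A = nu A by [].
apply: lebesgue_measure_unique => // _ [[c e] _ <-] /=.
rewrite /nu /mscale /= /pushforward.
have [ap|an|/eqP] := ltgtP a 0%R; last by rewrite (negbTE a0).
- rewrite preim_aff_neg// !lebesgue_measure_itv/= !lte_fin.
  rewrite (ltr_nM2r (x := a^-1)) ?invr_lt0// ltrD2r; case: ifPn => _; last by rewrite mule0.
  rewrite -!EFinB -EFinM ltr0_norm//; congr EFin; field; exact: a0.
- rewrite preim_aff_pos// !lebesgue_measure_itv/= !lte_fin.
  rewrite (ltr_pM2r (x := a^-1)) ?invr_gt0// ltrD2r; case: ifPn => _; last by rewrite mule0.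
  rewrite -!EFinB -EFinM gtr0_norm//; congr EFin; field; exact: a0.
Qed.

Lemma integral_affine (f : R -> \bar R) (a b : R) : a != 0%R ->
  measurable_fun setT f -> (forall x, 0 <= f x) ->
  \int[mu]_x f x = `|a|%:E * \int[mu]_x f (a * x + b)%R.
Proof.
move=> a0 mf f0.
pose pf := measure_function_pushforward__canonical__measure_function_Measure mu (maff a b).
pose nu := mscale (NngNum (normr_ge0 a)) pf.
rewrite (@eq_measure_integral _ _ _ _ nu) => [|A mA _]; last first.
  exact: (lebesgue_measure_affine b a0 mA).
rewrite ge0_integral_mscale//= ge0_integral_pushforward//.
Qed.

End affine.

Section lebesgue_rV.
Context {R : realType}.
Local Notation mu := (@lebesgue_measure R).
Local Open Scope ereal_scope.

Lemma measurable_fun_rV (d : measure_display) (T : measurableType d) n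
    (f : T -> 'rV[R]_n) :
  (forall i, measurable_fun setT (fun x => f x ord0 i)) -> measurable_fun setT f.
Proof. by move=> mf; apply/measurable_fun_rV_coordP. Qed.

Lemma measurable_rV_insert n (j : 'I_n.+1) :
  measurable_fun setT
    (fun p : measurableTypeR R * 'rV[R]_n => rV_insert j p.1 p.2).
Proof.
apply: measurable_fun_rV => i; rewrite /rV_insert.
under eq_fun do rewrite mxE.
case: unlift => [i'|].
  exact: (measurableT_comp (@measurable_rV_coord R n i')).
exact: measurable_fst.
Qed.

Lemma integral_rV_cons n (f : 'rV[R]_n.+1 -> \bar R) :
  measurable_fun setT f -> (forall x, 0 <= f x) ->
  \int[lebesgue_rV n.+1]_x f x =
  \int[mu]_a \int[lebesgue_rV n]_y f (rV_insert ord0 a y).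
Proof.
move=> mf f0.
have -> : \int[lebesgue_rV n.+1]_x f x =
    \int[pushforward (mu \x lebesgue_rV n) (@rV_cons R n)]_x f x by [].
rewrite ge0_integral_pushforward//; last exact: measurable_rV_cons.
rewrite preimage_setT fubini_tonelli1//.
  by apply: measurableT_comp => //; exact: measurable_rV_cons.
by move=> x; exact: f0.
Qed.

(** [lebesgue_rV] adds coordinates at position 0, whereas a hyperplane chart eliminates an arbitrary
    coordinate [j]. Tonelli and the commutation of insertions reconcile the two. *)
Lemma integral_rV_insert n (j : 'I_n.+1) (f : 'rV[R]_n.+1 -> \bar R) :
  measurable_fun setT f -> (forall x, 0 <= f x) ->
  \int[lebesgue_rV n.+1]_x f x =
  \int[lebesgue_rV n]_y \int[mu]_a f (rV_insert j a y).
Proof.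
elim: n => [|n IHn] in j f *.
  move=> mf f0; rewrite (ord1 j) integral_rV_cons//.
  rewrite (fubini_tonelli (fun p : measurableTypeR R * 'rV[R]_0 =>
    f (rV_insert ord0 p.1 p.2)))//.
  by apply: measurableT_comp => //; exact: measurable_rV_insert.
move=> mf f0; rewrite integral_rV_cons//.
case: (unliftP ord0 j) => [j'|] ->; last first.
  rewrite (fubini_tonelli (fun p : measurableTypeR R * 'rV[R]_n.+1 =>
    f (rV_insert ord0 p.1 p.2)))//.
  by apply: measurableT_comp => //; exact: measurable_rV_insert.
have mf' a : measurable_fun setT (fun y => f (rV_insert ord0 a y)).
  apply: measurableT_comp => //.
  exact: (measurableT_comp (@measurable_rV_insert n.+1 ord0) (measurable_pair1 a)).
have insE a b (z : 'rV[R]_n) : rV_insert ord0 a (rV_insert j' b z) =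
    rV_insert (lift ord0 j') b (rV_insert ord0 a z).
  apply/rowP => i; rewrite !mxE.
  case: (unliftP ord0 i) => [i'|] ->; last first.
    case: unliftP => [k|].
      move=> E; rewrite !mxE; case: unliftP => [k' E'|//].
      by move: E; rewrite E' => /(congr1 val)/=; rewrite /bump /=; case: leqP; lia.
    by move/(congr1 val).
  rewrite [LHS]mxE.
  case: (unliftP j' i') => [k|] ->; last by rewrite unlift_none.
  rewrite (_ : lift ord0 (lift j' k) = lift (lift ord0 j') (lift ord0 k)).
    by rewrite liftK !mxE liftK.
  by apply: val_inj; rewrite /= /bump /=; lia.
under eq_integral => a _.
  rewrite (IHn j')//.
  under eq_integral do under eq_integral do rewrite insE.
  over.
rewrite [RHS]integral_rV_cons//.
  pose G (p : measurableTypeR R * 'rV[R]_n.+1) := f (rV_insert (lift ord0 j') p.1 p.2).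
  apply: (measurable_fun_fubini_tonelli_G G) => //; last by move=> x; exact: f0.
  by apply: measurableT_comp => //; exact: measurable_rV_insert.
by move=> x; exact: integral_ge0.
Qed.

Lemma measurable_scale n (r : R) : measurable_fun setT (fun x : 'rV[R]_n => r *: x).
Proof.
apply: measurable_fun_rV => i; under eq_fun do rewrite mxE.
by apply: measurable_funM => //; exact: measurable_rV_coord.
Qed.

Lemma integral_rV_scale n (r : R) (f : 'rV[R]_n -> \bar R) : (0 < r)%R ->
  measurable_fun setT f -> (forall x, 0 <= f x) ->
  \int[lebesgue_rV n]_x f x = (r ^+ n)%:E * \int[lebesgue_rV n]_x f (r *: x).
Proof.
move=> r0; elim: n f => [|n IHn] f mf f0.
  by rewrite expr0 mul1e; apply: eq_integral => x _; congr f; apply/rowP => -[].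
rewrite integral_rV_cons//.
have mI : measurable_fun setT (fun p : measurableTypeR R * 'rV[R]_n =>
    f (rV_insert ord0 p.1 p.2)).
  by apply: measurableT_comp => //; exact: measurable_rV_insert.
rewrite (@integral_affine _ _ r 0)//; first last.
- by move=> x; exact: integral_ge0.
- exact: (measurable_fun_fubini_tonelli_F (fun p : measurableTypeR R * 'rV[R]_n =>
    f (rV_insert ord0 p.1 p.2))).
- by rewrite gt_eqF.
have mfs : measurable_fun setT (fun x : 'rV[R]_n.+1 => f (r *: x)).
  by apply: measurableT_comp => //; exact: measurable_scale.
rewrite [in RHS]integral_rV_cons//.
rewrite gtr0_norm// exprS EFinM -muleA; congr *%E.
rewrite -ge0_integralZl//; first last.
- by rewrite lee_fin exprn_ge0// ltW.
- by move=> x _; exact: integral_ge0.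
- apply: (measurable_fun_fubini_tonelli_F (fun p : measurableTypeR R * 'rV[R]_n =>
    f (r *: rV_insert ord0 p.1 p.2))) => //.
  by apply: (measurableT_comp mfs); exact: measurable_rV_insert.
apply: eq_integral => a _; rewrite IHn//; last first.
  apply: measurableT_comp => //.
  exact: (measurableT_comp (@measurable_rV_insert n ord0) (measurable_pair1 _)).
congr *%E; apply: eq_integral => y _; congr f; apply/rowP => i.
by rewrite !mxE addr0; case: unlift => //= i'; rewrite mxE.
Qed.

Lemma measurable_rV_box n (A : 'I_n -> set R) : (forall i, measurable (A i)) ->
  measurable [set x : 'rV[R]_n | forall i, A i (x ord0 i)].
Proof.
move=> mA.
rewrite (_ : mkset _ = \bigcap_(i in [set: 'I_n]) (rV_coord i @^-1` A i)).
  apply: fin_bigcap_measurable => // i _; rewrite -[X in measurable X]setTI.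
  exact: measurable_rV_coord.
by apply/seteqP; split => [x Hx i _|x Hx i]; [exact: Hx|exact: Hx i I].
Qed.

Lemma lebesgue_rV_box n (A : 'I_n -> set R) : (forall i, measurable (A i)) ->
  lebesgue_rV n [set x | forall i, A i (x ord0 i)] = \prod_i mu (A i).
Proof.
elim: n A => [|n IHn] A mA.
  rewrite big_ord0 /= /dirac indicE mem_set//=; by case.
rewrite big_ord_recl -IHn//.
rewrite /= /rV_cons_measure /pushforward.
rewrite -product_measure1E//; last 2 first.
- exact: mA.
- exact: (measurable_rV_box (A := fun i => A (lift ord0 i))).
congr (product_measure1 _ _ _); apply/seteqP; split=> -[a y] /=.
  move=> H; split=> [|i] /=.
    by have := H ord0; rewrite mxE unlift_none.
  by have := H (lift ord0 i); rewrite mxE liftK.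
move=> [/= Ha Hy] i; rewrite mxE.
by case: (unliftP ord0 i) => [i'|] ->; rewrite ?liftK ?unlift_none.
Qed.

(** The sigma-algebra is generated by the coordinates; an open set is the union of the countably
    many boxes with rational centre and half-side [1 / (m + 1)] that it contains. *)
Lemma open_measurable_rV n (U : set 'rV[R]_n) : open U -> measurable U.
Proof.
move=> oU.
pose B (q : 'rV[rat]_n * nat) : set 'rV[R]_n :=
  [set x | forall i, `](ratr (q.1 ord0 i) - q.2.+1%:R^-1)%R,
                       (ratr (q.1 ord0 i) + q.2.+1%:R^-1)%R[%classic (x ord0 i)].
rewrite (_ : U = \bigcup_(q in [set q | B q `<=` U]) B q).
  rewrite bigcup_mkcond; apply: countable_bigcupT_measurable => // q.
  case: ifP => _; last exact: measurable0.
  apply: (measurable_rV_box (A := fun i => `](ratr (q.1 ord0 i) - q.2.+1%:R^-1)%R,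
    (ratr (q.1 ord0 i) + q.2.+1%:R^-1)%R[%classic)) => i.
  exact: measurable_itv.
apply/seteqP; split=> [x Ux|x [q /= qU Bqx]]; last exact: qU.
have /nbhs_ballP[e /= e0 xeU] : nbhs x U by exact: open_nbhs_nbhs.
have [m _ /= mP] := near_infty_natSinv_lt (PosNum (divr_gt0 e0 (ltr0n _ 2))).
have m0 : (0 < m.+1%:R^-1 :> R)%R by rewrite invr_gt0.
have Hq i : exists q : rat,
    (ratr q \in `](x ord0 i - m.+1%:R^-1), (x ord0 i + m.+1%:R^-1)[)%R.
  by apply: rat_in_itvoo; rewrite ltrBlDr -addrA ltrDl addr_gt0.
have [q Hq'] := choice Hq.
exists (\row_i q i, m) => /=; last first.
  move=> i /=; have := Hq' i; rewrite !mxE !in_itv/= => /andP[h1 h2].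
  by rewrite ltrBlDr h2 -ltrBlDr h1.
move=> y By; apply: xeU; rewrite /ball/= /mx_ball; split=> // i j.
rewrite (ord1 i) /ball/=; have := Hq' j; have := By j; rewrite /= !mxE !in_itv/=.
move=> /andP[h1 h2] /andP[h3 h4]; have h5 := mP m (leqnn m); rewrite /= in h5.
move: (ratr (q j)) (m.+1%:R^-1)%R h1 h2 h3 h4 h5 => a b h1 h2 h3 h4 h5.
by rewrite ltr_distlC; apply/andP; split; lra.
Qed.

Lemma closed_measurable_rV n (U : set 'rV[R]_n) : closed U -> measurable U.
Proof.
by move=> cU; rewrite -[U]setCK; apply: measurableC; apply: open_measurable_rV;
  exact: closed_openC.
Qed.

End lebesgue_rV.

(** * Gamma integrals and polar coordinates *)

Section gamma_integrals.
Context {R : realType}.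
Local Notation mu := (@lebesgue_measure R).

Fixpoint gamma_primitive (m : nat) (r : R) : R :=
  if m is m'.+1 then - (r ^+ m * expR (- r)) + m%:R * gamma_primitive m' r
  else - expR (- r).

Lemma is_derive_gamma_primitive m (r : R) :
  is_derive r 1 (gamma_primitive m) (r ^+ m * expR (- r)).
Proof.
elim: m => [|m IHm] /=.
  have H := is_deriveN (is_derive1_comp (is_derive_expR (- r)) (is_deriveNid r 1)).
  by apply: (is_derive_eq H); rewrite expr0 mul1r mulrN1 opprK.
have H := is_deriveD (is_deriveN (is_deriveM (DeriveDef (@exprn_derivable R m.+1 r 1) (exp_derive m.+1 r 1))
  (is_derive1_comp (is_derive_expR (- r)) (is_deriveNid r 1)))) (is_deriveZ m.+1%:R IHm).
apply: (is_derive_eq H) => /=.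
rewrite /GRing.scale /= ; ring.
Qed.

Lemma cvg_exprM_expRN m : (fun r : R => r ^+ m * expR (- r)) @ +oo --> (0 : R).
Proof.
apply: (@squeeze_cvgr _ _ _ _ (fun=> 0) (fun r => (m.+1)`!%:R * r^-1)).
- near=> r; have r0 : 0 < r by near: r; exact: nbhs_pinfty_gt.
  rewrite mulr_ge0 ?exprn_ge0 ?expR_ge0 ?(ltW r0)//= expRN.
  rewrite ler_pdivrMr ?expR_gt0// mulrAC ler_pdivlMr// -exprSr.
  have : r ^+ m.+1 / (m.+1)`!%:R <= expR r by apply: le_trans (expR_ge1Dxn m (ltW r0)); rewrite lerDr.
  by rewrite ler_pdivrMr ?ltr0n ?fact_gt0// mulrC.
- exact: cvg_cst.
- rewrite -[X in _ --> X](mulr0 (m.+1)`!%:R); apply: cvgMr.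
  exact: (gtr0_cvgV0 (nbhs_pinfty_gt (num_real 0))).2 cvg_id.
Unshelve. all: by end_near.
Qed.

Lemma cvg_gamma_primitive m : gamma_primitive m r @[r --> +oo] --> (0 : R).
Proof.
elim: m => [|m IHm] /=.
  rewrite -oppr0; apply: cvgN; exact: cvgr_expR.
rewrite -[X in _ --> X](addr0 0) -{1}oppr0 -[X in _ + X](mulr0 m.+1%:R).
apply: cvgD; first by apply: cvgN; exact: cvg_exprM_expRN.
exact: cvgMr.
Qed.

Lemma gamma_primitive0 m : gamma_primitive m (0 : R) = - m`!%:R.
Proof.
elim: m => [|m IHm] /=; first by rewrite oppr0 expR0.
by rewrite IHm expr0n/= mul0r oppr0 add0r mulrN -natrM -factS.
Qed.

Local Open Scope ereal_scope.

Lemma integral_gamma1 m :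
  \int[mu]_(r in `]0%R, +oo[) (r ^+ m * expR (- r))%:E = m`!%:R%:E.
Proof.
have cont : continuous (fun r : R => (r ^+ m * expR (- r))%R).
  move=> x; apply: cvgM; first exact: exprn_continuous.
  by apply: continuous_comp; [exact: opp_continuous|exact: continuous_expR].
rewrite integral_itv_obnd_cbnd; last first.
  apply/measurable_EFinP; apply: measurable_funTS.
  exact: continuous_measurable_fun.
rewrite (@ge0_continuous_FTC2y _ _ (gamma_primitive m) _ 0%R).
- by rewrite gamma_primitive0 EFinN oppeK add0e.
- by move=> x x0; rewrite mulr_ge0 ?exprn_ge0 ?expR_ge0.
- by apply: continuous_subspaceT.
- exact: cvg_gamma_primitive.
- by move=> x _; have [] := is_derive_gamma_primitive m x.
- apply: cvg_at_right_filter.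
  have /derivable1_diffP/differentiable_continuous : derivable (gamma_primitive m) 0%R 1
    by have [] := is_derive_gamma_primitive m 0.
  by [].
- by move=> x _; rewrite derive1E (@derive_val _ _ _ _ _ _ _ (is_derive_gamma_primitive m x)).
Qed.

Lemma integral_gamma m (t : R) : (0 < t)%R ->
  \int[mu]_(r in `]0%R, +oo[) (r ^+ m * expR (- (t * r)))%:E = (m`!%:R / t ^+ m.+1)%:E.
Proof.
move=> t0; have := integral_gamma1 m.
have mf : measurable_fun setT (fun r : R => (r ^+ m * expR (- r))%R).
  apply: continuous_measurable_fun => x; apply: cvgM; first exact: exprn_continuous.
  by apply: continuous_comp; [exact: opp_continuous|exact: continuous_expR].
have mft : measurable_fun setT (fun r : R => (r ^+ m * expR (- (t * r)))%R).
  apply: measurable_funM; first exact: exprn_measurable.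
  by apply: measurableT_comp => //; apply: measurableT_comp => //; apply: measurable_funM.
rewrite integral_mkcond (@integral_affine _ _ t 0); first last.
- move=> x; rewrite /patch; case: ifPn => //; rewrite inE/= in_itv/= andbT => x0.
  by rewrite lee_fin mulr_ge0 ?exprn_ge0 ?expR_ge0 ?ltW.
- apply: (measurable_restrictT _ (measurable_itv _)).1; apply/measurable_EFinP.
  exact: measurable_funTS.
- by rewrite gt_eqF.
rewrite gtr0_norm// => H.
rewrite integral_mkcond.
have := congr1 (fun z => (t ^+ m.+1)^-1%:E * z) H.
rewrite muleA -EFinM => {H}.
rewrite -ge0_integralZl//; first last.
- by rewrite lee_fin mulr_ge0 ?invr_ge0 ?exprn_ge0 ?(ltW t0).
- move=> x _; rewrite /patch; case: ifPn => //; rewrite inE/= in_itv/= andbT => x0.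
  by rewrite lee_fin mulr_ge0 ?exprn_ge0 ?expR_ge0 ?ltW.
- apply: measurableT_comp; last by apply: measurable_funD => //; apply: measurable_funM.
  apply: (measurable_restrictT _ (measurable_itv _)).1; apply/measurable_EFinP.
  exact: measurable_funTS.
rewrite -EFinM [(_ * m`!%:R)%R]mulrC => <-.
apply: eq_integral => x _; rewrite /patch addr0.
have -> : ((t * x)%R \in `]0%R, +oo[%classic) = (x \in `]0%R, +oo[%classic).
  by apply/idP/idP; rewrite !inE/= !in_itv/= !andbT pmulr_rgt0.
case: ifPn => [_|_]; last by rewrite mule0.
rewrite -EFinM; congr EFin; rewrite exprMn exprS; field.
by rewrite expf_neq0 ?gt_eqF.
Qed.

(** The indicator of [r <= t] is the radial profile of a cap, as the exponential in [integral_gamma]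
    is that of the Laplace transform. *)
Lemma integral_exprn m (t : R) : (0 < t)%R ->
  \int[mu]_(r in `]0%R, +oo[) (r ^+ m * (r <= t :> R)%R%:R)%:E = (t ^+ m.+1 / m.+1%:R)%:E.
Proof.
move=> t0.
transitivity (\int[mu]_(r in `]0%R, t]) (r ^+ m)%:E).
  rewrite integral_mkcond [RHS]integral_mkcond; apply: eq_integral => x _.
  rewrite /patch !mem_setE !in_itv/= andbT; case: ifPn => //= x0.
  by case: leP; rewrite /= ?mulr1 ?mulr0.
have ce n : continuous (fun r : R => r ^+ n)%R by exact: exprn_continuous.
rewrite integral_itv_obnd_cbnd; last first.
  by apply/measurable_EFinP; apply: measurable_funTS; exact: exprn_measurable.
rewrite (@continuous_FTC2 _ _ (fun r => r ^+ m.+1 / m.+1%:R)%R)//.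
- by rewrite expr0n/= mul0r sube0.
- exact: continuous_subspaceT.
- split.
  + by move=> x _; apply: derivableM => //; exact: exprn_derivable.
  + by apply: cvg_at_right_filter; apply: cvgMl; exact: ce.
  + by apply: cvg_at_left_filter; apply: cvgMl; exact: ce.
- move=> x _; rewrite derive1E deriveM//=; last exact: exprn_derivable.
  by rewrite exp_derive derive_cst scaler0 add0r /GRing.scale /= mulr1 mulrA mulVf ?mul1r.
Qed.

End gamma_integrals.

(** * Slicing a cone by the level sets of a functional *)

Section polar.
Context {R : realType} {n : nat}.
Local Notation mu := (@lebesgue_measure R).
Implicit Types (C : set 'rV[R]_n.+1) (u x : 'rV[R]_n.+1).

Lemma measurable_dotr m (u : 'rV[R]_m) : measurable_fun setT (dotr u).
Proof.
rewrite /dotr; apply: measurable_sum => i; apply: measurable_funM => //.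
exact: measurable_rV_coord.
Qed.

Lemma dotrZr m (u x : 'rV[R]_m) (a : R) : dotr u (a *: x) = a * dotr u x.
Proof. by rewrite /dotr mulr_sumr; apply: eq_bigr => i _; rewrite mxE mulrCA. Qed.

Lemma dotrZl m (u x : 'rV[R]_m) (a : R) : dotr (a *: u) x = a * dotr u x.
Proof. by rewrite /dotr mulr_sumr; apply: eq_bigr => i _; rewrite mxE mulrA. Qed.

Lemma dotrDr m (u x y : 'rV[R]_m) : dotr u (x + y) = dotr u x + dotr u y.
Proof. by rewrite /dotr -big_split; apply: eq_bigr => i _; rewrite mxE mulrDr. Qed.

Lemma dotrDl m (u v x : 'rV[R]_m) : dotr (u + v) x = dotr u x + dotr v x.
Proof. by rewrite /dotr -big_split; apply: eq_bigr => i _; rewrite mxE mulrDl. Qed.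

Lemma dotrC m (u x : 'rV[R]_m) : dotr u x = dotr x u.
Proof. by apply: eq_bigr => i _; rewrite mulrC. Qed.

Lemma dotr0 m (u : 'rV[R]_m) : dotr u 0 = 0.
Proof. by rewrite /dotr big1// => i _; rewrite mxE mulr0. Qed.

Lemma measurable_exprM m (h : R -> R) : measurable_fun setT h ->
  measurable_fun setT (fun r : R => r ^+ m * h r).
Proof. by move=> mh; apply: measurable_funM => //; exact: exprn_measurable. Qed.

(** [hyperplane_chart] at height [r] instead of 1, so that the height can become an integration
    variable. *)
Definition affine_chart u (j : 'I_n.+1) (r : R) (y : 'rV[R]_n) : 'rV[R]_n.+1 :=
  rV_insert j ((r - \sum_i u ord0 (lift j i) * y ord0 i) / u ord0 j) y.

Lemma affine_chartZ u j (r : R) (y : 'rV[R]_n) :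
  affine_chart u j r (r *: y) = r *: hyperplane_chart u j y.
Proof.
apply/rowP => i; rewrite !mxE; case: unlift => [i'|]; first by rewrite !mxE.
rewrite mulrA mulrBr mulr1 mulr_sumr; congr (_ / _); congr (_ - _).
by apply: eq_bigr => k _; rewrite !mxE mulrCA.
Qed.

Lemma dotr_insert u (j : 'I_n.+1) (a : R) (y : 'rV[R]_n) :
  dotr u (rV_insert j a y) = u ord0 j * a + \sum_i u ord0 (lift j i) * y ord0 i.
Proof.
rewrite /dotr (bigD1_ord j)//= mxE unlift_none; congr (_ + _).
by apply: eq_bigr => i _; rewrite mxE liftK.
Qed.

Lemma dotr_affine_chart u j (r : R) (y : 'rV[R]_n) : u ord0 j != 0 ->
  dotr u (affine_chart u j r y) = r.
Proof. by move=> uj; rewrite dotr_insert mulrC divfK// subrK. Qed.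

Lemma measurable_affine_chart u j : measurable_fun setT
  (fun p : measurableTypeR R * 'rV[R]_n => affine_chart u j p.1 p.2).
Proof.
pose g (p : measurableTypeR R * 'rV[R]_n) : measurableTypeR R * 'rV[R]_n :=
  ((p.1 - \sum_i u ord0 (lift j i) * p.2 ord0 i) / u ord0 j, p.2).
apply: (measurableT_comp (@measurable_rV_insert R n j) (g := g)).
apply/measurable_fun_pairP; split; last exact: measurable_snd.
apply: measurable_funM => //; apply: measurable_funB; first exact: measurable_fst.
apply: measurable_sum => i; apply: measurable_funM => //.
exact: (measurableT_comp (@measurable_rV_coord R n i)).
Qed.

Lemma measurable_hyperplane_chart u j : measurable_fun setT (hyperplane_chart u j).
Proof.
exact: (measurableT_comp (measurable_affine_chart u j) (pair1_measurable (1 : measurableTypeR R))).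
Qed.

Local Open Scope ereal_scope.

(** The slice of the cone at height [r] is [r] times the slice at height 1, whence the Jacobian
    [r ^+ n]; exchanging the [j]-th coordinate for the height costs [1 / |u_j|]. *)
Lemma integral_cone_polar C u j (F : 'rV[R]_n.+1 -> \bar R) :
  measurable C -> is_cone C -> strict_dual C u -> u ord0 j != 0%R ->
  measurable_fun C F -> (forall x, C x -> 0 <= F x) ->
  \int[lebesgue_rV n.+1]_(x in C) F x =
  (`|u ord0 j|^-1)%:E * \int[mu]_(r in `]0%R, +oo[) ((r ^+ n)%:E *
    \int[lebesgue_rV n]_(y in hyperplane_chart u j @^-1` C) F (r *: hyperplane_chart u j y)).
Proof.
move=> mC coneC uC uj mF F0.
rewrite integral_mkcond; set G := F \_ C.
have mG : measurable_fun setT G := (measurable_restrictT F mC).1 mF.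
have G0 x : 0 <= G x by rewrite /G /patch; case: ifPn => //; rewrite inE => /F0.
have mGP : measurable_fun setT (fun p : measurableTypeR R * 'rV[R]_n => G (affine_chart u j p.1 p.2)).
  by apply: measurableT_comp => //; exact: measurable_affine_chart.
rewrite (integral_rV_insert j)//.
(* Change of variable in the [j]-th coordinate, from its value to the height [dotr u x]. *)
under eq_integral => y _.
  rewrite (@integral_affine _ _ (u ord0 j)^-1 (- ((\sum_i u ord0 (lift j i) * y ord0 i) / u ord0 j)))//; first last.
  - apply: measurableT_comp => //.
    exact: (measurableT_comp (@measurable_rV_insert R n j) (measurable_pair2 y)).
  - by rewrite invr_eq0.
  rewrite normfV.
  under eq_integral => r _.
    rewrite [(_^-1 * r)%R]mulrC -mulrBl -/(affine_chart u j r y).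
    over.
  over.
rewrite ge0_integralZl//; first last.
- by move=> y _; exact: integral_ge0.
- exact: (measurable_fun_fubini_tonelli_G
    (fun p : measurableTypeR R * 'rV[R]_n => G (affine_chart u j p.1 p.2))).
congr *%E.
rewrite -(fubini_tonelli (fun p : measurableTypeR R * 'rV[R]_n => G (affine_chart u j p.1 p.2)))//.
have mFF := measurable_fun_fubini_tonelli_F (m2 := lebesgue_rV n)
  (fun p : measurableTypeR R * 'rV[R]_n => G (affine_chart u j p.1 p.2)) mGP (fun p => G0 _).
(* Slices at negative height miss the cone, since [u] is nonnegative on it. *)
transitivity (\int[mu]_(r in `[0%R, +oo[) \int[lebesgue_rV n]_y G (affine_chart u j r y)).
  rewrite [RHS]integral_mkcond; apply: eq_integral => r _.
  rewrite /patch mem_setE in_itv/= andbT; case: leP => // r0.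
  rewrite /= integral0_eq// => y _; rewrite /G /patch; case: ifPn => //.
  rewrite inE => Cx; have := dotr_affine_chart r y uj.
  have [->|/(uC _ Cx)] := eqVneq (affine_chart u j r y) 0%R.
    by rewrite dotr0 => E; rewrite -E ltxx in r0.
  by move=> /[swap] -> /ltW; rewrite leNgt r0.
rewrite -integral_itv_obnd_cbnd; last exact: measurable_funTS.
apply: eq_integral => r; rewrite inE/= in_itv/= andbT => r0.
rewrite (integral_rV_scale r0)//; last first.
  exact: (measurableT_comp mGP (measurable_pair1 r)).
congr *%E; rewrite [RHS]integral_mkcond; apply: eq_integral => y _.
rewrite affine_chartZ /G /patch.
have -> // : (r *: hyperplane_chart u j y \in C) = (y \in hyperplane_chart u j @^-1` C).
apply/idP/idP; rewrite !inE/=.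
  move=> /(coneC r^-1%R); rewrite scalerA mulVf ?gt_eqF// scale1r; apply.
  by rewrite invr_ge0 ltW.
by apply: coneC; exact: ltW.
Qed.

(** The radial profile [h] enters only through a one-dimensional integral. Hence the moments of a
    cap, of the exponential weight and of the section are proportional, which links [q] to
    [laplace]. *)
Lemma integral_cone_homog C u j (h : R -> R) (g : 'rV[R]_n.+1 -> R) (i : nat) :
  measurable C -> is_cone C -> strict_dual C u -> u ord0 j != 0%R ->
  measurable_fun setT h -> (forall r, 0 <= h r)%R ->
  measurable_fun setT g -> (forall x, C x -> 0 <= g x)%R ->
  (forall r x, g (r *: x) = r ^+ i * g x)%R ->
  \int[lebesgue_rV n.+1]_(x in C) (g x * h (dotr u x))%:E =
  (`|u ord0 j|^-1)%:E * (\int[mu]_(r in `]0%R, +oo[) (r ^+ (n + i) * h r)%:E *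
    \int[lebesgue_rV n]_(y in hyperplane_chart u j @^-1` C) (g (hyperplane_chart u j y))%:E).
Proof.
move=> mC coneC uC uj mh h0 mg g0 gZ.
have mchart := measurable_hyperplane_chart u j.
have mS : measurable (hyperplane_chart u j @^-1` C).
  by rewrite -[X in measurable X]setTI; exact: mchart.
rewrite (integral_cone_polar mC coneC uC uj); first last.
- by move=> x Cx; rewrite lee_fin mulr_ge0 ?g0.
- apply/measurable_EFinP; apply: measurable_funTS; apply: measurable_funM => //.
  by apply: measurableT_comp => //; exact: measurable_dotr.
congr *%E; rewrite -ge0_integralZr//; first last.
- by apply: integral_ge0 => y Sy; rewrite lee_fin g0.
- move=> r; rewrite /= in_itv/= andbT => r0.
  by rewrite lee_fin mulr_ge0// exprn_ge0// ltW.
- apply/measurable_EFinP; apply: measurable_funTS.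
  exact: measurable_exprM.
apply: eq_integral => r; rewrite inE/= in_itv/= andbT => r0.
rewrite exprD -mulrA EFinM -muleA; congr *%E.
rewrite -ge0_integralZl//; first last.
- by rewrite lee_fin mulr_ge0// exprn_ge0// ltW.
- by move=> y Sy; rewrite lee_fin g0.
- by apply/measurable_EFinP; apply: measurable_funTS; apply: measurableT_comp.
apply: eq_integral => y _; rewrite -EFinM gZ dotrZr -[hyperplane_chart u j y]/(affine_chart u j 1 y).
by rewrite dotr_affine_chart// mulr1 mulrAC.
Qed.

End polar.

(** * Geometry of pointed cones *)

Section dotr_theory.
Context {R : realType} {m : nat}.
Implicit Types (u v x y : 'rV[R]_m).

Lemma dotr0l x : dotr 0 x = 0.
Proof. by rewrite dotrC dotr0. Qed.

Lemma dotrNl u x : dotr (- u) x = - dotr u x.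
Proof. by rewrite -scaleN1r dotrZl mulN1r. Qed.

Lemma dotrNr u x : dotr u (- x) = - dotr u x.
Proof. by rewrite -scaleN1r dotrZr mulN1r. Qed.

Lemma dotrBl u v x : dotr (u - v) x = dotr u x - dotr v x.
Proof. by rewrite dotrDl dotrNl. Qed.

Lemma dotrBr u x y : dotr u (x - y) = dotr u x - dotr u y.
Proof. by rewrite dotrDr dotrNr. Qed.

Lemma dotr_suml (I : Type) (r : seq I) (f : I -> 'rV[R]_m) x :
  dotr (\sum_(i <- r) f i) x = \sum_(i <- r) dotr (f i) x.
Proof.
elim: r => [|i r IH]; first by rewrite !big_nil dotr0l.
by rewrite !big_cons dotrDl IH.
Qed.

Lemma dotr_sqrD x y (t : R) : dotr (x + t *: y) (x + t *: y) =
  dotr x x + (2 * t * dotr x y + t ^+ 2 * dotr y y).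
Proof. rewrite !dotrDl !dotrDr !dotrZl !dotrZr (dotrC y x); ring. Qed.

Lemma dotr_delta i x : dotr (delta_mx 0 i) x = x ord0 i.
Proof.
rewrite /dotr (bigD1 i)//= !mxE !eqxx mul1r big1 ?addr0// => k ki.
by rewrite !mxE (negbTE ki) andbF mul0r.
Qed.

Lemma coord_le_norm x i : `|x ord0 i| <= `|x|.
Proof.
rewrite [leRHS]/Num.Def.normr /= mx_normrE.
exact: (le_bigmax _ (fun ij : 'I_1 * 'I_m => `|x ij.1 ij.2|) (ord0, i)).
Qed.

(** The norm on row vectors is the sup norm; this is its dual, used to measure functionals. *)
Definition norm1 u : R := \sum_i `|u ord0 i|.

Lemma norm1_ge0 u : 0 <= norm1 u.
Proof. exact: sumr_ge0. Qed.

Lemma dotr_le_norm u x : `|dotr u x| <= norm1 u * `|x|.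
Proof.
rewrite /dotr /norm1 mulr_suml; apply: (le_trans (ler_norm_sum _ _ _)).
by apply: ler_sum => i _; rewrite normrM ler_wpM2l// coord_le_norm.
Qed.

Lemma dotrr_ge0 x : 0 <= dotr x x.
Proof. by apply: sumr_ge0 => i _; rewrite -expr2 sqr_ge0. Qed.

Lemma dotrr_gt0 x : x != 0 -> 0 < dotr x x.
Proof.
move=> x0; rewrite lt_def dotrr_ge0 andbT; apply: contra_neq x0 => /eqP.
rewrite psumr_eq0 => [/allP H|i _]; last by rewrite -expr2 sqr_ge0.
apply/rowP => i; rewrite mxE; apply/eqP; have := H i (mem_index_enum _).
by rewrite /= mulf_eq0 orbb.
Qed.

Lemma norm_sqr_le_dotrr x : `|x| ^+ 2 <= dotr x x.
Proof.
suff H (t : R) : 0 <= t -> (forall i, `|x ord0 i| <= t) -> `|x| <= t.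
  rewrite -(@sqr_sqrtr _ (dotr x x)) ?dotrr_ge0// ler_sqr ?nnegrE ?sqrtr_ge0//.
  apply: H => [|i]; first exact: sqrtr_ge0.
  rewrite -sqrtr_sqr ler_sqrt ?dotrr_ge0//.
  rewrite /dotr (bigD1 i)//= expr2 lerDl.
  by apply: sumr_ge0 => k _; rewrite -expr2 sqr_ge0.
move=> t0 H; rewrite [leLHS]/Num.Def.normr /= mx_normrE; apply/bigmax_leP; split=> //.
by move=> [i j] _ /=; rewrite (ord1 i).
Qed.

Lemma continuous_dotr u : continuous (dotr u).
Proof.
apply: (continuous_big (@add_continuous R^o)) => i _ x.
by apply: continuousM; [exact: cst_continuous|exact: coord_continuous].
Qed.

End dotr_theory.

Section cone_geometry.
Context {R : realType} {m : nat}.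
Variable C : set 'rV[R]_m.
Hypotheses (C_closed : closed C) (C_convex : convex_set C) (C_cone : is_cone C)
  (C_pointed : contains_no_line C) (C_solid : interior C !=set0).
Implicit Types (u v x y : 'rV[R]_m).

Lemma cone0 : C 0.
Proof.
have [x /interior_subset Cx] := C_solid.
by have := C_cone (lexx 0) Cx; rewrite scale0r.
Qed.

Lemma coneD x y : C x -> C y -> C (x + y).
Proof.
move=> Cx Cy.
have h0 : 0 <= (2^-1 : R) by rewrite invr_ge0.
have h1 : (2^-1 : R) <= 1 by rewrite invf_le1// ler1n.
have /= := C_convex (Itv01 h0 h1) (mem_set Cx) (mem_set Cy).
rewrite inE => /(C_cone (ler0n _ 2)).
rewrite /conv /= /unstable.onem scalerDr !scalerA divff// scale1r.
have -> : 2 * (1 - 2^-1) = 1 :> R by field.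
by rewrite scale1r.
Qed.

Lemma coneN x : C x -> C (- x) -> x = 0.
Proof.
move=> Cx CNx; apply/eqP/negPn/negP => x0; apply: (C_pointed (p := 0) x0) => t.
rewrite add0r; have [t0|t0] := leP 0 t; first exact: C_cone.
by rewrite -[t]opprK scaleNr -scalerN; apply: C_cone => //; rewrite oppr_ge0 ltW.
Qed.

Definition unit_section : set 'rV[R]_m := C `&` [set x | `|x| = 1].

Lemma unit_section_compact : compact unit_section.
Proof.
apply: bounded_closed_compact.
  by exists 1; split=> // M M1 x [_ /= ->]; exact: ltW.
apply: closedI => //.
rewrite (_ : mkset _ = (@Num.Def.normr R 'rV[R]_m) @^-1` [set 1]); last by [].
apply: preimage_closed; last exact: closed_eq.
by move=> x _; exact: norm_continuous.
Qed.

Lemma unit_section_neq0 x : unit_section x -> x != 0.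
Proof. by move=> [_ /= x1]; rewrite -normr_eq0 x1 oner_neq0. Qed.

(** The functional attains a positive minimum on the compact [unit_section], and homogeneity does
    the rest. *)
Lemma strict_dual_coercive u : strict_dual C u ->
  exists2 k : R, 0 < k & forall x, C x -> k * `|x| <= dotr u x.
Proof.
move=> uC.
suff [k k0 H] : exists2 k : R, 0 < k & forall x, unit_section x -> k <= dotr u x.
  exists k => // x Cx; have [->|x0] := eqVneq x 0; first by rewrite normr0 mulr0 dotr0.
  have nx : 0 < `|x| by rewrite normr_gt0.
  have /H : unit_section (`|x|^-1 *: x).
    split; first by apply: C_cone => //; rewrite invr_ge0.
    by rewrite /= normrZ ger0_norm ?invr_ge0// mulVf// gt_eqF.
  by rewrite dotrZr ler_pdivlMl// mulrC.
have [E|/set0P[x0 Sx0]] := eqVneq unit_section set0.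
  by exists 1 => // x; rewrite E.
have [c /set_mem Sc Hc] := EVT_min_rV (ex_intro _ _ Sx0) unit_section_compact
  (continuous_subspaceT (@continuous_dotr _ _ u)).
exists (dotr u c); first by apply: uC; [case: Sc|exact: unit_section_neq0].
by move=> x Sx; apply: Hc; exact: mem_set.
Qed.

Lemma coercive_strict_dual u (k : R) : 0 < k ->
  (forall x, C x -> k * `|x| <= dotr u x) -> strict_dual C u.
Proof.
move=> k0 H x Cx x0; apply: lt_le_trans (H _ Cx).
by rewrite mulr_gt0// normr_gt0.
Qed.

Lemma strict_dual_ge0 u x : strict_dual C u -> C x -> 0 <= dotr u x.
Proof.
move=> uC Cx; have [->|x0] := eqVneq x 0; first by rewrite dotr0.
exact/ltW/uC.
Qed.

Definition dual_cone : set 'rV[R]_m := [set w | forall x, C x -> 0 <= dotr w x].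

(** First-order optimality condition, for perturbations of a minimiser in a one-sided direction. *)
Lemma lin_quad_ge0 (a b : R) :
  (forall t, 0 < t -> t <= 1 -> 0 <= 2 * t * a + t ^+ 2 * b) -> 0 <= a.
Proof.
move=> H; rewrite leNgt; apply/negP => a0.
pose t := Num.min 1 (- a / (`|b| + 1)).
have b0 : 0 < `|b| + 1 by rewrite ltr_wpDl.
have t0 : 0 < t by rewrite lt_min ltr01 divr_gt0// oppr_gt0.
have t1 : t <= 1 by rewrite ge_min lexx.
have := H _ t0 t1.
have tb : t * b <= - a.
  apply: (@le_trans _ _ (t * (`|b| + 1))).
    by rewrite ler_pM2l// (le_trans (ler_norm _))// lerDl.
  by rewrite -ler_pdivlMr// ge_min lexx orbT.
have : 2 * t * a + t ^+ 2 * b = t * (2 * a + t * b) by ring.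
move=> ->; rewrite pmulr_rge0//; lra.
Qed.

(* Separates [- x] from [C]: the functional is the gap between [- x] and its projection. *)
Lemma dual_cone_separates x : C x -> x != 0 -> exists2 w, dual_cone w & 0 < dotr w x.
Proof.
move=> Cx x0.
pose N z := dotr (z + x) (z + x).
have cN : continuous N.
  apply: (continuous_big (@add_continuous R^o)) => i _ z.
  have cz : {for z, continuous (fun z : 'rV[R]_m => (z + x) ord0 i)}.
    rewrite (_ : (fun _ => _) = (fun z : 'rV[R]_m => z ord0 i + x ord0 i)).
      by apply: continuousD; [exact: coord_continuous|exact: cst_continuous].
    by apply/funext => y; rewrite mxE.
  exact: continuousM.
(* Restricting to a sublevel set makes the domain compact; it contains 0, so a minimum over it is a
   minimum over [C]. *)
pose K := C `&` [set z | N z <= dotr x x].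
have K0 : K 0 by split; [exact: cone0|rewrite /N /= add0r].
have cK : compact K.
  apply: bounded_closed_compact.
    exists (`|x| + dotr x x + 1); split=> [|M MM z [_ /= Hz]]; first exact: num_real.
    apply: (le_trans _ (ltW MM)); rewrite -[z](addrK x) (le_trans (ler_normB _ _))//.
    rewrite addrC -addrA lerD2l.
    have := le_trans (norm_sqr_le_dotrr (z + x)) Hz.
    have := normr_ge0 (z + x); move: (`|z + x|) (dotr x x) => a b; nra.
  apply: closedI => //.
  rewrite (_ : mkset _ = N @^-1` [set y | y <= dotr x x]); last by [].
  by apply: preimage_closed; [move=> z _; exact: cN|exact: closed_le].
have [z /set_mem[Cz Nz] Hz] := EVT_min_rV (ex_intro _ _ K0) cK (continuous_subspaceT cN).
have Nmin y : C y -> N z <= N y.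
  move=> Cy; have [Ny|/ltW Ny] := leP (N y) (dotr x x); last exact: le_trans Ny.
  by apply: Hz; apply: mem_set.
pose w := z + x.
have w0 : w != 0.
  apply: contra_neq x0 => /eqP; rewrite addr_eq0 => /eqP zx; apply: coneN => //.
  by rewrite -zx.
have NE y t : N (z + t *: y) = N z + (2 * t * dotr w y + t ^+ 2 * dotr y y).
  by rewrite /N addrAC dotr_sqrD.
exists w.
  move=> y Cy; apply: (@lin_quad_ge0 _ (dotr y y)) => t t0 t1.
  have := Nmin (z + t *: y) (coneD Cz (C_cone (ltW t0) Cy)).
  by rewrite NE lerDl.
(* Moving [z] towards the apex stays in [C]; the optimality of [z] in this direction gives the
   sign. *)
have wz : dotr w z <= 0.
  rewrite -oppr_ge0 -dotrNr; apply: (@lin_quad_ge0 _ (dotr (- z) (- z))) => t t0 t1.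
  have : C (z + t *: - z).
    rewrite scalerN -scaleNr -{1}[z]scale1r -scalerDl; apply: C_cone => //.
    by rewrite subr_ge0.
  by move=> /Nmin; rewrite NE lerDl.
have -> : x = w - z by rewrite /w addrAC subrr add0r.
by rewrite dotrBr subr_gt0 (le_lt_trans wz)// dotrr_gt0.
Qed.

(** The half-spaces where some element of the dual cone is positive cover the compact
    [unit_section]; the sum over a finite subcover is positive on all of it. *)
Lemma strict_dual_nonempty : strict_dual C !=set0.
Proof.
have : cover_compact unit_section.
  by have := unit_section_compact; rewrite compact_cover.
move=> /(_ _ dual_cone (fun w => [set y | 0 < dotr w y])) [].
- move=> w _; apply: (@open_comp _ _ (dotr w) [set y | 0 < y]); last exact: open_gt.
  by move=> x _; exact: continuous_dotr.
- move=> x Sx; have [|w wC wx] := dual_cone_separates (x := x) Sx.1.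
    exact: unit_section_neq0.
  by exists w.
move=> D DC cov.
exists (\sum_(w <- D) w) => x Cx x0.
have nx : 0 < `|x| by rewrite normr_gt0.
rewrite dotr_suml.
have Sx : unit_section (`|x|^-1 *: x).
  split; first by apply: C_cone => //; rewrite invr_ge0.
  by rewrite /= normrZ ger0_norm ?invr_ge0// mulVf// gt_eqF.
have [w /= wD] := cov _ Sx; rewrite dotrZr pmulr_rgt0 ?invr_gt0// => wx.
rewrite (big_fsetD1 w)//= ltr_pwDl// big_seq sumr_ge0// => v.
by rewrite in_fsetD1 => /andP[_ /DC/set_mem]; apply.
Qed.

(** A perturbation of size half the coercivity constant uses up at most half of it. *)
Lemma strict_dual_ball u : strict_dual C u ->
  exists2 e : R, 0 < e & forall v, norm1 v <= e -> strict_dual C (u + v).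
Proof.
move=> /strict_dual_coercive[k k0 H]; exists (k / 2); first by rewrite divr_gt0.
move=> v ve; apply: (@coercive_strict_dual _ (k / 2)); first by rewrite divr_gt0.
move=> x Cx; rewrite dotrDl.
have := H _ Cx; have := dotr_le_norm v x.
have : norm1 v * `|x| <= k / 2 * `|x| by rewrite ler_wpM2r.
rewrite ler_norml; move: (normr_ge0 x) => n0 h1 /andP[h2 _] h3.
have : k * `|x| = k / 2 * `|x| + k / 2 * `|x| by field.
lra.
Qed.

End cone_geometry.

(** * Integrals of linear functions over a cone *)

Section moments.
Context {R : realType} {n : nat}.
Local Notation mu := (@lebesgue_measure R).
Variable C : set 'rV[R]_n.+1.
Hypotheses (C_closed : closed C) (C_convex : convex_set C) (C_cone : is_cone C)
  (C_pointed : contains_no_line C) (C_solid : interior C !=set0).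
Implicit Types (u v x e : 'rV[R]_n.+1).

Let mC : measurable C. Proof. exact: closed_measurable_rV. Qed.

Definition chart_domain u j : set 'rV[R]_n := hyperplane_chart u j @^-1` C.

Lemma measurable_chart_domain u j : measurable (chart_domain u j).
Proof.
by rewrite -[X in measurable X]setTI; exact: measurable_hyperplane_chart.
Qed.

Lemma dotr_hyperplane_chart u j (y : 'rV[R]_n) : u ord0 j != 0 -> dotr u (hyperplane_chart u j y) = 1.
Proof. exact: dotr_affine_chart. Qed.

(** Provides the coordinate that a chart eliminates: [u = 0] would force [C] to be reduced to 0,
    against solidity. *)
Lemma strict_dual_coord u : strict_dual C u -> exists j, u ord0 j != 0.
Proof.
move=> uC; apply: contrapT => H.
have u0 : u = 0.
  by apply/rowP => j; rewrite mxE; apply: contrapT => /eqP uj; apply: H; exists j.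
have H0 x' : C x' -> x' = 0.
  move=> Cx'; apply/eqP/negPn/negP => /(uC _ Cx').
  by rewrite u0 dotr0l ltxx.
have [z zi] := C_solid; have /nbhs_ballP[e /= e0 ze] := zi.
have z0 := H0 _ (interior_subset zi).
have : C (const_mx (e / 2)).
  apply: ze; rewrite /ball/= /mx_ball; split=> // i k.
  rewrite z0 /ball/= !mxE sub0r normrN gtr0_norm ?divr_gt0//; lra.
move=> /H0/rowP/(_ ord0); rewrite !mxE; lra.
Qed.

Local Open Scope ereal_scope.

(** Coercivity confines the section to a box of side [2 / k]. *)
Lemma chart_domain_fin u j : strict_dual C u -> u ord0 j != 0%R ->
  lebesgue_rV n (chart_domain u j) < +oo.
Proof.
move=> uC uj; have [k k0 H] := strict_dual_coercive C_closed C_cone uC.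
pose A (i : 'I_n) : set R := `[(- k^-1)%R, (k^-1)%R]%classic.
apply: (@le_lt_trans _ _ (lebesgue_rV n [set y | forall i, A i (y ord0 i)])).
  apply: le_measure; rewrite ?inE.
  - exact: measurable_chart_domain.
  - by apply: measurable_rV_box => i; exact: measurable_itv.
  move=> y /H; rewrite dotr_hyperplane_chart// => Hy i.
  rewrite /A /= in_itv/= -ler_norml.
  rewrite -div1r ler_pdivlMr// mulrC (le_trans _ Hy)// ler_pM2l//.
  have := coord_le_norm (hyperplane_chart u j y) (lift j i).
  by rewrite mxE liftK.
rewrite lebesgue_rV_box => [|i]; last exact: measurable_itv.
under eq_bigr => i _ do rewrite /A.
rewrite /= big_const_ord; elim: n => [|p IH]; first exact: ltry.
rewrite iterS lte_mul_pinfty//.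
rewrite ge0_fin_numE ?measure_ge0// lebesgue_measure_itv/=.
by case: ifP => _; rewrite ?ltry.
Qed.

Lemma integral_cone0 u j (h : R -> R) : strict_dual C u -> u ord0 j != 0%R ->
  measurable_fun setT h -> (forall r, 0 <= h r)%R ->
  \int[lebesgue_rV n.+1]_(x in C) (h (dotr u x))%:E =
  (`|u ord0 j|^-1)%:E * (\int[mu]_(r in `]0%R, +oo[) (r ^+ n * h r)%:E *
    lebesgue_rV n (chart_domain u j)).
Proof.
move=> uC uj mh h0.
have := integral_cone_homog (g := fun=> 1%R) (i := 0) mC C_cone uC uj mh h0.
under eq_integral do rewrite mul1r.
move=> -> //; last by move=> r x; rewrite expr0 mul1r.
rewrite addn0; congr (_ * (_ * _)).
by rewrite integral_cst ?mul1e//; exact: measurable_chart_domain.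
Qed.

Lemma dotr_bound u e : strict_dual C u ->
  exists2 c : R, (0 <= c)%R & forall x, C x -> (`|dotr e x| <= c * dotr u x)%R.
Proof.
move=> uC; have [k k0 H] := strict_dual_coercive C_closed C_cone uC.
exists (norm1 e / k)%R; first by rewrite divr_ge0 ?norm1_ge0 ?ltW.
move=> x Cx; apply: (le_trans (dotr_le_norm _ _)); rewrite -mulrA.
apply: ler_wpM2l; first exact: norm1_ge0.
by rewrite mulrC ler_pdivlMr// mulrC H.
Qed.

Lemma moment1_ge0 u j (h : R -> R) (H : R) e :
  strict_dual C u -> u ord0 j != 0%R ->
  measurable_fun setT h -> (forall r, 0 <= h r)%R ->
  \int[mu]_(r in `]0%R, +oo[) (r ^+ n.+1 * h r)%:E = H%:E ->
  (forall x, C x -> 0 <= dotr e x)%R ->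
  [/\ (lebesgue_rV n).-integrable (chart_domain u j)
        (EFin \o (fun y => dotr e (hyperplane_chart u j y))),
      (lebesgue_rV n.+1).-integrable C (EFin \o (fun x => (dotr e x * h (dotr u x))%R)) &
      (\int[lebesgue_rV n.+1]_(x in C) (dotr e x * h (dotr u x)) =
        `|u ord0 j|^-1 * H *
        \int[lebesgue_rV n]_(y in chart_domain u j) dotr e (hyperplane_chart u j y))%R].
Proof.
move=> uC uj mh h0 HH e0.
have mchart := measurable_hyperplane_chart u j.
have mS := measurable_chart_domain u j.
have mD1 : measurable_fun (chart_domain u j)
    (EFin \o (fun y => dotr e (hyperplane_chart u j y))).
  apply/measurable_EFinP; apply: measurable_funTS.
  by apply: measurableT_comp => //; exact: measurable_dotr.
have mD2 : measurable_fun C (EFin \o (fun x => (dotr e x * h (dotr u x))%R)).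
  apply/measurable_EFinP; apply: measurable_funTS.
  apply: measurable_funM; first exact: measurable_dotr.
  by apply: measurableT_comp => //; exact: measurable_dotr.
have E := integral_cone_homog (g := dotr e) (i := 1) mC C_cone uC uj mh h0
  (@measurable_dotr _ _ e) e0.
rewrite addn1 HH in E.
have {}E := E (fun r x => etrans (dotrZr e x r) (congr1 (fun a => a * dotr e x)%R (esym (expr1 r)))).
have [c c0 Hc] := dotr_bound e uC.
have I1 : \int[lebesgue_rV n]_(y in chart_domain u j) (dotr e (hyperplane_chart u j y))%:E < +oo.
  apply: (@le_lt_trans _ _ (\int[lebesgue_rV n]_(y in chart_domain u j) (cst c%:E y))).
    apply: ge0_le_integral => //.
    - by move=> y Sy; rewrite lee_fin e0.
    - move=> y Sy; rewrite lee_fin; apply: (le_trans (ler_norm _)).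
      by apply: (le_trans (Hc _ Sy)); rewrite dotr_hyperplane_chart// mulr1.
  rewrite integral_cst// lte_mul_pinfty ?lee_fin//; exact: chart_domain_fin.
have I10 : 0 <= \int[lebesgue_rV n]_(y in chart_domain u j) (dotr e (hyperplane_chart u j y))%:E.
  by apply: integral_ge0 => y Sy; rewrite lee_fin e0.
have I1f : \int[lebesgue_rV n]_(y in chart_domain u j) (dotr e (hyperplane_chart u j y))%:E \is a fin_num.
  by rewrite ge0_fin_numE.
split.
- apply/integrableP; split=> //.
  rewrite (eq_integral (fun y => (dotr e (hyperplane_chart u j y))%:E))// => y /[!inE] Sy.
  by rewrite /= ger0_norm// e0.
- apply/integrableP; split=> //.
  rewrite (eq_integral (fun x => (dotr e x * h (dotr u x))%:E)).
    by rewrite E -(fineK I1f) -!EFinM ltry.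
  by move=> x /[!inE] Cx; rewrite /= ger0_norm// mulr_ge0// e0.
- by rewrite /Rintegral E -[in LHS](fineK I1f) -!EFinM /= mulrA.
Qed.

(** The signed case follows from the nonnegative one by writing [e] as [(e + c u) - c u], with [c]
    from [dotr_bound] so large that both terms are nonnegative on [C]. *)
Lemma moment1 u j (h : R -> R) (H : R) e :
  strict_dual C u -> u ord0 j != 0%R ->
  measurable_fun setT h -> (forall r, 0 <= h r)%R ->
  \int[mu]_(r in `]0%R, +oo[) (r ^+ n.+1 * h r)%:E = H%:E ->
  [/\ (lebesgue_rV n).-integrable (chart_domain u j)
        (EFin \o (fun y => dotr e (hyperplane_chart u j y))),
      (lebesgue_rV n.+1).-integrable C (EFin \o (fun x => (dotr e x * h (dotr u x))%R)) &
      (\int[lebesgue_rV n.+1]_(x in C) (dotr e x * h (dotr u x)) =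
        `|u ord0 j|^-1 * H *
        \int[lebesgue_rV n]_(y in chart_domain u j) dotr e (hyperplane_chart u j y))%R].
Proof.
move=> uC uj mh h0 HH.
have [c c0 Hc] := dotr_bound e uC.
have u0 x : C x -> (0 <= dotr (c *: u) x)%R.
  by move=> Cx; rewrite dotrZl mulr_ge0// (strict_dual_ge0 uC Cx).
have w0 x : C x -> (0 <= dotr (e + c *: u) x)%R.
  move=> Cx; have := Hc _ Cx; rewrite dotrDl dotrZl ler_norml => /andP[]; lra.
have [A1 A2 A3] := moment1_ge0 uC uj mh h0 HH u0.
have [B1 B2 B3] := moment1_ge0 uC uj mh h0 HH w0.
have E1 : EFin \o (fun y => dotr e (hyperplane_chart u j y)) =
    (EFin \o (fun y => dotr (e + c *: u) (hyperplane_chart u j y))) \-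
    (EFin \o (fun y => dotr (c *: u) (hyperplane_chart u j y))).
  by apply/funext => y /=; rewrite -EFinB -dotrBl addrK.
have E2 : EFin \o (fun x => (dotr e x * h (dotr u x))%R) =
    (EFin \o (fun x => (dotr (e + c *: u) x * h (dotr u x))%R)) \-
    (EFin \o (fun x => (dotr (c *: u) x * h (dotr u x))%R)).
  by apply/funext => y /=; rewrite -EFinB -mulrBl -dotrBl addrK.
have mS := measurable_chart_domain u j.
split.
- by rewrite E1; exact: integrableB.
- by rewrite E2; exact: integrableB.
- transitivity (\int[lebesgue_rV n.+1]_(x in C) (dotr (e + c *: u) x * h (dotr u x) -
      dotr (c *: u) x * h (dotr u x)))%R.
    apply: eq_Rintegral; by move=> x _; rewrite -mulrBl -dotrBl addrK.
  rewrite RintegralB// A3 B3 -mulrBr; congr (_ * _)%R.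
  rewrite -RintegralB//; apply: eq_Rintegral => y _.
  by rewrite -dotrBl addrK.
Qed.

End moments.

(** * Laplace transform of a cone *)

Section lattice_boxes.
Context {R : realType} {m : nat}.
Implicit Types (v : 'rV[int]_m) (x u : 'rV[R]_m).

Definition floor_box v : set 'rV[R]_m :=
  [set x | forall i, `[(v ord0 i)%:~R, (v ord0 i)%:~R + 1[%classic (x ord0 i)].

Lemma measurable_floor_box v : measurable (floor_box v).
Proof.
by apply: (measurable_rV_box (A := fun i => `[_, _[%classic)) => i; exact: measurable_itv.
Qed.

Lemma lebesgue_floor_box v : lebesgue_rV m (floor_box v) = 1%E.
Proof.
rewrite (lebesgue_rV_box (A := fun i => `[(v ord0 i)%:~R, (v ord0 i)%:~R + 1[%classic));
  last by move=> i; exact: measurable_itv.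
rewrite big1// => i _; rewrite lebesgue_measure_itv/= lte_fin ltrDl ltr01.
by rewrite -EFinB addrAC subrr add0r.
Qed.

Lemma floor_boxP v x : floor_box v x -> v = \row_i Num.floor (x ord0 i).
Proof.
move=> vx; apply/rowP => i; rewrite mxE; apply/esym/floor_def.
by have := vx i; rewrite /= in_itv/= intrD.
Qed.

Lemma floor_box_floor x : floor_box (\row_i Num.floor (x ord0 i)) x.
Proof. by move=> i; rewrite /= mxE in_itv/= -intrD1 floor_itv. Qed.

Lemma trivIset_floor_box (D : set 'rV[int]_m) : trivIset D floor_box.
Proof.
by move=> v w _ _ [x [/floor_boxP -> /floor_boxP ->]].
Qed.

Lemma floor_box_norm v x : floor_box v x -> `|x - intvec v| <= 1.
Proof.
move=> vx; rewrite [leLHS]/Num.Def.normr /= mx_normrE; apply/bigmax_leP; split=> //.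
move=> [i j] _ /=; rewrite (ord1 i) !mxE.
have := vx j; rewrite /= in_itv/= => /andP[h1 h2].
by rewrite ler_norml; apply/andP; split; lra.
Qed.

Lemma floor_box_dotr u v x : floor_box v x ->
  `|dotr u x - dotr u (intvec v)| <= norm1 u.
Proof.
move=> /floor_box_norm vx; rewrite -dotrBr (le_trans (dotr_le_norm _ _))//.
by rewrite ler_piMr// norm1_ge0.
Qed.

Lemma measurable_expR_dotr u (D : set 'rV[R]_m) :
  measurable_fun D (EFin \o (fun x => expR (- dotr u x))).
Proof.
apply/measurable_EFinP; apply: measurable_funTS; apply: measurableT_comp => //.
by apply: measurableT_comp => //; exact: measurable_dotr.
Qed.

(** A floor box has volume 1 and [dotr u] varies on it by at most [norm1 u], so each summand is
    below the integral over its box. *)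
Lemma sum_expR_le_integral (C : set 'rV[R]_m) u (F : seq 'rV[int]_m) :
  measurable C -> uniq F -> (forall v, v \in F -> floor_box v `<=` C) ->
  (\sum_(v <- F) (expR (- dotr u (intvec v) - norm1 u))%:E <=
   \int[lebesgue_rV m]_(x in C) (expR (- dotr u x))%:E)%E.
Proof.
move=> mC uF FC.
apply: (@le_trans _ _ (\sum_(v <- F) \int[lebesgue_rV m]_(x in floor_box v) (expR (- dotr u x))%:E)%E).
  apply: lee_sum => v _.
  rewrite -[leLHS]mule1 -(lebesgue_floor_box v) -integral_cst; last exact: measurable_floor_box.
  apply: ge0_le_integral => //.
  - exact: measurable_floor_box.
  - by move=> x _; rewrite /= lee_fin expR_ge0.
  - exact: measurable_expR_dotr.
  - move=> x /(floor_box_dotr u); rewrite lee_fin ler_expR ler_norml => /andP[_]; lra.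
rewrite -ge0_integral_bigsetU//.
- apply: ge0_subset_integral => //.
  + by apply: bigsetU_measurable => v _; exact: measurable_floor_box.
  + exact: measurable_expR_dotr.
  + by move=> x; rewrite -bigcup_seq => -[v /= vF]; exact: FC.
- exact: measurable_floor_box.
- exact: trivIset_floor_box.
- exact: measurable_expR_dotr.
Qed.

End lattice_boxes.

Section laplace.
Context {R : realType} {n : nat}.
Variable C : set 'rV[R]_n.+1.
Hypotheses (C_closed : closed C) (C_convex : convex_set C) (C_cone : is_cone C)
  (C_pointed : contains_no_line C) (C_solid : interior C !=set0).
Implicit Types (u v x e : 'rV[R]_n.+1).

Let mC : measurable C. Proof. exact: closed_measurable_rV. Qed.

Definition laplace u : R := \int[lebesgue_rV n.+1]_(x in C) expR (- dotr u x).

(** Minus the derivative of [laplace] at [u] in the direction [e]. *)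
Definition laplace_moment u e : R :=
  \int[lebesgue_rV n.+1]_(x in C) (dotr e x * expR (- dotr u x)).

Let mexp (t : R) : measurable_fun setT (fun r : R => expR (- (t * r))).
Proof.
by apply: measurableT_comp => //; apply: measurableT_comp => //; exact: measurable_funM.
Qed.

Lemma integral_expR_chart u j (t : R) : 0 < t -> strict_dual C u -> u ord0 j != 0 ->
  (\int[lebesgue_rV n.+1]_(x in C) (expR (- (t * dotr u x)))%:E =
  (`|u ord0 j|^-1 * (n`!%:R / t ^+ n.+1) * vol (chart_domain C u j))%:E)%E.
Proof.
move=> t0 uC uj.
rewrite (integral_cone0 C_closed C_cone (h := fun r => expR (- (t * r))) uC uj) ?integral_gamma//.
  rewrite /vol -[X in (_ * (_ * X))%E]fineK; last first.
    by rewrite ge0_fin_numE//; exact: chart_domain_fin.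
  by rewrite -!EFinM mulrA.
Qed.

Lemma laplace_chart u j : strict_dual C u -> u ord0 j != 0 ->
  laplace u = `|u ord0 j|^-1 * n`!%:R * vol (chart_domain C u j).
Proof.
move=> uC uj; rewrite /laplace /Rintegral; have := integral_expR_chart ltr01 uC uj.
move=> /(congr1 fine)/=; rewrite expr1n divr1 => <-; congr fine.
by apply: eq_integral => x _; rewrite mul1r.
Qed.

Lemma integral_expRZ u (t : R) : 0 < t -> strict_dual C u ->
  (\int[lebesgue_rV n.+1]_(x in C) (expR (- (t * dotr u x)))%:E =
  (laplace u / t ^+ n.+1)%:E)%E.
Proof.
move=> t0 uC; have [j uj] := strict_dual_coord C_solid uC.
rewrite (integral_expR_chart t0 uC uj) (laplace_chart uC uj); congr EFin.
by rewrite mulrA mulrAC.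
Qed.

Lemma integral_expR u : strict_dual C u ->
  (\int[lebesgue_rV n.+1]_(x in C) (expR (- dotr u x))%:E = (laplace u)%:E)%E.
Proof.
move=> uC; have := integral_expRZ ltr01 uC; rewrite expr1n divr1 => <-.
by under [RHS]eq_integral do rewrite mul1r.
Qed.

Lemma integrable_expR u : strict_dual C u ->
  (lebesgue_rV n.+1).-integrable C (EFin \o (fun x => expR (- dotr u x))).
Proof.
move=> uC; apply/integrableP; split; first exact: measurable_expR_dotr.
under eq_integral do rewrite /= ger0_norm ?expR_ge0//.
by rewrite (integral_expR uC) ltry.
Qed.

Lemma interior_box (a : 'rV[R]_n.+1) : interior C a ->
  exists2 e : R, 0 < e & forall x, `|x| <= e -> C (a + x).
Proof.
move=> /nbhs_ballP[e /= e0 H]; exists (e / 2); first by rewrite divr_gt0.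
move=> x xe; apply: H; rewrite -ball_normE /= opprD addrA subrr add0r normrN.
by rewrite (le_lt_trans xe)//; lra.
Qed.

Lemma laplace_gt0 u : strict_dual C u -> 0 < laplace u.
Proof.
move=> uC.
have [a /interior_box[e e0 H]] := C_solid.
have einv : 0 <= e^-1 by rewrite invr_ge0 ltW.
(* Dilating by [2 / e] turns the ball of radius [e] in [C] into one of radius 2, large enough to
   contain the floor box around its centre. *)
pose v : 'rV[int]_n.+1 := \row_i Num.floor ((2 * e^-1 *: a) ord0 i).
have : (\sum_(w <- [:: v]) (expR (- dotr u (intvec w) - norm1 u))%:E <=
   \int[lebesgue_rV n.+1]_(x in C) (expR (- dotr u x))%:E)%E.
  apply: sum_expR_le_integral => // w; rewrite inE => /eqP -> x vx.
  rewrite -[x](subrK (2 * e^-1 *: a)) addrC.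
  have -> : 2 * e^-1 *: a + (x - 2 * e^-1 *: a) =
      (2 * e^-1) *: (a + (e / 2) *: (x - 2 * e^-1 *: a)).
    rewrite scalerDr scalerA (_ : 2 * e^-1 * (e / 2) = 1) ?scale1r//.
    by field; rewrite gt_eqF.
  apply: C_cone; first by rewrite mulr_ge0.
  apply: H; rewrite normrZ gtr0_norm ?divr_gt0// -ler_pdivlMl ?divr_gt0//.
  rewrite (_ : (e / 2)^-1 * e = 2); last by field; rewrite gt_eqF.
  apply: (le_trans (ler_distD (intvec v) _ _)).
  rewrite [X in _ <= X](_ : 2 = 1 + 1)//; apply: lerD.
    exact: floor_box_norm.
  rewrite distrC; apply: floor_box_norm; exact: floor_box_floor.
rewrite big_seq1 (integral_expR uC) lee_fin; apply: lt_le_trans.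
exact: expR_gt0.
Qed.

Lemma vol_chart_gt0 u j : strict_dual C u -> u ord0 j != 0 ->
  0 < vol (chart_domain C u j).
Proof.
move=> uC uj; have := laplace_gt0 uC; rewrite (laplace_chart uC uj).
by rewrite pmulr_rgt0// mulr_gt0 ?invr_gt0 ?normr_gt0// ltr0n fact_gt0.
Qed.

Lemma laplace_moment_chart u j e : strict_dual C u -> u ord0 j != 0 ->
  laplace_moment u e = `|u ord0 j|^-1 * (n.+1)`!%:R *
    \int[lebesgue_rV n]_(y in chart_domain C u j) dotr e (hyperplane_chart u j y).
Proof.
move=> uC uj.
have [|||_ _ <-] := moment1 C_closed C_cone (h := fun r => expR (- (1 * r)))
  (H := (n.+1)`!%:R) e uC uj.
- exact: mexp.
- by move=> r; exact: expR_ge0.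
- by rewrite integral_gamma// expr1n divr1.
by apply: eq_Rintegral => x _; rewrite mul1r.
Qed.

Lemma integrable_moment u e : strict_dual C u ->
  (lebesgue_rV n.+1).-integrable C (EFin \o (fun x => dotr e x * expR (- dotr u x))).
Proof.
move=> uC; have [j uj] := strict_dual_coord C_solid uC.
have [|||_ H _] := moment1 C_closed C_cone (h := fun r => expR (- (1 * r)))
  (H := (n.+1)`!%:R) e uC uj.
- exact: mexp.
- by move=> r; exact: expR_ge0.
- by rewrite integral_gamma// expr1n divr1.
by move: H; under eq_fun do rewrite mul1r.
Qed.

(** Slicing expresses both sides by the section. The radial integrals are [(n + 1)!] for the moment
    and [n!] for [laplace], and their ratio is the factor [n + 1]. *)
Lemma section_centroidP u j a : strict_dual C u -> u ord0 j != 0 ->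
  hyperplane_centroid u j (cone_section C u) = a <->
  forall i, laplace_moment u (delta_mx 0 i) = n.+1%:R * laplace u * a ord0 i.
Proof.
move=> uC uj.
have SE : hyperplane_chart u j @^-1` (cone_section C u) = chart_domain C u j.
  by apply/seteqP; split=> y /= => [[]//|Cy]; split=> //; exact: dotr_hyperplane_chart.
have W0 := vol_chart_gt0 uC uj.
have cE i : laplace_moment u (delta_mx 0 i) = n.+1%:R * laplace u *
    ((vol (chart_domain C u j))^-1 *
     \int[lebesgue_rV n]_(y in chart_domain C u j) hyperplane_chart u j y ord0 i).
  rewrite (laplace_moment_chart _ uC uj) (laplace_chart uC uj) factS natrM.
  under eq_Rintegral do rewrite dotr_delta.
  field; by rewrite gt_eqF// normr_eq0 uj.
rewrite /hyperplane_centroid /= SE /vec_integral; split=> [<- i|H].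
  by rewrite cE !mxE.
apply/rowP => i; rewrite !mxE; have := H i; rewrite cE => /mulfI; apply.
by rewrite mulf_neq0 ?pnatr_eq0// gt_eqF// laplace_gt0.
Qed.

Lemma measurable_cap u (l : R) : measurable (cap C u l).
Proof.
have -> : cap C u l = C `&` (dotr u @^-1` `]-oo, l]%classic).
  by apply/seteqP; split=> x; rewrite /cap/= in_itv.
apply: measurableI => //; rewrite -[X in measurable X]setTI.
apply: measurable_dotr => //; exact: measurable_itv.
Qed.

Let mle (l : R) : measurable_fun setT (fun r : R => (r <= l)%R%:R : R).
Proof.
rewrite (_ : (fun _ => _) = \1_(`]-oo, l]%classic)).
  by apply: measurable_indic; exact: measurable_itv.
by apply/funext => r; rewrite indicE mem_setE in_itv.
Qed.

Lemma vol_cap u (l : R) : 0 < l -> strict_dual C u ->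
  vol (cap C u l) = l ^+ n.+1 / (n.+1)`!%:R * laplace u.
Proof.
move=> l0 uC; have [j uj] := strict_dual_coord C_solid uC.
rewrite (laplace_chart uC uj) /vol -[X in fine X]mul1e -integral_cst; last exact: measurable_cap.
have -> : (\int[lebesgue_rV n.+1]_(x in cap C u l) (cst 1 x) =
   \int[lebesgue_rV n.+1]_(x in C) ((dotr u x <= l)%R%:R)%:E)%E.
  rewrite integral_mkcond [RHS]integral_mkcond; apply: eq_integral => x _.
  rewrite /patch; case: ifPn; rewrite ?inE.
    by move=> [Cx ux]; rewrite mem_set//= ux.
  case: ifPn => //; rewrite ?inE => Cx nx.
  by case: leP => // h; move/negP: nx; case; apply: mem_set.
rewrite (integral_cone0 C_closed C_cone (h := fun r => (r <= l)%R%:R) uC uj)//.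
rewrite integral_exprn// -[X in (_ * (_ * X))%E]fineK; last first.
  by rewrite ge0_fin_numE//; exact: chart_domain_fin.
rewrite -!EFinM /= factS natrM /vol; field.
by rewrite normr_eq0 uj ?nat1r -?natrD !pnatr_eq0/= -lt0n fact_gt0.
Qed.

Lemma vec_integral_cap u (l : R) i : 0 < l -> strict_dual C u ->
  vec_integral (cap C u l) id ord0 i =
  l ^+ n.+2 / (n.+2)`!%:R * laplace_moment u (delta_mx 0 i).
Proof.
move=> l0 uC; have [j uj] := strict_dual_coord C_solid uC.
rewrite (laplace_moment_chart _ uC uj) mxE.
have [|||_ _ H] := moment1 C_closed C_cone (h := fun r => (r <= l)%R%:R)
  (H := l ^+ n.+2 / n.+2%:R) (delta_mx 0 i) uC uj.
- exact: mle.
- by [].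
- exact: integral_exprn.
transitivity (\int[lebesgue_rV n.+1]_(x in C) (dotr (delta_mx 0 i) x * (dotr u x <= l)%R%:R)).
  rewrite Rintegral_mkcond [RHS]Rintegral_mkcond; apply: eq_Rintegral => x _.
  rewrite /patch dotr_delta; case: ifPn; rewrite ?inE.
    by move=> [Cx ux]; rewrite mem_set//= ux mulr1.
  case: ifPn => //; rewrite ?inE => Cx nx.
  by case: leP => // h; [move/negP: nx; case; apply: mem_set|rewrite mulr0].
rewrite H (factS n.+1) natrM; field.
by rewrite normr_eq0 uj ?nat1r -?natrD !pnatr_eq0/= -lt0n fact_gt0.
Qed.

End laplace.

(** * The Gigena functional *)

(** Second-order bound whose remainder stays integrable against the exponential weight in
    [laplace_expansion]. *)
Lemma expR_le_quad {R : realType} (y : R) : expR y <= 1 + y + y ^+ 2 * expR `|y|.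
Proof.
have H : expR y - 1 <= y * expR y.
  have := expR_ge1Dx (- y); rewrite expRN => h.
  have e0 := expR_gt0 y.
  have : expR y * (1 - y) <= 1 by rewrite -ler_pdivlMl// mulr1.
  lra.
have H1 := expR_ge1Dx y.
have [y0|y0] := leP 0 y.
  have : y * (expR y - 1) <= y * (y * expR y) by rewrite ler_wpM2l.
  rewrite ger0_norm// expr2 -mulrA; lra.
have : 1 <= expR `|y| by rewrite -expR0 ler_expR.
move: (expR `|y|) (expR y) H H1 => a b H H1 a1.
have : y * (b - 1) <= y ^+ 2 by nra.
have : y ^+ 2 <= y ^+ 2 * a by rewrite ler_peMr// sqr_ge0.
lra.
Qed.

Section laplace_calculus.
Context {R : realType} {n : nat}.
Variable C : set 'rV[R]_n.+1.
Hypotheses (C_closed : closed C) (C_convex : convex_set C) (C_cone : is_cone C)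
  (C_pointed : contains_no_line C) (C_solid : interior C !=set0).
Implicit Types (u v w x e a : 'rV[R]_n.+1).

Local Notation lap := (laplace C).
Local Notation mom := (laplace_moment C).

Let mC : measurable C. Proof. exact: closed_measurable_rV. Qed.
Let intE u := @integrable_expR R n C C_closed C_cone C_solid u.
Let intM u e := @integrable_moment R n C C_closed C_cone C_solid u e.

Lemma strict_dualZ u (t : R) : 0 < t -> strict_dual C u -> strict_dual C (t *: u).
Proof. by move=> t0 uC x Cx x0; rewrite dotrZl mulr_gt0// uC. Qed.

Lemma strict_dualD u w : dual_cone C u -> strict_dual C w -> strict_dual C (u + w).
Proof. by move=> uC wC x Cx x0; rewrite dotrDl ltr_wpDl ?uC ?wC. Qed.

Lemma laplaceZ u (t : R) : 0 < t -> strict_dual C u ->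
  lap (t *: u) = lap u / t ^+ n.+1.
Proof.
move=> t0 uC; have := integral_expRZ C_closed C_cone C_solid t0 uC.
move=> /(congr1 fine)/= <-; rewrite /laplace /Rintegral; congr fine.
by apply: eq_integral => x _; rewrite dotrZl.
Qed.

Lemma laplace_momentZ u e (t : R) : 0 < t -> strict_dual C u ->
  mom (t *: u) e = mom u e / t ^+ n.+2.
Proof.
move=> t0 uC; have [j uj] := strict_dual_coord C_solid uC.
have [|||_ _ H] := moment1 C_closed C_cone (h := fun r => expR (- (t * r)))
  (H := (n.+1)`!%:R / t ^+ n.+2) e uC uj.
- apply: measurableT_comp => //; apply: measurableT_comp => //; exact: measurable_funM.
- by move=> r; exact: expR_ge0.
- exact: integral_gamma.
rewrite (laplace_moment_chart C_closed C_cone _ uC uj).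
transitivity (\int[lebesgue_rV n.+1]_(x in C) (dotr e x * expR (- (t * dotr u x)))).
  by apply: eq_Rintegral => x _; rewrite dotrZl.
by rewrite H !mulrA mulrAC.
Qed.

Lemma laplace_momentD u e v : strict_dual C u -> mom u (e + v) = mom u e + mom u v.
Proof.
move=> uC; rewrite /laplace_moment -RintegralD//; [|exact: intM|exact: intM].
by apply: eq_Rintegral => x _; rewrite dotrDl mulrDl.
Qed.

Lemma laplace_moment_scale u e (c : R) : strict_dual C u -> mom u (c *: e) = c * mom u e.
Proof.
move=> uC; rewrite /laplace_moment -RintegralZl//; last exact: intM.
by apply: eq_Rintegral => x _; rewrite dotrZl mulrA.
Qed.

Lemma laplace_moment_coord u e : strict_dual C u ->
  mom u e = \sum_i e ord0 i * mom u (delta_mx 0 i).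
Proof.
move=> uC; rewrite {1}[e]row_sum_delta.
elim/big_rec2 : _ => [|i y1 y2 _ <-].
  have := laplace_moment_scale 0 0 uC; rewrite scale0r mul0r; exact.
by rewrite laplace_momentD// laplace_moment_scale.
Qed.

Lemma laplace_moment_self u : strict_dual C u -> mom u u = n.+1%:R * lap u.
Proof.
move=> uC; have [j uj] := strict_dual_coord C_solid uC.
rewrite (laplace_moment_chart C_closed C_cone _ uC uj) (laplace_chart C_closed C_cone uC uj).
rewrite factS natrM [RHS]mulrA [in RHS]mulrCA !mulrA; congr (_ * _).
under eq_Rintegral do rewrite dotr_hyperplane_chart//.
rewrite Rintegral_cst ?mul1r//; exact: measurable_chart_domain.
Qed.

(** Convexity of [laplace]: the inequality [1 + y <= expR y] integrated over [C]. *)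
Lemma laplace_tangent u v : strict_dual C u -> strict_dual C v ->
  lap u - mom u (v - u) <= lap v.
Proof.
move=> uC vC.
rewrite /laplace /laplace_moment -RintegralB//; [|exact: intE|exact: intM].
apply: le_Rintegral => //; last 1 first.
- move=> x Cx; have -> : - dotr v x = - dotr u x + - dotr (v - u) x.
    by rewrite dotrBl; lra.
  rewrite expRD -{1}[expR (- dotr u x)]mulr1 [dotr _ _ * _]mulrC -mulrBr.
  by rewrite ler_pM2l ?expR_gt0// expR_ge1Dx.
- have -> : EFin \o (fun x => expR (- dotr u x) - dotr (v - u) x * expR (- dotr u x)) =
     ((EFin \o (fun x => expR (- dotr u x)%R)) \-
      (EFin \o (fun x => (dotr (v - u) x * expR (- dotr u x))%R)))%E by [].
  by apply: integrableB => //; [exact: intE|exact: intM].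
- exact: intE.
Qed.

Lemma laplace_le u v : strict_dual C u -> strict_dual C v ->
  dual_cone C (v - u) -> lap v <= lap u.
Proof.
move=> uC vC H; apply: le_Rintegral => //; [exact: intE|exact: intE|].
by move=> x Cx; rewrite ler_expR lerN2 -subr_ge0 -dotrBl H.
Qed.

(** The upper half of differentiability, matching [laplace_tangent]. The remainder is absorbed by
    giving up half of the exponential decay, so that it is controlled by [laplace] at [u / 2]. *)
Lemma laplace_expansion u e : strict_dual C u -> exists K h0 : R,
  [/\ 0 <= K, 0 < h0 & forall h, `|h| <= h0 -> strict_dual C (u + h *: e) /\
      lap (u + h *: e) <= lap u - h * mom u e + K * h ^+ 2].
Proof.
move=> uC.
have [c c0 Hc] := dotr_bound C_closed C_cone e uC.
have [r r0 Hr] := strict_dual_ball C_closed C_cone uC.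
have u2C : strict_dual C (2^-1 *: u) by apply: strict_dualZ.
(* The first bound keeps [u + h e] in the open dual; the second gives [|h dotr e x| <= dotr u x / 4]
   on [C]. *)
pose h0 := Num.min (r / (norm1 e + 1)) ((4 * (c + 1))^-1).
have ne0 : 0 < norm1 e + 1 by rewrite ltr_wpDl ?norm1_ge0.
have c10 : 0 < 4 * (c + 1) by rewrite mulr_gt0// ltr_wpDl.
exists (32 * c ^+ 2 * lap (2^-1 *: u)), h0; split.
- by rewrite mulr_ge0 ?mulr_ge0 ?sqr_ge0// ltW// laplace_gt0.
- by rewrite lt_min divr_gt0// invr_gt0.
move=> h hh0.
have hC : strict_dual C (u + h *: e).
  apply: Hr; rewrite /norm1.
  under eq_bigr do rewrite mxE normrM.
  rewrite -mulr_sumr -/(norm1 e).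
  have : `|h| <= r / (norm1 e + 1) by apply: le_trans hh0 _; rewrite ge_min lexx.
  rewrite ler_pdivlMr// => H; apply: le_trans H.
  by rewrite ler_wpM2l// lerDl.
split => //.
have hc : `|h| * c <= 4^-1.
  have : `|h| <= (4 * (c + 1))^-1 by apply: le_trans hh0 _; rewrite ge_min lexx orbT.
  move=> H; apply: (@le_trans _ _ ((4 * (c + 1))^-1 * (c + 1))).
    by apply: ler_pM => //; rewrite lerDl.
  rewrite le_eqVlt; apply/orP; left; apply/eqP; field.
  by rewrite gt_eqF// ltr_wpDl.
have i1 : (lebesgue_rV n.+1).-integrable C
    (EFin \o (fun x => expR (- dotr u x) - h * (dotr e x * expR (- dotr u x)))).
  have -> : EFin \o (fun x => expR (- dotr u x) - h * (dotr e x * expR (- dotr u x))) =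
     ((EFin \o (fun x => expR (- dotr u x)%R)) \-
      (fun x => h%:E * ((EFin \o (fun x => (dotr e x * expR (- dotr u x))%R)) x)))%E by [].
  apply: integrableB => //; first exact: intE.
  by apply: integrableZl => //; exact: intM.
have i2 : (lebesgue_rV n.+1).-integrable C
    (EFin \o (fun x => 32 * c ^+ 2 * h ^+ 2 * expR (- dotr (2^-1 *: u) x))).
  have -> : EFin \o (fun x => 32 * c ^+ 2 * h ^+ 2 * expR (- dotr (2^-1 *: u) x)) =
    (fun x => (32 * c ^+ 2 * h ^+ 2)%:E * ((EFin \o (fun x => expR (- dotr (2^-1 *: u) x)%R)) x))%E by [].
  by apply: integrableZl => //; exact: intE.
have -> : lap u - h * mom u e + 32 * c ^+ 2 * lap (2^-1 *: u) * h ^+ 2 =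
    \int[lebesgue_rV n.+1]_(x in C) ((expR (- dotr u x) - h * (dotr e x * expR (- dotr u x)))
      + 32 * c ^+ 2 * h ^+ 2 * expR (- dotr (2^-1 *: u) x)).
  rewrite RintegralD// RintegralB//; [|exact: intE|]; last first.
    by have := integrableZl mC h (intM e uC).
  rewrite (RintegralZl _ mC (intM e uC)) (RintegralZl _ mC (intE u2C)).
  by rewrite -/(lap u) -/(mom u e) -/(lap _); ring.
apply: le_Rintegral => //.
- exact: intE.
- have -> : EFin \o (fun x => (expR (- dotr u x) - h * (dotr e x * expR (- dotr u x)))
      + 32 * c ^+ 2 * h ^+ 2 * expR (- dotr (2^-1 *: u) x)) =
    ((EFin \o (fun x => (expR (- dotr u x) - h * (dotr e x * expR (- dotr u x)))%R)) \+
     (EFin \o (fun x => (32 * c ^+ 2 * h ^+ 2 * expR (- dotr (2^-1 *: u) x))%R)))%E by [].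
  exact: integrableD.
move=> x Cx.
have ux0 : 0 <= dotr u x by exact: strict_dual_ge0 uC Cx.
have := Hc _ Cx; set z := dotr e x; set s := dotr u x => zs.
rewrite dotrDl dotrZl dotrZl -/z -/s opprD.
have -> : - (2^-1 * s) = - s + s / 2 by field.
rewrite !expRD.
have es := expR_gt0 (- s).
have Q := expR_le_quad (- (h * z)).
rewrite normrN sqrrN in Q.
have hz : `|h * z| <= s / 4.
  rewrite normrM; apply: (@le_trans _ _ (`|h| * (c * s))); first by rewrite ler_wpM2l.
  by rewrite mulrA mulrC; apply: ler_wpM2l.
have E1 : expR `|h * z| <= expR (s / 4) by rewrite ler_expR.
(* [s ^+ 2 / 32] is the quadratic term of the exponential series at [s / 4]. *)
have s2 : s ^+ 2 <= 32 * expR (s / 4).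
  have h4 : (s / 4) ^+ 2 / 2 <= expR (s / 4).
    by apply: le_trans (expR_ge1Dxn 1 (divr_ge0 ux0 (ler0n _ 4))); rewrite lerDr.
  have -> : s ^+ 2 = 16 * (s / 4) ^+ 2 by field.
  by move: ((s / 4) ^+ 2) (expR (s / 4)) h4 => X Y h4; lra.
have z2 : z ^+ 2 <= c ^+ 2 * s ^+ 2.
  by rewrite -exprMn -[z ^+ 2]real_normK ?num_real// lerXn2r ?nnegrE// mulr_ge0.
have eE : expR (s / 2) = expR (s / 4) * expR (s / 4).
  by rewrite -expRD; congr expR; field.
have B : (h * z) ^+ 2 * expR `|h * z| <= 32 * c ^+ 2 * h ^+ 2 * expR (s / 2).
  rewrite eE exprMn.
  apply: (@le_trans _ _ (h ^+ 2 * (c ^+ 2 * (32 * expR (s / 4))) * expR (s / 4))).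
    apply: ler_pM => //; rewrite ?expR_ge0//.
      by rewrite mulr_ge0 ?sqr_ge0.
    rewrite ler_wpM2l ?sqr_ge0//; apply: (le_trans z2).
    by rewrite ler_wpM2l ?sqr_ge0.
  by rewrite le_eqVlt; apply/orP; left; apply/eqP; ring.
have : expR (- s) * expR (- (h * z)) <=
  expR (- s) * (1 - h * z + 32 * c ^+ 2 * h ^+ 2 * expR (s / 2)).
  by rewrite ler_pM2l//; lra.
move=> /le_trans; apply; rewrite -/s le_eqVlt; apply/orP; left; apply/eqP; ring.
Qed.

(** Test [u] at the vertex, of a cube around [a] inside [C], where [dotr u] is smallest. This makes
    [dotr _ a] coercive on the dual cone and hence minimising sequences bounded. *)
Lemma dual_cone_interior a : interior C a ->
  exists2 c : R, 0 < c & forall u, dual_cone C u -> c * norm1 u <= dotr u a.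
Proof.
move=> /interior_box[c c0 H]; exists c => // u uC.
pose x : 'rV[R]_n.+1 := \row_i (- c * Num.sg (u ord0 i)).
have xc : `|x| <= c.
  rewrite [leLHS]/Num.Def.normr /= mx_normrE; apply/bigmax_leP; split; first exact: ltW.
  move=> [i j] _ /=; rewrite mxE normrM normrN (gtr0_norm c0) normr_sg.
  by rewrite ler_piMr ?(ltW c0)// lern1 leq_b1.
have := uC _ (H _ xc); rewrite dotrDr => h.
have xE : dotr u x = - (c * norm1 u).
  rewrite /dotr /norm1 mulr_sumr -sumrN; apply: eq_bigr => i _.
  by rewrite mxE mulNr mulrN mulrCA -[u ord0 i * _]mulrC -normrEsg.
by rewrite xE in h; lra.
Qed.

(** [laplace] blows up at the boundary of the dual cone: if [u] vanished on a ray,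
    [expR (- dotr u x)] would be bounded below on a tube of infinite volume around it. The tube is
    replaced by arbitrarily many disjoint lattice boxes. *)
Lemma laplace_bounded_strict_dual u e (B : R) : dual_cone C u -> strict_dual C e ->
  (forall t, 0 < t -> t <= 1 -> lap (u + t *: e) <= B) -> strict_dual C u.
Proof.
move=> uC eC H x0 Cx0 x00; rewrite lt_def uC// andbT; apply/negP => /eqP ux0.
have [a /interior_box[r r0 Hr]] := C_solid.
pose z := (2 / r) *: a.
have Cz x : `|x| <= 2 -> C (z + x).
  move=> x2; have -> : z + x = (2 / r) *: (a + (r / 2) *: x).
    rewrite scalerDr scalerA (_ : 2 / r * (r / 2) = 1) ?scale1r//.
    by field; rewrite gt_eqF.
  apply: C_cone; first by rewrite divr_ge0// ltW.
  apply: Hr; rewrite normrZ gtr0_norm ?divr_gt0//.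
  rewrite -ler_pdivlMl ?divr_gt0// (_ : (r / 2)^-1 * r = 2)//.
  by field; rewrite gt_eqF.
have [i xi] : exists i, x0 ord0 i != 0.
  apply: contrapT => N; case/negP: x00; apply/eqP/rowP => i; rewrite mxE.
  by apply: contrapT => /eqP xi; apply: N; exists i.
(* The [i]-th coordinate of [y] has absolute value 2, so different multiples of [y] fall into
   different floor boxes. *)
pose y := (2 / `|x0 ord0 i|) *: x0.
have xi0 : 0 < `|x0 ord0 i| by rewrite normr_gt0.
have Cy : C y by apply: C_cone => //; rewrite divr_ge0// ltW.
have uy : dotr u y = 0 by rewrite dotrZr ux0 mulr0.
have yi : `|y ord0 i| = 2.
  by rewrite mxE normrM ger0_norm ?divr_ge0// divfK// gt_eqF.
pose v (N : nat) : 'rV[int]_n.+1 := \row_i Num.floor ((z + N%:R *: y) ord0 i).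
have vinj : injective v.
  move=> N M NM; apply/eqP/negPn/negP => NnM.
  have h1 := floor_box_floor (z + N%:R *: y); have h2 := floor_box_floor (z + M%:R *: y).
  have := NM => /rowP/(_ i); rewrite !mxE => E.
  have := h1 i; have := h2 i; rewrite /= !mxE !in_itv/= -E.
  set f := _%:~R => /andP[a1 a2] /andP[a3 a4].
  have : `|(N%:R - M%:R) * (2 / `|x0 ord0 i| * x0 ord0 i)| < 1.
    by rewrite ltr_norml; apply/andP; split; lra.
  have := yi; rewrite mxE => yi'; rewrite normrM yi'.
  apply/negP; rewrite -leNgt; apply: (@le_trans _ _ (1 * 2)); first lra.
  rewrite ler_pM2r//.
  rewrite -[N%:R]/((N%:Z)%:~R) -[M%:R]/((M%:Z)%:~R) -intrB -intr_norm.
  rewrite -[1]/(1%:~R) ler_int; lia.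
pose A := `|dotr u z| + `|dotr e z| + dotr e y + 2 * (norm1 u + norm1 e).
have ey0 : 0 <= dotr e y by exact: strict_dual_ge0 eC Cy.
have bound (M : nat) : M%:R * expR (- A) <= B.
  (* With this [t] the term [t N dotr e y] stays below [dotr e y] for all [N < M], so [A] bounds the
     exponents uniformly in [M]. *)
  pose t : R := M.+1%:R^-1.
  have t0 : 0 < t by rewrite invr_gt0.
  have t1 : t <= 1 by rewrite invf_le1// ler1n.
  have tC : strict_dual C (u + t *: e) by apply: strict_dualD => //; exact: strict_dualZ.
  apply: le_trans (H t t0 t1).
  rewrite -lee_fin -(integral_expR C_closed C_cone C_solid tC).
  apply: le_trans (sum_expR_le_integral (F := map v (iota 0 M)) _ mC _ _).
  - rewrite big_map sumEFin lee_fin.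
    rewrite (_ : M%:R * expR (- A) = \sum_(N <- iota 0 M) expR (- A)); last first.
      by rewrite big_const_seq count_predT size_iota iter_addr_0 mulr_natl.
    rewrite !big_seq; apply: ler_sum => N; rewrite mem_iota add0n /= => NM.
    rewrite ler_expR.
    have := floor_box_dotr (u + t *: e) (floor_box_floor (z + N%:R *: y)).
    rewrite -/(v N) ler_norml => /andP[h _].
    have n1 : norm1 (u + t *: e) <= norm1 u + norm1 e.
      rewrite /norm1 -big_split; apply: ler_sum => k _; rewrite !mxE.
      rewrite (le_trans (ler_normD _ _))// lerD2l normrM gtr0_norm//.
      by rewrite ler_piMl.
    have E : dotr (u + t *: e) (z + N%:R *: y) = dotr u z + t * dotr e z + t * N%:R * dotr e y.
      have E z' y' : dotr u y' = 0 -> dotr (u + t *: e) (z' + N%:R *: y') =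
          dotr u z' + t * dotr e z' + t * N%:R * dotr e y'.
        by move=> uy'; rewrite dotrDl !dotrDr !dotrZl !dotrZr uy'; ring.
      exact: E.
    have tN : t * N%:R * dotr e y <= dotr e y.
      rewrite ler_piMl// /t ler_pdivrMl// mulr1 ler_nat; lia.
    have te : t * dotr e z <= `|dotr e z|.
      by rewrite (le_trans (ler_norm _))// normrM gtr0_norm// ler_piMl.
    have := ler_norm (dotr u z).
    rewrite /A; rewrite E in h; lra.
  - by rewrite map_inj_uniq// iota_uniq.
  - move=> w /mapP[N _ ->] x vx.
    have -> : x = (z + (x - (z + N%:R *: y))) + N%:R *: y.
      by rewrite addrAC addrCA subrr addr0.
    apply: coneD => //; last by apply: C_cone.
    apply: Cz; apply: (le_trans (ler_distD (intvec (v N)) _ _)).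
    rewrite [X in _ <= X](_ : 2 = 1 + 1)//; apply: lerD; first exact: floor_box_norm.
    rewrite distrC; apply: floor_box_norm; exact: floor_box_floor.
have := bound (Num.truncn (B / expR (- A))).+1.
apply/negP; rewrite -ltNge -ltr_pdivrMr ?expR_gt0//.
exact: truncnS_gt.
Qed.

(** A minimising sequence is bounded and has a cluster point in the closed dual cone; the blow-up of
    [laplace] at the boundary keeps that point in the open one. *)
Lemma laplace_minimizer a : interior C a -> exists2 u, strict_dual C u &
  forall v, strict_dual C v -> lap u + dotr u a <= lap v + dotr v a.
Proof.
move=> aC.
have Ca : C a by exact: interior_subset.
have [e eC] := strict_dual_nonempty C_closed C_convex C_cone C_pointed C_solid.
have [c c0 Hc] := dual_cone_interior aC.
pose P v := lap v + dotr v a.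
pose S := [set P v | v in strict_dual C].
have dC v : strict_dual C v -> dual_cone C v by move=> vC x; exact: strict_dual_ge0.
have S0 : has_inf S.
  split; first by exists (P e); exists e.
  exists 0 => _ [v vC <-]; rewrite addr_ge0//; first exact/ltW/laplace_gt0.
  exact: dC.
pose m := inf S.
have mP v : strict_dual C v -> m <= P v.
  by move=> vC; apply: (inf_lbound S0.2); exists v.
have Hv (N : nat) : exists v, strict_dual C v /\ P v < m + N.+1%:R^-1.
  have [|_ [v vC <-] Pv] := @inf_adherent _ S N.+1%:R^-1 _ S0; first by rewrite invr_gt0.
  by exists v.
have [v vP] := choice Hv.
pose K := [set w : 'rV[R]_n.+1 | `|w| <= (m + 1) / c].
have cK : compact K.
  apply: bounded_closed_compact.
    by exists ((m + 1) / c); split=> [|M MM w /= Hw]; [exact: num_real|exact: le_trans (ltW MM)].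
  rewrite /K (_ : mkset _ = (@Num.Def.normr R 'rV[R]_n.+1) @^-1` [set y | y <= (m + 1) / c]); last by [].
  by apply: preimage_closed; [move=> z _; exact: norm_continuous|exact: closed_le].
have vK N : K (v N).
  have [vC Pv] := vP N.
  have := Hc _ (dC _ vC); rewrite /K /= => h.
  have h2 : dotr (v N) a <= m + 1.
    apply: ltW; apply: le_lt_trans (lt_le_trans Pv _).
      by rewrite /P lerDr ltW// laplace_gt0.
    by rewrite lerD2l invf_le1// ler1n.
  rewrite ler_pdivlMr// mulrC (le_trans _ h2)// (le_trans _ h)// ler_pM2l//.
  rewrite [leLHS]/Num.Def.normr /= mx_normrE; apply/bigmax_leP; split; first exact: norm1_ge0.
  move=> [i j] _ /=; rewrite (ord1 i) /norm1 (bigD1 j)//= lerDl.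
  exact: sumr_ge0.
have FK : (v @ \oo) K by exists 0%N => // N _; exact: vK.
have [u [_ uclu]] := cK _ _ FK.
have near_u (g : R) : 0 < g -> exists w, [/\ strict_dual C w, P w < m + g & `|u - w| < g].
  move=> g0.
  have [N0 _ HN] := near_infty_natSinv_lt (PosNum g0).
  have F1 : (v @ \oo) [set w | strict_dual C w /\ P w < m + g].
    exists N0 => // N NN0 /=; have [vC Pv] := vP N; split=> //.
    by apply: (lt_trans Pv); rewrite ltrD2l; exact: HN.
  have [w [[wC Pw] ub]] := uclu _ (ball u g) F1 (nbhsx_ballx u g g0).
  by exists w; split=> //; move: ub; rewrite -ball_normE.
have norm1_le w : norm1 w <= n.+1%:R * `|w|.
  rewrite /norm1 (le_trans (ler_sum _ (fun i _ => coord_le_norm w i)))//.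
  by rewrite sumr_const card_ord mulr_natl.
have uC : dual_cone C u.
  move=> x Cx; rewrite leNgt; apply/negP => ux.
  pose g := - dotr u x / (norm1 x + 1).
  have nx : 0 < norm1 x + 1 by rewrite ltr_wpDl ?norm1_ge0.
  have [|w [wC _ uw]] := near_u g; first by rewrite divr_gt0// oppr_gt0.
  have := dC _ wC _ Cx.
  have := dotr_le_norm x (u - w); rewrite dotrC dotrBl ler_norml => /andP[+ _].
  have : norm1 x * `|u - w| <= norm1 x * g by rewrite ler_wpM2l ?norm1_ge0// ltW.
  have : (norm1 x + 1) * g = - dotr u x by rewrite /g mulrC divfK// gt_eqF.
  have : 0 < g by rewrite divr_gt0// oppr_gt0.
  rewrite mulrDl mul1r; lra.
have [k k0 Hk] := strict_dual_coercive C_closed C_cone eC.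
(* So far [u] is only in the closed dual. For [w] near [u] in the minimising sequence, [u + t e - w]
   is nonnegative on [C], so monotonicity bounds [lap (u + t e)] by [lap w]. *)
have key t : 0 < t -> lap (u + t *: e) <= m - dotr u a.
  move=> t0; apply/ler_addgt0Pr => g g0.
  pose r := Num.min (g / 2) (Num.min (t * k / n.+1%:R) (g / 2 / (norm1 a + 1))).
  have na : 0 < norm1 a + 1 by rewrite ltr_wpDl ?norm1_ge0.
  have r0 : 0 < r by rewrite !lt_min !divr_gt0// mulr_gt0.
  have [w [wC Pw uw]] := near_u r r0.
  have [r1 r2 r3] : [/\ r <= g / 2, r <= t * k / n.+1%:R & r <= g / 2 / (norm1 a + 1)].
    by split; rewrite !ge_min lexx ?orbT.
  have tC : strict_dual C (u + t *: e) by apply: strict_dualD => //; exact: strict_dualZ.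
  have : lap (u + t *: e) <= lap w.
    apply: laplace_le => // x Cx; rewrite addrAC dotrDl dotrZl.
    have := dotr_le_norm (u - w) x; rewrite ler_norml => /andP[h _].
    have h2 := Hk _ Cx.
    have h3 : norm1 (u - w) <= t * k.
      apply: (le_trans (norm1_le _)); rewrite mulrC -ler_pdivlMr//.
      by apply: le_trans (ltW uw) _.
    have : norm1 (u - w) * `|x| <= t * k * `|x| by rewrite ler_wpM2r.
    have : t * (k * `|x|) <= t * dotr e x by rewrite ler_pM2l.
    lra.
  have := dotr_le_norm a (u - w); rewrite dotrC dotrBl ler_norml => /andP[_ h1].
  have h2 : norm1 a * `|u - w| <= g / 2.
    apply: (@le_trans _ _ ((norm1 a + 1) * (g / 2 / (norm1 a + 1)))).
      apply: ler_pM => //; [exact: norm1_ge0|by rewrite lerDl|].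
      exact: le_trans (ltW uw) _.
    by rewrite mulrC divfK// gt_eqF.
  rewrite /P in Pw; lra.
have suC : strict_dual C u.
  by apply: (laplace_bounded_strict_dual (B := m - dotr u a) uC eC) => t t0 _; exact: key.
exists u => // w wC; apply: le_trans (mP _ wC).
(* Let [t] tend to 0 in [key]: by the tangent inequality [lap u] exceeds [lap (u + t e)] by at most
   [t * mom u e]. *)
rewrite -lerBrDr; apply/ler_addgt0Pr => g g0.
pose t := g / (`|mom u e| + 1).
have me : 0 < `|mom u e| + 1 by rewrite ltr_wpDl.
have t0 : 0 < t by rewrite divr_gt0.
have := key t t0.
have := laplace_tangent suC (strict_dualD uC (strict_dualZ t0 eC)).
rewrite [u + _ - u]addrAC subrr add0r laplace_moment_scale//.
have : t * mom u e <= g.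
  rewrite (le_trans (ler_wpM2l (ltW t0) (ler_norm _)))//.
  by rewrite /t mulrAC ler_pdivrMr// ler_wpM2l ?(ltW g0)// lerDl.
lra.
Qed.

Lemma gigena_exists a : interior C a -> exists2 u, strict_dual C u &
  forall i, mom u (delta_mx 0 i) = n.+1%:R * lap u * a ord0 i.
Proof.
move=> aC; have [u uC umin] := laplace_minimizer aC.
have D i : mom u (delta_mx 0 i) = a ord0 i.
  have [K [h0 [K0 h00 HK]]] := laplace_expansion (delta_mx 0 i) uC.
  have H (h : R) : `|h| <= h0 -> 0 <= h * (a ord0 i - mom u (delta_mx 0 i)) + K * h ^+ 2.
    move=> /HK[hC]; have := umin _ hC; rewrite dotrDl dotrZl dotr_delta; lra.
  have pos s : s = 1 \/ s = -1 -> 0 <= s * (a ord0 i - mom u (delta_mx 0 i)).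
    move=> s1; have s2 : `|s| = 1 by case: s1 => ->; rewrite ?normrN normr1.
    have : 0 <= h0 * (s * (a ord0 i - mom u (delta_mx 0 i))) / 2.
      apply: (@lin_quad_ge0 _ _ (K * h0 ^+ 2)) => t t0 t1.
      have := H (t * h0 * s); rewrite !normrM s2 mulr1 !gtr0_norm// ler_piMl ?(ltW h00)//.
      move=> /(_ isT).
      have -> : (t * h0 * s) ^+ 2 = t ^+ 2 * h0 ^+ 2.
        by rewrite !exprMn -[s ^+ 2]real_normK ?num_real// s2 expr1n mulr1.
      lra.
    by rewrite pmulr_lge0// pmulr_rge0.
  have := pos 1 (or_introl erefl); have := pos (-1) (or_intror erefl); lra.
(* The minimiser has moment [a]. As [mom] has degree [-(n + 2)] and [lap] degree [-(n + 1)], this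
   dilation turns the equation into that of the centroid. *)
pose t := (n.+1%:R * lap u)^-1.
have l0 := laplace_gt0 C_closed C_cone C_solid uC.
have t0 : 0 < t by rewrite invr_gt0 mulr_gt0.
exists (t *: u); first exact: strict_dualZ.
move=> i; rewrite laplace_momentZ// laplaceZ// D [t ^+ n.+2]exprS.
have : t ^+ n.+1 != 0 by rewrite expf_neq0// gt_eqF.
move: (t ^+ n.+1) => T T0; rewrite /t; field.
by rewrite T0 (gt_eqF l0) nat1r pnatr_eq0.
Qed.

(** [get] returns a solution because one exists; [section_centroidP] reads the moment equation off
    whichever solution and chart occur. *)
Lemma gigenaP a : interior C a -> strict_dual C (gigena C a) /\
  forall i, mom (gigena C a) (delta_mx 0 i) = n.+1%:R * lap (gigena C a) * a ord0 i.
Proof.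
move=> aC; have [u uC uD] := gigena_exists aC.
have [j uj] := strict_dual_coord C_solid uC.
have : exists w, strict_dual C w /\ is_section_centroid C w a.
  by exists u; split=> //; exists j => //; exact/section_centroidP.
move=> /(@getPex _ [set w | strict_dual C w /\ is_section_centroid C w a]).
rewrite -/(gigena C a) => -[gC [j' gj gE]]; split=> //.
exact: (section_centroidP C_closed C_cone C_solid _ gC gj).1 gE.
Qed.

(** Pair the moment equation with [u] itself and use Euler's relation [laplace_moment_self]. *)
Lemma dotr_gigena a : interior C a -> dotr (gigena C a) a = 1.
Proof.
move=> aC; have [uC uD] := gigenaP aC.
have := laplace_moment_coord (gigena C a) uC; rewrite laplace_moment_self//.
under eq_bigr do rewrite uD mulrCA.
rewrite -mulr_sumr -{1}[_ * lap _]mulr1 => /mulfI H; rewrite H//.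
by rewrite mulf_neq0 ?pnatr_eq0// gt_eqF// laplace_gt0.
Qed.

Lemma q_power a : interior C a -> 0 <= q C a /\
  q C a ^+ n.+2 = (n.+2%:R / n.+1%:R) ^+ n.+1 * lap (gigena C a) / (n.+1)`!%:R.
Proof.
move=> aC; have [uC uD] := gigenaP aC.
have l0 := laplace_gt0 C_closed C_cone C_solid uC.
(* The value that the moment equation forces on the [(n + 2)]-th power of the level. *)
pose L := (n.+2)`!%:R / (n.+1%:R * lap (gigena C a)).
have L0 : 0 < L by rewrite divr_gt0 ?ltr0n ?fact_gt0// mulr_gt0.
have Qex : exists l : R, 0 < l /\ vec_integral (cap C (gigena C a) l) id = a.
  exists (L `^ n.+2%:R^-1); split; first by rewrite powR_gt0.
  apply/rowP => i; rewrite vec_integral_cap ?powR_gt0// uD.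
  rewrite -powR_mulrn ?powR_ge0// -powRrM mulVf ?pnatr_eq0// powRr1 ?(ltW L0)//.
  rewrite /L; field.
  by rewrite nat1r !pnatr_eq0 (gt_eqF l0) -lt0n fact_gt0.
have := getPex Qex; rewrite -/(Qlevel C a) => -[l1 lE].
(* The level is recovered from a vector equation by cancelling a nonzero coordinate of [a]. *)
have a0 : exists i, a ord0 i != 0.
  apply: contrapT => N; have a0 : a = 0.
    by apply/rowP => i; rewrite mxE; apply: contrapT => /eqP ai; apply: N; exists i.
  have := dotr_gigena aC; rewrite a0 dotr0 => /esym/eqP; by rewrite oner_eq0.
have [i ai] := a0.
have lpow : Qlevel C a ^+ n.+2 = L.
  move/rowP : lE => /(_ i); rewrite vec_integral_cap// uD => H.
  apply: (mulIf ai); rewrite -[in RHS]H /L; field.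
  by rewrite nat1r !pnatr_eq0 (gt_eqF l0) -lt0n fact_gt0.
rewrite /q /Q vol_cap//; split.
  by rewrite mulr_ge0 ?(ltW l0)// divr_ge0 ?exprn_ge0 ?(ltW l1).
rewrite !exprMn exprAC lpow exprVn [lap _ ^+ n.+2]exprS /L expr_div_n factS natrM.
rewrite !exprMn [(n.+1)`!%:R ^+ n.+2]exprS [n.+1%:R^-1 ^+ n.+1]exprVn.
have h1 : (n.+1)`!%:R != 0 :> R by rewrite pnatr_eq0 -lt0n fact_gt0.
have := expf_neq0 n.+1 h1.
have h2 : lap (gigena C a) != 0 by rewrite gt_eqF.
have := expf_neq0 n.+1 h2.
have h3 : n.+1%:R != 0 :> R by rewrite pnatr_eq0.
have := expf_neq0 n.+1 h3.
move: (_ ^+ n.+1) (_ ^+ n.+1) (_ ^+ n.+1) => X Y Z X0 Y0 Z0.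
field.
by rewrite h1 X0 Y0 Z0.
Qed.

End laplace_calculus.

(** * Zeta-weighted limits *)

Section right_limit.
Context {R : realType}.
Implicit Types (f g h : R -> R) (z : nat -> R).

Lemma cvg_right0P f (l : R) : f t @[t --> 0^'+] --> l <->
  forall e, 0 < e -> exists2 t0, 0 < t0 & forall t, 0 < t -> t < t0 -> `|f t - l| <= e.
Proof.
split=> [fl e e0|H].
  have /cvgrPdist_le/(_ _ e0) := fl; rewrite near_withinE => /nbhs_ballP[t0 /= t00 Ht].
  exists t0 => // t tp tt0; rewrite distrC; apply: Ht => //=.
  by rewrite /ball/= sub0r normrN gtr0_norm.
apply/cvgrPdist_le => e e0; have [t0 t00 Ht] := H e e0.
rewrite near_withinE; apply/nbhs_ballP; exists t0 => //= t.
rewrite /ball/= sub0r normrN distrC => tt0 tp; apply: Ht => //.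
by rewrite gtr0_norm in tt0.
Qed.

(** Split the series at [J]: the tail weights sum to at most [e / (B + 1)] and are paired with the
    global bound [B], while for small [t] the first [J] arguments lie below [tau], where [h] is at
    most [b]. *)
Lemma weighted_estimate z h (G : R -> R) (Z B b tau : R) :
  (forall j, 0 <= z j) -> series z @ \oo --> Z ->
  0 <= B -> (forall s, 0 < s -> `|h s| <= B) ->
  0 <= b -> 0 < tau -> (forall s, 0 < s -> s < tau -> `|h s| <= b) ->
  (forall t, 0 < t -> series (fun j => z j * h (j.+1%:R * t)) @ \oo --> G t) ->
  forall e, 0 < e -> exists2 t0, 0 < t0 &
    forall t, 0 < t -> t < t0 -> `|G t| <= Z * b + e.
Proof.
move=> z0 zZ B0 hB b0 tau0 hb hG e e0.
have nd : nondecreasing_seq (series z) by exact: nondecreasing_series.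
have zle N : series z N <= Z.
  by rewrite -(cvg_lim _ zZ)//; apply: nondecreasing_cvgn_le => //; exact: cvgP zZ.
have B10 : 0 < B + 1 by rewrite ltr_wpDl.
have [J _ HJ] : \forall J \near \oo, `|Z - series z J| <= e / (B + 1).
  by apply: cvgr_dist_le zZ _ _; rewrite divr_gt0.
have {}HJ : Z - series z J <= e / (B + 1).
  by rewrite -[X in X <= _]ger0_norm ?subr_ge0//; apply: HJ => /=.
exists (tau / J.+1%:R); first by rewrite divr_gt0.
move=> t t0; rewrite ltr_pdivlMr// => tJ.
have bound N : (J <= N)%N ->
    `|series (fun j => z j * h (j.+1%:R * t)) N| <= Z * b + e.
  move=> JN; rewrite /series /=.
  apply: (le_trans (ler_norm_sum _ _ _)).
  rewrite (big_cat_nat (leq0n J) JN) /=.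
  apply: lerD.
    apply: (@le_trans _ _ (\sum_(0 <= j < J) z j * b)).
      rewrite !big_nat; apply: ler_sum => j jJ.
      rewrite normrM ger0_norm// ler_wpM2l// hb ?mulr_gt0//.
      apply: le_lt_trans tJ; rewrite mulrC ler_pM2l// ler_nat; lia.
    by rewrite -mulr_suml ler_wpM2r//; exact: zle.
  apply: (@le_trans _ _ ((\sum_(J <= j < N) z j) * B)).
    rewrite mulr_suml; apply: ler_sum => j _.
    by rewrite normrM ger0_norm// ler_wpM2l// hB ?mulr_gt0.
  have -> : \sum_(J <= j < N) z j = series z N - series z J.
    by rewrite /series /= (big_cat_nat (leq0n J) JN) /= [X in _ = X - _]addrC addrK.
  apply: (@le_trans _ _ (e / (B + 1) * (B + 1))); last by rewrite divfK// gt_eqF.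
  apply: ler_pM => //.
  - by rewrite subr_ge0; exact: nd.
  - by apply: le_trans HJ; rewrite lerD2r.
  - by rewrite lerDl.
apply: (cvgr_to_le (cvg_norm (hG t t0))).
by exists J => // N /= JN; exact: bound.
Qed.

(** Dominated convergence for series, applied to [f - f0]. *)
Lemma weighted_limit z f (G : R -> R) (Z B f0 : R) :
  (forall j, 0 <= z j) -> series z @ \oo --> Z ->
  0 <= B -> (forall s, 0 < s -> `|f s| <= B) -> f t @[t --> 0^'+] --> f0 ->
  (forall t, 0 < t -> series (fun j => z j * f (j.+1%:R * t)) @ \oo --> G t) ->
  G t @[t --> 0^'+] --> Z * f0.
Proof.
move=> z0 zZ B0 fB ff0 hG; apply/cvg_right0P => e e0.
have Z0 : 0 <= Z.
  apply: (cvgr_to_ge zZ); apply: nearW => N; rewrite /series /=; exact: sumr_ge0.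
pose b := e / 2 / (Z + 1).
have Z1 : 0 < Z + 1 by rewrite ltr_wpDl.
have b0 : 0 < b by rewrite !divr_gt0.
have /cvg_right0P/(_ _ b0)[tau tau0 Htau] := ff0.
have [||||t0 t00 Ht] := @weighted_estimate z (fun t => f t - f0) (fun t => G t - Z * f0)
  Z (B + `|f0|) b tau z0 zZ _ _ (ltW b0) tau0 Htau _ (e / 2).
- by rewrite addr_ge0.
- by move=> s s0; rewrite (le_trans (ler_normB _ _))// lerD2r fB.
- move=> t t0.
  rewrite (_ : series _ = (fun N => series (fun j => z j * f (j.+1%:R * t)) N - series z N * f0)).
    by apply: cvgB; [exact: hG|apply: cvgMl].
  apply/funext => N; rewrite /series /= mulr_suml -sumrB.
  by apply: eq_bigr => j _; rewrite mulrBr.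
- by rewrite divr_gt0.
exists t0 => // t tp tt0; apply: (le_trans (Ht t tp tt0)).
have : Z * b <= (Z + 1) * b by rewrite ler_wpM2r ?(ltW b0)// lerDl.
have : (Z + 1) * b = e / 2 by rewrite /b mulrC divfK// gt_eqF.
lra.
Qed.

(* The limsup [s] of [`|l - m0 / Z|] satisfies [s <= (Z - 1) s], whence [s = 0]. *)
Lemma weighted_limit_inv z f (G : R -> R) (Z B G0 : R) :
  (forall j, 0 <= z j) -> z 0%N = 1 -> series z @ \oo --> Z -> Z < 2 ->
  0 <= B -> (forall s, 0 < s -> `|f s| <= B) -> G t @[t --> 0^'+] --> G0 ->
  (forall t, 0 < t -> series (fun j => z j * f (j.+1%:R * t)) @ \oo --> G t) ->
  f t @[t --> 0^'+] --> G0 / Z.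
Proof.
move=> z0 z01 zZ Z2 B0 fB GG0 hG.
have Z1 : 1 <= Z.
  apply: (cvgr_to_ge zZ); exists 1%N => // N /= N1; rewrite /series /=.
  by rewrite big_ltn//= z01 lerDl; exact: sumr_ge0.
pose x := G0 / Z; pose B' := B + `|x|.
have Bx s : 0 < s -> `|f s - x| <= B'.
  by move=> s0; rewrite (le_trans (ler_normB _ _))// lerD2r fB.
pose S := [set b : R | 0 <= b /\ exists2 t0, 0 < t0 &
  forall t, 0 < t -> t < t0 -> `|f t - x| <= b].
have SB : S B' by split; [rewrite addr_ge0|exists 1 => // t t0 _; exact: Bx].
have Sinf : has_inf S by split; [exists B'|exists 0 => b []].
have step b e : S b -> 0 < e -> S ((Z - 1) * b + e).
  move=> [b0 [tau tau0 Htau]] e0; split; first by rewrite addr_ge0 ?(ltW e0)// mulr_ge0// subr_ge0.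
  (* The weights without their first term, of total mass [Z - 1 < 1]: this is the contraction
     factor. *)
  pose z' j := if j is j'.+1 then z j else 0.
  have z'E (g : nat -> R) N : series (fun j => z' j * g j) N.+1 = series (fun j => z j * g j) N.+1 - g 0%N.
    by rewrite /series /= !big_nat_recl//= mul0r z01 mul1r add0r addrC addKr.
  have zz' : series z' @ \oo --> Z - 1.
    rewrite -cvg_shiftS.
    rewrite (_ : (fun N => _) = (fun N => series z N.+1 - 1)).
      by apply: cvgB; [rewrite (cvg_shiftS (series z))|exact: cvg_cst].
    apply/funext => N; have := z'E (fun=> 1) N; rewrite /series /=.
    by under eq_bigr do rewrite mulr1; under [in X in _ = X - _]eq_bigr do rewrite mulr1.
  have e20 : 0 < e / 2 by rewrite divr_gt0.
  have [|||t1 t10 Ht1] := @weighted_estimate z' (fun t => f t - x)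
    (fun t => G t - G0 - (f t - x)) (Z - 1) B' b tau _ zz' _ Bx b0 tau0 Htau _ (e / 2) e20.
  - by move=> [|j] //=; exact: z0.
  - by rewrite addr_ge0.
  - move=> t t0; rewrite -cvg_shiftS.
    rewrite (_ : (fun N => _) = (fun N => series (fun j => z j * f (j.+1%:R * t)) N.+1 -
       series z N.+1 * x - (f t - x))).
      apply: cvgB; last exact: cvg_cst.
      apply: cvgB; first by rewrite (cvg_shiftS (series (fun j => z j * f (j.+1%:R * t)))); exact: hG.
      rewrite -[X in _ --> X](divfK (x := Z)) ?gt_eqF ?(lt_le_trans ltr01)// mulrC.
      by apply: cvgMl; rewrite (cvg_shiftS (series z)).
    apply/funext => N; rewrite (z'E (fun j => f (j.+1%:R * t) - x)) mul1r; congr (_ - _).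
    rewrite /series /= mulr_suml -sumrB.
    by apply: eq_bigr => j _; rewrite mulrBr.
  have /cvg_right0P/(_ _ e20)[t2 t20 Ht2] := GG0.
  exists (Num.min t1 t2); first by rewrite lt_min t10.
  move=> t t0; rewrite lt_min => /andP[tt1 tt2].
  have h1 := Ht1 t t0 tt1; have h2 := Ht2 t t0 tt2.
  have -> : f t - x = (G t - G0) - (G t - G0 - (f t - x)) by ring.
  rewrite (le_trans (ler_normB _ _))//; lra.
have inf0 : inf S = 0.
  have I0 : 0 <= inf S by apply: lb_le_inf => [|b []//]; exists B'.
  apply/eqP; rewrite eq_le I0 andbT leNgt; apply/negP => Ip.
  (* Chosen so that [(Z - 1) (inf S + g) + g] is strictly below [inf S], which amounts to
     [Z g < (2 - Z) inf S]. *)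
  pose g := (2 - Z) * inf S / 4.
  have g0 : 0 < g by rewrite divr_gt0// mulr_gt0// subr_gt0.
  have [b Sb bg] := inf_adherent g0 Sinf.
  have := inf_lbound Sinf.2 (step b g Sb g0).
  have : (Z - 1) * b <= (Z - 1) * (inf S + g) by rewrite ler_wpM2l ?subr_ge0// ltW.
  have : Z * g < 2 * g by rewrite ltr_pM2r.
  have : 4 * g = (2 - Z) * inf S by rewrite /g; field.
  by rewrite !mulrDr !mulrBl; lra.
apply/cvg_right0P => e e0.
have [b [b0 [t0 t00 Ht0]] be] := inf_adherent e0 Sinf.
exists t0 => // t tp tt0; apply: (le_trans (Ht0 t tp tt0)).
by rewrite inf0 add0r in be; exact: ltW.
Qed.

End right_limit.

(** * The logarithmic series and zeta as a sum of integer powers *)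

Section log_series.
Context {R : realType}.

Let f (N : nat) (y : R) : R := - ln (1 - y) - \sum_(0 <= j < N) y ^+ j.+1 / j.+1%:R.

Let is_derive_f N (y : R) : y < 1 -> is_derive y 1 (f N) (y ^+ N / (1 - y)).
Proof.
move=> y1; elim: N => [|N IHN].
  have y10 : 0 < 1 - y by rewrite subr_gt0.
  have H := is_deriveN (@is_derive1_comp _ (@ln R) (cst 1 - id) y _ _ (is_derive1_ln y10)
    (is_deriveB (is_derive_cst (1 : R) y 1) (is_derive_id y 1))).
  rewrite (_ : f 0 = - (@ln R \o (cst 1 - id))).
    by apply: (is_derive_eq H); rewrite expr0 mul1r sub0r mulrN1 opprK.
  by apply/funext => x; rewrite /f big_geq// subr0.
have H := is_deriveB IHN (is_deriveZ (N.+1%:R^-1)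
  (DeriveDef (@exprn_derivable R N.+1 y 1) (exp_derive N.+1 y 1))).
rewrite (_ : f N.+1 = f N - (N.+1%:R^-1 \*: (@GRing.exp R ^~ N.+1))).
  apply: (is_derive_eq H); rewrite /GRing.scale /= exprS; field.
  by rewrite nat1r pnatr_eq0 /= subr_eq0 gt_eqF.
apply/funext => x; rewrite /f big_nat_recr//= opprD addrA; congr (_ - _).
by rewrite mulrC.
Qed.

(** The remainder after [N] terms vanishes at 0 and has derivative [y ^+ N / (1 - y)]; the mean
    value theorem bounds it by a geometric sequence. *)
Lemma cvg_log_series (x : R) : 0 <= x -> x < 1 ->
  series (fun j => x ^+ j.+1 / j.+1%:R) @ \oo --> - ln (1 - x).
Proof.
move=> x0 x1; have x10 : 0 < 1 - x by rewrite subr_gt0.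
have bound N : `|- ln (1 - x) - series (fun j => x ^+ j.+1 / j.+1%:R) N| <= x ^+ N / (1 - x).
  have [||c] := @MVT_segment _ (f N) (fun y => y ^+ N / (1 - y)) 0 x x0.
  - by move=> y; rewrite in_itv/= => /andP[_ yx]; apply: is_derive_f; exact: lt_trans x1.
  - apply: derivable_within_continuous => y; rewrite in_itv/= => /andP[_ yx].
    by have [] := is_derive_f N (le_lt_trans yx x1).
  rewrite in_itv/= => /andP[c0 cx].
  have -> : f N 0 = 0.
    rewrite /f subr0 ln1 oppr0 sub0r big1 ?oppr0// => j _.
    by rewrite exprS mul0r mul0r.
  rewrite subr0 subr0 -/(f N x) => ->.
  have c1 : 0 < 1 - c by rewrite subr_gt0 (le_lt_trans cx).
  rewrite ger0_norm; last first.
    by rewrite mulr_ge0// divr_ge0 ?exprn_ge0// ltW.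
  apply: (@le_trans _ _ (c ^+ N / (1 - c) * 1)).
    by rewrite ler_wpM2l ?divr_ge0 ?exprn_ge0// ltW.
  rewrite mulr1; apply: ler_pM; rewrite ?exprn_ge0 ?invr_ge0 ?(ltW c1)//.
    by rewrite lerXn2r ?nnegrE.
  by rewrite lef_pV2 ?posrE// lerD2l lerN2.
apply/cvgrPdist_le => e e0.
have : geometric (1 - x)^-1 x @ \oo --> 0 by apply: cvg_geometric; rewrite ger0_norm.
move=> /cvgr0_norm_le/(_ _ e0)[N0 _ HN0]; exists N0 => // N NN0 /=.
apply: le_trans (bound N) _; have := HN0 N NN0; rewrite /= mulrC.
by apply: le_trans; exact: ler_norm.
Qed.

End log_series.

Section zeta_weights.
Context {R : realType}.

Definition zweight (a j : nat) : R := (j.+1%:R ^+ a)^-1.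

Lemma zweight_ge0 a j : 0 <= zweight a j.
Proof. by rewrite invr_ge0 exprn_ge0. Qed.

Lemma zweight0 a : zweight a 0 = 1.
Proof. by rewrite /zweight expr1n invr1. Qed.

(** Telescoping comparison with the inverse squares. Starting at two terms, where [1 + 1 / 4] equals
    [7 / 4 - 1 / 2], brings the limit strictly below 2, as the contraction demands. *)
Lemma series_zweight_le a N : (2 <= a)%N -> series (zweight a) N.+2 <= 7 / 4 - N.+2%:R^-1.
Proof.
move=> a2.
have w2 j : zweight a j <= (j.+1%:R ^+ 2)^-1.
  by rewrite lef_pV2 ?posrE ?exprn_gt0// ler_weXn2l// ler1n.
elim: N => [|N IHN].
  rewrite /series /= !big_nat_recr//= big_geq// add0r zweight0.
  have := w2 1%N; lra.
rewrite /series /= big_nat_recr//=; apply: (le_trans (lerD IHN (w2 _))).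
have : (N.+3%:R ^+ 2)^-1 <= N.+2%:R^-1 - N.+3%:R^-1 :> R.
  have p2 : 0 < N.+2%:R :> R by [].
  have -> : N.+2%:R^-1 - N.+3%:R^-1 = (N.+2%:R * N.+3%:R)^-1 :> R.
    have -> : N.+3%:R = N.+2%:R + 1 :> R by rewrite -natr1.
    field; by rewrite gt_eqF// gt_eqF// addr_gt0.
  rewrite lef_pV2 ?posrE ?mulr_gt0 ?exprn_gt0// expr2 ler_pM2r// ler_nat; lia.
by move: (N.+3%:R ^- 2) (N.+2%:R^-1) (N.+3%:R^-1) => A B C; lra.
Qed.

Lemma cvg_zweight a : (2 <= a)%N -> series (zweight a) @ \oo --> zeta (a%:R : R).
Proof.
move=> a2.
have -> : zeta (a%:R : R) = limn (series (zweight a)).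
  rewrite /zeta; congr (limn (series _)); apply/funext => j.
  by rewrite powR_invn.
apply: nondecreasing_is_cvgn; first by apply: nondecreasing_series => *; exact: zweight_ge0.
exists (7 / 4) => _ [N _ <-].
apply: (@le_trans _ _ (series (zweight a) N.+2)).
  apply: (nondecreasing_series (fun j _ _ => zweight_ge0 a j)); lia.
by apply: (le_trans (series_zweight_le N a2)); rewrite gerBl invr_ge0.
Qed.

Lemma zeta_lt2 a : (2 <= a)%N -> zeta (a%:R : R) < 2.
Proof.
move=> a2; apply: (@le_lt_trans _ _ (7 / 4)); last lra.
have := cvg_zweight a2 => /cvgr_to_le; apply.
exists 2%N => // -[//|[//|N]] _ /=.
by apply: (le_trans (series_zweight_le N a2)); rewrite gerBl invr_ge0.
Qed.

Lemma zeta_ge1 a : (2 <= a)%N -> 1 <= zeta (a%:R : R).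
Proof.
move=> a2; have := cvg_zweight a2 => /cvgr_to_ge; apply.
exists 1%N => // -[//|N] _ /=; rewrite /series /= big_nat_recl//= zweight0 lerDl.
by apply: sumr_ge0 => j _; exact: zweight_ge0.
Qed.

End zeta_weights.

(** * Lattice sums over a cone *)

Section esum_extra.
Context {R : realType}.
Local Open Scope ereal_scope.

Lemma esumZl (T : choiceType) (S : set T) (a : T -> \bar R) (c : R) : (0 < c)%R ->
  (forall i, S i -> 0 <= a i) ->
  \esum_(i in S) (c%:E * a i) = c%:E * \esum_(i in S) a i.
Proof.
have le (b : T -> \bar R) (x : R) : (0 < x)%R -> (forall i, S i -> 0 <= b i) ->
    \esum_(i in S) (x%:E * b i) <= x%:E * \esum_(i in S) b i.
  move=> x0 b0; apply: ge_ereal_sup => _ [X [fX XS] <-].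
  rewrite fsbig_finite//= big_seq -ge0_sume_distrr; last first.
    by move=> i; rewrite in_fset_set// inE => /XS; exact: b0.
  rewrite -big_seq.
  apply: lee_wpmul2l; first by rewrite lee_fin ltW.
  apply: esum_ge; exists X; first by split.
  by rewrite fsbig_finite.
move=> c0 a0; apply/eqP; rewrite eq_le le//=.
have := le (fun i => c%:E * a i) (c^-1)%R.
rewrite invr_gt0 => /(_ c0).
have ca0 i : S i -> 0 <= c%:E * a i by move=> Si; rewrite mule_ge0 ?lee_fin ?(ltW c0)// a0.
move=> /(_ ca0) H.
have : c%:E * (\esum_(i in S) a i) <= c%:E * (c^-1%:E * \esum_(i in S) (c%:E * a i)).
  apply: lee_wpmul2l; first by rewrite lee_fin ltW.
  apply: le_trans H; rewrite le_eqVlt; apply/orP; left; apply/eqP.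
  by apply: eq_esum => i _; rewrite muleA -EFinM mulVf ?gt_eqF// mul1e.
by rewrite muleA -EFinM divff ?gt_eqF// mul1e.
Qed.

Lemma exchange_esum (T1 T2 : choiceType) (I : set T1) (J : set T2)
    (a : T1 -> T2 -> \bar R) : (forall i j, I i -> J j -> 0 <= a i j) ->
  \esum_(i in I) \esum_(j in J) a i j = \esum_(j in J) \esum_(i in I) a i j.
Proof.
move=> a0; rewrite (@esum_esum _ _ _ I (fun=> J))//.
rewrite (@esum_esum _ _ _ J (fun=> I) (fun j i => a i j)); last by move=> j i Jj Ii; exact: a0.
rewrite (reindex_esum (J `*`` fun=> I) (I `*`` fun=> J) (fun k => (k.2, k.1)))//.
split.
- by move=> [j i] [].
- by move=> [j i] [j' i'] _ _ [-> ->].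
- by move=> [i j] [Ii Jj]; exists (j, i).
Qed.

Lemma nneseries_EFin (a : nat -> R) (G : R) : (forall j, 0 <= a j)%R ->
  \sum_(j <oo) (a j)%:E = G%:E <-> series a @ \oo --> G.
Proof.
move=> a0.
have E : eseries (EFin \o a) = EFin \o series a.
  by apply/funext => N; rewrite /eseries /series /= sumEFin.
have cv := @is_cvg_nneseries R (fun j => (a j)%:E) xpredT 0%N (fun j _ _ => a0 j).
split=> [H|H].
  have : eseries (EFin \o a) @ \oo --> G%:E by rewrite -H; exact: cv.
  by rewrite E => /fine_cvgP[].
have H' : eseries (EFin \o a) @ \oo --> G%:E.
  by rewrite E; apply: cvg_EFin => //; exact: nearW.
exact/cvg_lim.
Qed.

End esum_extra.

Section intvec_theory.
Context {R : realType} {m : nat}.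
Implicit Types (v w : 'rV[int]_m).

Lemma intvecD v w : intvec (v + w) = intvec v + intvec w :> 'rV[R]_m.
Proof. by apply/rowP => i; rewrite !mxE intrD. Qed.

Lemma intvecB v w : intvec (v - w) = intvec v - intvec w :> 'rV[R]_m.
Proof. by apply/rowP => i; rewrite !mxE intrB. Qed.

Lemma intvec0 : intvec 0 = 0 :> 'rV[R]_m.
Proof. by apply/rowP => i; rewrite !mxE. Qed.

Lemma intvecMn v (k : nat) : intvec (v *+ k) = k%:R *: intvec v :> 'rV[R]_m.
Proof. by apply/rowP => i; rewrite !mxE mulmxnE rmorphMn/= mulr_natl. Qed.

Lemma intvec_sum (I : Type) (r : seq I) (f : I -> 'rV[int]_m) :
  intvec (\sum_(i <- r) f i) = \sum_(i <- r) intvec (f i) :> 'rV[R]_m.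
Proof.
elim: r => [|i r IH]; first by rewrite !big_nil intvec0.
by rewrite !big_cons intvecD IH.
Qed.

Lemma intvec_eq0 v : (intvec v == 0 :> 'rV[R]_m) = (v == 0).
Proof.
apply/eqP/eqP => [H|->]; last exact: intvec0.
by apply/rowP => i; move/rowP : H => /(_ i); rewrite !mxE => /eqP; rewrite intr_eq0 => /eqP.
Qed.

Lemma norm_intvec_ge1 v : v != 0 -> 1 <= `|intvec v : 'rV[R]_m|.
Proof.
move=> v0; have [i vi] : exists i, v ord0 i != 0.
  apply: contrapT => N; case/negP: v0; apply/eqP/rowP => i; rewrite mxE.
  by apply: contrapT => /eqP vi; apply: N; exists i.
apply: le_trans (coord_le_norm _ i); rewrite mxE -intr_norm -[1]/(1%:~R) ler_int.
by rewrite -gtz0_ge1 normr_gt0.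
Qed.

End intvec_theory.

(** * Primitive integer vectors *)

Section primitive_vectors.
Context {m : nat}.
Implicit Types (v w : 'rV[int]_m).

(** Equivalent to coprime coordinates; stated through multiples, the form in which it is used. *)
Definition primitive v := v != 0 /\ forall (j : nat) w, v = w *+ j -> j = 1%N.

Let size v : nat := \sum_i `|v ord0 i|%N.

Let sizeMn v (k : nat) : size (v *+ k) = (k * size v)%N.
Proof.
rewrite /size big_distrr; apply: eq_bigr => i _; rewrite mulmxnE -mulr_natl abszM.
by rewrite natz.
Qed.

Let size_eq0 v : (size v == 0%N) = (v == 0).
Proof.
apply/eqP/eqP => [/eqP|->]; last by rewrite /size big1// => i _; rewrite mxE.
rewrite sum_nat_eq0 => /forallP H; apply/rowP => i; rewrite mxE.
by apply/eqP; rewrite -absz_eq0; exact: H.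
Qed.

Lemma primitive_decomp v : v != 0 -> exists (k : nat) w, primitive w /\ v = w *+ k.+1.
Proof.
have [s] := ubnP (size v); elim: s v => [//|s IH] v vs v0.
have [vp|nvp] := pselect (primitive v); first by exists 0%N, v; rewrite mulr1n.
have [j [w [vE j1]]] : exists (j : nat) w, v = w *+ j /\ j != 1%N.
  apply: contrapT => N; apply: nvp; split=> // j w vE.
  by apply: contrapT => /eqP j1; apply: N; exists j, w.
have j0 : j != 0%N by apply: contra_neq v0 => j0; rewrite vE j0 mulr0n.
have w0 : w != 0 by apply: contra_neq v0 => w0; rewrite vE w0 mul0rn.
have ws : (0 < size w)%N by rewrite lt0n size_eq0.
have /IH/(_ w0)[k [w' [w'p wE]]] : (size w < s)%N.
  rewrite vE sizeMn in vs; nia.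
exists (k.+1 * j).-1, w'; split=> //.
rewrite vE wE -mulrnA prednK// muln_gt0 lt0n; lia.
Qed.

(** A Bezout relation [p a = q b + 1] exhibits [v] as [b] times [w *+ p - v *+ q]. *)
Let divide v w (a b : nat) : (0 < a)%N -> coprime a b -> primitive v -> v *+ a = w *+ b -> b = 1%N.
Proof.
move=> a0 ab [_ vp] E.
have [p q pq _] := egcdnP b a0; rewrite (eqP ab) in pq.
apply: (vp b (w *+ p - v *+ q)).
have : v *+ (a * p) = v *+ (q * b).+1 by rewrite mulnC pq addn1.
rewrite mulrnA E mulrS => H.
by rewrite mulrnBl -!mulrnA (mulnC p b) mulrnA H addrK.
Qed.

Lemma primitive_unique v w (a b : nat) : primitive v -> primitive w ->
  v *+ a.+1 = w *+ b.+1 -> v = w /\ a = b.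
Proof.
move=> vp wp E.
pose g := gcdn a.+1 b.+1.
have g0 : (0 < g)%N by rewrite gcdn_gt0.
have /dvdnP[a' aE] : (g %| a.+1)%N by exact: dvdn_gcdl.
have /dvdnP[b' bE] : (g %| b.+1)%N by exact: dvdn_gcdr.
have a'0 : (0 < a')%N by case: a' aE.
have b'0 : (0 < b')%N by case: b' bE.
have cop : coprime a' b'.
  have : gcdn (a' * g) (b' * g) = g by rewrite -aE -bE.
  by rewrite -muln_gcdl -{2}[g]mul1n => /eqP; rewrite eqn_pmul2r.
have E' : v *+ a' = w *+ b'.
  apply/rowP => i; move/rowP : E => /(_ i); rewrite aE bE !mulmxnE !mulrnA.
  by move=> /eqP; rewrite eqrMn2r (gtn_eqF g0)/= => /eqP.
have b1 := divide a'0 cop vp E'.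
have a1 := divide b'0 (etrans (coprime_sym _ _) cop) wp (esym E').
rewrite a1 b1 !mulr1n in E'; split=> //.
by rewrite a1 mul1n in aE; rewrite b1 mul1n -aE in bE; case: bE.
Qed.

End primitive_vectors.

(** Logarithm of [1 / (1 - expR (- y))], the generating function of one multiplicity. *)
Definition log_factor {R : realType} (y : R) : R := - ln (1 - expR (- y)).

Lemma log_factor_series {R : realType} (y : R) : 0 < y ->
  (\sum_(j <oo) (expR (- (j.+1%:R * y)) / j.+1%:R)%:E = (log_factor y)%:E)%E.
Proof.
move=> y0; apply/nneseries_EFin => [j|]; first by rewrite divr_ge0 ?expR_ge0.
rewrite (_ : (fun j : nat => _) = (fun j => expR (- y) ^+ j.+1 / j.+1%:R)).
  apply: cvg_log_series; rewrite ?expR_ge0//.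
  by rewrite -[X in _ < X]expR0 ltr_expR oppr_lt0.
by apply/funext => j; rewrite -expRM_natl mulrN.
Qed.

Lemma log_factor_ge0 {R : realType} (y : R) : 0 < y -> 0 <= log_factor y.
Proof.
move=> y0; rewrite -lee_fin -log_factor_series//; apply: nneseries_ge0 => j _ _.
by rewrite lee_fin divr_ge0 ?expR_ge0.
Qed.

Section floor_box_integral.
Context {R : realType} {m : nat}.
Local Open Scope ereal_scope.

(** Countable additivity over the boxes, enumerated through [pickle_inv]; an index that codes no
    vector gets the empty set. *)
Lemma integral_floor_boxes (C : set 'rV[R]_m) (f : 'rV[R]_m -> \bar R) :
  measurable C -> measurable_fun C f -> (forall x, C x -> 0 <= f x) ->
  \int[lebesgue_rV m]_(x in C) f x =
  \esum_(v in [set: 'rV[int]_m]) \int[lebesgue_rV m]_(x in C `&` floor_box v) f x.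
Proof.
move=> mC mf f0.
pose F (N : nat) := if choice.pickle_inv N is Some v then C `&` floor_box (v : 'rV[int]_m) else set0.
have CE : C = \bigcup_N F N.
  apply/seteqP; split=> [x Cx|x [N _]].
    exists (choice.pickle (\row_i Num.floor (x ord0 i) : 'rV[int]_m)) => //.
    by rewrite /F choice.pickleK_inv; split=> //; exact: floor_box_floor.
  by rewrite /F; case: choice.pickle_inv => // v [].
have mF N : measurable (F N).
  rewrite /F; case: choice.pickle_inv => [v|]; last exact: measurable0.
  by apply: measurableI => //; exact: measurable_floor_box.
have tF : trivIset setT F.
  move=> N M _ _ [x []]; rewrite /F.
  case EN : choice.pickle_inv => [v|//] [_ vx]; case EM : choice.pickle_inv => [w|//] [_ wx].
  have := @choice.pickle_invK 'rV[int]_m N; have := @choice.pickle_invK 'rV[int]_m M.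
  rewrite EN EM /= => <- <-; congr choice.pickle.
  by rewrite (floor_boxP vx) (floor_boxP wx).
have f0' x : (\bigcup_N F N) x -> 0 <= f x by rewrite -CE; exact: f0.
rewrite {1}CE ge0_integral_bigcup//; last by rewrite -CE.
have g0 N : 0 <= \int[lebesgue_rV m]_(x in F N) f x.
  by apply: integral_ge0 => x Fx; apply: f0'; exists N.
rewrite nneseries_esumT//.
rewrite (esumID (range (@choice.pickle 'rV[int]_m)))//.
rewrite [X in _ + X]esum1 ?adde0; last first.
  move=> N [_ NN]; rewrite /F; case E : choice.pickle_inv => [v|]; last exact: integral_set0.
  exfalso; apply: NN; exists v => //.
  by have := @choice.pickle_invK 'rV[int]_m N; rewrite E.
rewrite setTI esum_image; last by move=> v w _ _; exact: (pcan_inj choice.pickleK).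
by apply: eq_esum => v _; rewrite /F choice.pickleK_inv.
Qed.

End floor_box_integral.

(** * From exponential lattice sums to sums over primitive vectors *)

Section lattice_sums.
Context {R : realType} {n : nat}.
Variable C : set 'rV[R]_n.+1.
Hypotheses (C_closed : closed C) (C_convex : convex_set C) (C_cone : is_cone C)
  (C_pointed : contains_no_line C) (C_solid : interior C !=set0).
Variable u : 'rV[R]_n.+1.
Hypothesis uC : strict_dual C u.

Local Notation lap := (laplace C).
Local Notation du v := (dotr u (intvec v)).

Let mC : measurable C. Proof. exact: closed_measurable_rV. Qed.

Definition lattice0 : set 'rV[int]_n.+1 := [set v | C (intvec v)].
Definition lattice1 : set 'rV[int]_n.+1 := [set v | v != 0 /\ C (intvec v)].
Definition lattice_prim : set 'rV[int]_n.+1 := [set v | primitive v /\ C (intvec v)].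

(** A fixed lattice translation that absorbs boundary effects: it carries every unit ball centred in
    [C] into [C]. *)
Lemma lattice_shift : exists e : 'rV[int]_n.+1,
  forall x : 'rV[R]_n.+1, `|x| <= 1 -> C (intvec e + x).
Proof.
have [a /interior_box[r r0 Hr]] := C_solid.
pose z := (2 / r) *: a.
exists (\row_i Num.floor (z ord0 i)) => x x1.
set e := \row_i _.
have -> : intvec e + x = (2 / r) *: (a + (r / 2) *: (intvec e + x - z)).
  rewrite scalerDr scalerA (_ : 2 / r * (r / 2) = 1) ?scale1r.
    by rewrite addrCA -/z subrr addr0.
  by field; rewrite gt_eqF.
apply: C_cone; first by rewrite divr_ge0// ltW.
apply: Hr; rewrite normrZ gtr0_norm ?divr_gt0//.
rewrite -ler_pdivlMl ?divr_gt0// (_ : (r / 2)^-1 * r = 2); last by field; rewrite gt_eqF.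
rewrite addrAC (le_trans (ler_normD _ _))// [leRHS](_ : 2 = 1 + 1)// lerD//.
by rewrite distrC; apply: floor_box_norm; exact: floor_box_floor.
Qed.

Lemma norm1Z (w : 'rV[R]_n.+1) (t : R) : 0 <= t -> norm1 (t *: w) = t * norm1 w.
Proof.
by move=> t0; rewrite /norm1 mulr_sumr; apply: eq_bigr => i _; rewrite mxE normrM ger0_norm.
Qed.

Local Open Scope ereal_scope.

(** After the shift by [e], the box of each lattice point of [C] lies in [C], and each box that
    meets [C] has its corner shifted into [C]. The error is a constant in the height, hence harmless
    after multiplication by a small [t]. *)
Lemma lattice0_bounds : exists2 c : R, (0 <= c)%R & forall t, (0 < t)%R ->
  \esum_(v in lattice0) (expR (- (t * (du v + c))))%:E <= (lap u / t ^+ n.+1)%:E /\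
  (lap u / t ^+ n.+1)%:E <= \esum_(v in lattice0) (expR (- (t * (du v - c))))%:E.
Proof.
have [e He] := lattice_shift.
have Ce : C (intvec e) by have := He 0%R; rewrite normr0 addr0; apply.
have due : (0 <= du e)%R by exact: strict_dual_ge0 uC Ce.
exists (du e + norm1 u)%R; first by rewrite addr_ge0// norm1_ge0.
move=> t t0.
have IE : \int[lebesgue_rV n.+1]_(x in C) (expR (- dotr (t *: u) x))%:E =
    (lap u / t ^+ n.+1)%:E.
  rewrite -(integral_expRZ C_closed C_cone C_solid t0 uC).
  by apply: eq_integral => x _; rewrite dotrZl.
split; rewrite -IE.
- apply: ge_ereal_sup => _ [X [fX XS] <-]; rewrite fsbig_finite//.
  apply: le_trans (sum_expR_le_integral (t *: u) (F := [seq (v + e)%R | v <- fset_set X]) mC _ _).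
  + rewrite big_map; apply: lee_sum => v _.
    rewrite lee_fin ler_expR dotrZl norm1Z ?(ltW t0)// intvecD dotrDr; lra.
  + by rewrite map_inj_uniq ?fset_uniq//; exact: addIr.
  + move=> w /mapP[v]; rewrite in_fset_set// inE => /XS Xv -> x vx.
    have -> : x = (intvec v + (intvec e + (x - intvec (v + e))))%R.
      by rewrite intvecD addrA addrCA subrr addr0.
    by apply: coneD => //; apply: He; exact: floor_box_norm.
- rewrite integral_floor_boxes//; last exact: measurable_expR_dotr.
  (* The other boxes do not meet [C], so they contribute nothing. *)
  rewrite (esumID [set v | lattice0 (v + e)%R]); last first.
    by move=> v _; exact: integral_ge0.
  rewrite [X in _ + X]esum1 ?adde0; last first.
    move=> v [_ nv]; rewrite (_ : C `&` floor_box v = set0) ?integral_set0//.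
    apply/seteqP; split=> // x [Cx vx]; apply: nv; rewrite /lattice0 /=.
    have -> : intvec (v + e) = (x + (intvec e + (intvec v - x)))%R :> 'rV[R]_n.+1.
      by rewrite intvecD addrC [RHS]addrC -addrA subrK.
    by apply: coneD => //; apply: He; rewrite distrC; exact: floor_box_norm.
  rewrite setTI (reindex_esum [set v | lattice0 (v + e)%R] lattice0 (fun v => v + e)%R); last first.
    split=> [v //|v w _ _ /addIr//|v Lv].
    by exists (v - e)%R; rewrite /= ?subrK.
  apply: le_esum => v _.
  apply: (@le_trans _ _ (\int[lebesgue_rV n.+1]_(x in floor_box v) (expR (- dotr (t *: u) x))%:E)).
    apply: ge0_subset_integral => //.
    + by apply: measurableI => //; exact: measurable_floor_box.
    + exact: measurable_floor_box.
    + exact: measurable_expR_dotr.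
  rewrite -[leRHS]mule1 -(lebesgue_floor_box v) -integral_cst; last exact: measurable_floor_box.
  apply: ge0_le_integral => //.
  + exact: measurable_floor_box.
  + exact: measurable_expR_dotr.
  + move=> x /(floor_box_dotr u); rewrite /= lee_fin ler_expR ler_norml dotrZl => /andP[h _].
    rewrite lerN2 ler_pM2l// intvecD dotrDr; lra.
Qed.

Let a0 (t : R) (v : 'rV[int]_n.+1) : 0 <= (expR (- (t * du v)))%:E :> \bar R.
Proof. by rewrite lee_fin expR_ge0. Qed.

Lemma lattice1_gap : exists2 k : R, (0 < k)%R & forall v, lattice1 v -> (k <= du v)%R.
Proof.
have [k k0 Hk] := strict_dual_coercive C_closed C_cone uC.
exists k => // v [v0 Cv]; apply: le_trans (Hk _ Cv).
by rewrite ler_peMr ?(ltW k0)// norm_intvec_ge1.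
Qed.

Definition lattice_sum (t : R) : R := fine (\esum_(v in lattice1) (expR (- (t * du v)))%:E).

(** The [1] is the term of the zero vector. The last bound holds for every [t > 0], large ones
    included, because the dilates [j t] in the series below are unbounded. *)
Lemma lattice_sum_bounds : exists c B : R, [/\ (0 <= c)%R, (0 <= B)%R & forall t, (0 < t)%R ->
  [/\ \esum_(v in lattice1) (expR (- (t * du v)))%:E = (lattice_sum t)%:E,
   (lattice_sum t + 1 <= expR (t * c) * (lap u / t ^+ n.+1))%R,
   (lap u / t ^+ n.+1 <= expR (t * c) * (lattice_sum t + 1))%R &
   (t ^+ n.+1 * lattice_sum t <= B)%R]].
Proof.
have [c c0 Hc] := lattice0_bounds.
have [k k0 Hk] := lattice1_gap.
have l0 := laplace_gt0 C_closed C_cone C_solid uC.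
(* Heights of nonzero lattice vectors are at least [k], so [rho * (du v + c) <= du v]: rescaling [t]
   removes the shift for all [t] at once. *)
pose rho := (k / (k + c))%R.
have kc : (0 < k + c)%R by rewrite ltr_pwDl.
have rho0 : (0 < rho)%R by rewrite divr_gt0.
exists c, (lap u / rho ^+ n.+1)%R; split=> //.
  by rewrite divr_ge0 ?exprn_ge0 ?ltW.
move=> t t0.
have [H1 H2] := Hc t t0.
have E0 : \esum_(v in lattice0) (expR (- (t * du v)))%:E =
    \esum_(v in lattice1) (expR (- (t * du v)))%:E + 1.
  rewrite (esumID [set 0%R]) => [|v _]; last exact: a0.
  rewrite addeC; congr (_ + _).
    congr esum; apply/seteqP; split=> [v [Lv /eqP v0]//|v [v0 Cv]].
    by split=> //; exact/eqP.
  rewrite (_ : _ `&` _ = [set 0%R]); last first.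
    apply/seteqP; split=> [v []//|_ ->]; split=> //; rewrite /lattice0 /= intvec0.
    exact: cone0.
  by rewrite esum_set1 ?intvec0 ?dotr0 ?mulr0 ?oppr0 ?expR0//; exact: a0.
have Z1 : \esum_(v in lattice0) (expR (- (t * (du v + c))))%:E =
    (expR (- (t * c)))%:E * \esum_(v in lattice0) (expR (- (t * du v)))%:E.
  rewrite -esumZl; [|exact: expR_gt0|by move=> v _; exact: a0].
  by apply: eq_esum => v _; rewrite -EFinM -expRD mulrDr opprD addrC.
have Z2 : \esum_(v in lattice0) (expR (- (t * (du v - c))))%:E =
    (expR (t * c))%:E * \esum_(v in lattice0) (expR (- (t * du v)))%:E.
  rewrite -esumZl; [|exact: expR_gt0|by move=> v _; exact: a0].
  by apply: eq_esum => v _; rewrite -EFinM -expRD mulrBr opprB.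
have B3 : \esum_(v in lattice1) (expR (- (t * du v)))%:E <= (lap u / (rho * t) ^+ n.+1)%:E.
  have [H3 _] := Hc (rho * t)%R (mulr_gt0 rho0 t0).
  apply: le_trans H3.
  apply: (@le_trans _ _ (\esum_(v in lattice1) (expR (- (rho * t * (du v + c))))%:E)).
    apply: le_esum => v Lv; rewrite lee_fin ler_expR lerN2 mulrAC [leRHS]mulrC ler_pM2r//.
    rewrite /rho mulrAC ler_pdivrMr//; have := Hk _ Lv.
    by move=> h; rewrite !mulrDr lerD ?ler_wpM2r// mulrC.
  rewrite [leRHS](esumID [set v | v != 0%R]) => [|v _]; last by rewrite lee_fin expR_ge0.
  rewrite (_ : lattice0 `&` _ = lattice1).
    by rewrite leeDl// esum_ge0// => v _; rewrite lee_fin expR_ge0.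
  by apply/seteqP; split=> v [].
have fin1 : \esum_(v in lattice1) (expR (- (t * du v)))%:E \is a fin_num.
  rewrite ge0_fin_numE; first exact: le_lt_trans B3 (ltry _).
  by apply: esum_ge0 => v _; exact: a0.
have E1 : \esum_(v in lattice1) (expR (- (t * du v)))%:E = (lattice_sum t)%:E.
  by rewrite fineK.
rewrite E0 E1 -EFinD in Z1 Z2; rewrite E1 lee_fin in B3.
rewrite Z1 -EFinM lee_fin in H1; rewrite Z2 -EFinM lee_fin in H2.
split=> //.
- have := expR_gt0 (t * c)%R; rewrite expRN in H1 => e0.
  by rewrite -ler_pdivrMl.
- rewrite mulrC -ler_pdivlMr ?exprn_gt0// (le_trans B3)//.
  by rewrite exprMn invfM mulrA.
Qed.

Definition log_sum (t : R) : R := fine (\esum_(v in lattice1) (log_factor (t * du v))%:E).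

Definition prim_log_sum (t : R) : R :=
  fine (\esum_(v in lattice_prim) (log_factor (t * du v))%:E).

Let du_gt0 v : lattice1 v -> (0 < du v)%R.
Proof. by move=> [v0 Cv]; apply: uC => //; rewrite intvec_eq0. Qed.

Let phi0 (t : R) v : (0 < t)%R -> lattice1 v -> 0 <= (log_factor (t * du v))%:E.
Proof. by move=> t0 Lv; rewrite lee_fin log_factor_ge0// mulr_gt0// du_gt0. Qed.

Let scaled_lattice_sum (t : R) := (t ^+ n.+1 * lattice_sum t)%R.

Let lattice_sum_ge0 (t : R) : (0 <= lattice_sum t)%R.
Proof. by rewrite fine_ge0// esum_ge0// => v _; exact: a0. Qed.

(** Expanding the logarithm and exchanging sums gives [lattice_sum (j t) / j] summed over [j];
    normalising each term by its own [(j t) ^+ n.+1] turns [1 / j] into [zweight n.+2]. *)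
Lemma log_sumE : exists2 B : R, (0 <= B)%R & forall t, (0 < t)%R ->
  [/\ \esum_(v in lattice1) (log_factor (t * du v))%:E = (log_sum t)%:E,
   series (fun j => zweight n.+2 j * (scaled_lattice_sum (j.+1%:R * t)))%R @ \oo -->
     (t ^+ n.+1 * log_sum t)%R &
   (t ^+ n.+1 * log_sum t <= B)%R].
Proof.
have [c [B [c0 B0 HB]]] := lattice_sum_bounds.
have cz := @cvg_zweight R n.+2 isT.
exists (zeta (n.+2%:R : R) * B)%R.
  by rewrite mulr_ge0// (le_trans ler01)// zeta_ge1.
move=> t t0.
have tn0 : (0 < t ^+ n.+1)%R by rewrite exprn_gt0.
set a := (fun j => zweight n.+2 j * _)%R.
have aj0 j : (0 <= a j)%R.
  by rewrite mulr_ge0 ?zweight_ge0// mulr_ge0// exprn_ge0// mulr_ge0// ltW.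
have aB j : (a j <= zweight n.+2 j * B)%R.
  by rewrite ler_wpM2l ?zweight_ge0//; have [] := HB (j.+1%:R * t)%R (mulr_gt0 (ltr0Sn _ j) t0).
have sB N : (series a N <= zeta (n.+2%:R : R) * B)%R.
  apply: (@le_trans _ _ (series (zweight n.+2) N * B)%R).
    by rewrite /series /= mulr_suml; apply: ler_sum => j _; exact: aB.
  rewrite ler_wpM2r// -(cvg_lim _ cz)//; apply: nondecreasing_cvgn_le; last exact: cvgP cz.
  by apply: nondecreasing_series => *; exact: zweight_ge0.
have ca : cvgn (series a).
  apply: nondecreasing_is_cvgn; first by apply: nondecreasing_series => *; exact: aj0.
  by exists (zeta (n.+2%:R : R) * B)%R => _ [N _ <-].
have E : \esum_(v in lattice1) (log_factor (t * du v))%:E = ((t ^+ n.+1)^-1 * limn (series a))%:E.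
  under eq_esum => v Lv.
    rewrite -log_factor_series; last by rewrite mulr_gt0// du_gt0.
    rewrite nneseries_esumT => [|j]; last by rewrite lee_fin divr_ge0 ?expR_ge0.
    over.
  rewrite exchange_esum => [|v j _ _]; last by rewrite lee_fin divr_ge0 ?expR_ge0.
  have aE j : \esum_(v in lattice1) (expR (- (j.+1%:R * (t * du v))) / j.+1%:R)%:E =
      ((t ^+ n.+1)^-1 * a j)%:E.
    have [E1 _ _ _] := HB (j.+1%:R * t)%R (mulr_gt0 (ltr0Sn _ j) t0).
    rewrite /a /scaled_lattice_sum /zweight exprMn.
    rewrite (_ : (_ * _)%R = (j.+1%:R^-1 * lattice_sum (j.+1%:R * t))%R); last first.
      rewrite [(j.+1%:R ^+ n.+2)%R]exprS; field.
      by rewrite nat1r pnatr_eq0 /= (gt_eqF tn0) expf_neq0// pnatr_eq0.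
    rewrite EFinM -E1 -esumZl; [|by rewrite invr_gt0|by move=> v _; exact: a0].
    by apply: eq_esum => v _; rewrite -EFinM mulrC mulrA.
  under eq_esum do rewrite aE.
  rewrite -nneseries_esumT => [|j]; last by rewrite lee_fin mulr_ge0// invr_ge0 ltW.
  apply/nneseries_EFin => [j|]; first by rewrite mulr_ge0// invr_ge0 ltW.
  rewrite (_ : series _ = (fun N => (t ^+ n.+1)^-1 * series a N)%R).
    by apply: cvgMr; exact: ca.
  by apply/funext => N; rewrite /series /= mulr_sumr.
have L : log_sum t = ((t ^+ n.+1)^-1 * limn (series a))%R by rewrite /log_sum E.
split.
- by rewrite E L.
- by rewrite L mulrA divff ?gt_eqF// mul1r; exact: ca.
- rewrite L mulrA divff ?gt_eqF// mul1r; apply: limr_le => //.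
  by apply: nearW => N; exact: sB.
Qed.

Lemma lattice_prim_bij :
  set_bij ([set: nat] `*`` (fun=> lattice_prim)) lattice1 (fun p => p.2 *+ p.1.+1)%R.
Proof.
split.
- move=> [i w] /= [_ [wp Cw]]; split.
    have [w0 _] := wp; rewrite -(intvec_eq0 (R := R)) intvecMn scaler_eq0 negb_or.
    by rewrite pnatr_eq0 intvec_eq0.
  by rewrite intvecMn; apply: C_cone.
- move=> [i w] [j w'] /=; rewrite !inE/= => -[_ [wp _]] [_ [wp' _]] E.
  by have [-> ->] := primitive_unique wp wp' E.
- move=> v [v0 Cv]; have [k [w [wp vE]]] := primitive_decomp v0.
  exists (k, w) => //; split=> //; split=> //.
  have := C_cone (t := (k.+1%:R^-1)%R) _ Cv; rewrite vE intvecMn scalerA mulVf ?pnatr_eq0//.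
  by rewrite scale1r; apply; rewrite invr_ge0.
Qed.

(** Each nonzero lattice vector of [C] is a unique multiple of a primitive one, so [log_sum t] is
    the sum of [prim_log_sum (i t)]; normalising produces [zweight n.+1]. *)
Lemma prim_log_sumE : exists2 B : R, (0 <= B)%R & forall t, (0 < t)%R ->
  [/\ \esum_(v in lattice_prim) (log_factor (t * du v))%:E = (prim_log_sum t)%:E,
   series (fun i => zweight n.+1 i * ((i.+1%:R * t) ^+ n.+1 * prim_log_sum (i.+1%:R * t)))%R
     @ \oo --> (t ^+ n.+1 * log_sum t)%R, (0 <= prim_log_sum t)%R &
   (t ^+ n.+1 * prim_log_sum t <= B)%R].
Proof.
have [B B0 HB] := log_sumE; exists B => //.
have prim1 v : lattice_prim v -> lattice1 v by move=> [[v0 _] Cv].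
have pfin t : (0 < t)%R -> \esum_(v in lattice_prim) (log_factor (t * du v))%:E <= (log_sum t)%:E.
  move=> t0; have [<- _ _] := HB t t0.
  rewrite [leRHS](esumID lattice_prim) => [|v Lv]; last exact: phi0.
  rewrite (_ : lattice1 `&` lattice_prim = lattice_prim); last first.
    by apply/seteqP; split=> [v []//|v Pv]; split=> //; exact: prim1.
  by rewrite leeDl// esum_ge0// => v [Lv _]; exact: phi0.
have pge0 t : (0 < t)%R -> 0 <= \esum_(v in lattice_prim) (log_factor (t * du v))%:E.
  by move=> t0; apply: esum_ge0 => v Pv; apply: phi0 => //; exact: prim1.
have pE t : (0 < t)%R ->
    \esum_(v in lattice_prim) (log_factor (t * du v))%:E = (prim_log_sum t)%:E.
  move=> t0; rewrite fineK// ge0_fin_numE ?pge0//; exact: le_lt_trans (pfin t t0) (ltry _).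
have pge t : (0 < t)%R -> (0 <= prim_log_sum t)%R.
  by move=> t0; rewrite fine_ge0// pge0.
move=> t t0; have [E _ LB] := HB t t0.
have tn0 : (0 < t ^+ n.+1)%R by rewrite exprn_gt0.
split.
- exact: pE.
- have S : \sum_(i <oo) (prim_log_sum (i.+1%:R * t))%:E = (log_sum t)%:E.
    rewrite -E (reindex_esum _ _ _ _ lattice_prim_bij).
    rewrite nneseries_esumT => [|i]; last by rewrite lee_fin pge// mulr_gt0.
    rewrite -(@esum_esum _ _ _ setT (fun=> lattice_prim)
      (fun i w => (log_factor (t * du (w *+ i.+1)))%:E)); last first.
      move=> i w _ Pw; apply: phi0 => //.
      by have [h _ _] := lattice_prim_bij; exact: (h (i, w)).
    apply: eq_esum => i _; rewrite -pE ?mulr_gt0//; apply: eq_esum => w _.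
    by rewrite intvecMn dotrZr mulrA [(t * _)%R]mulrC.
  move/nneseries_EFin : S => S.
  have {}S := S (fun i => pge _ (mulr_gt0 (ltr0Sn _ i) t0)).
  rewrite (_ : series _ = (fun N => t ^+ n.+1 * series (fun i => prim_log_sum (i.+1%:R * t)) N)%R).
    exact: cvgMr.
  apply/funext => N; rewrite /series /= mulr_sumr; apply: eq_bigr => i _.
  rewrite /zweight exprMn; field.
  by rewrite expf_neq0// pnatr_eq0.
- exact: pge.
- apply: le_trans LB; rewrite ler_pM2l// -lee_fin -pE//; exact: pfin.
Qed.

Lemma cvg_lattice_sum :
  (t ^+ n.+1 * lattice_sum t)%R @[t --> (0%R : R)^'+] --> (lap u : R).
Proof.
have [c [B [c0 B0 HB]]] := lattice_sum_bounds.
have l0 := laplace_gt0 C_closed C_cone C_solid uC.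
have ce (s : R) : expR (t * s) @[t --> (0%R : R)^'+] --> (1%R : R).
  apply: cvg_at_right_filter; rewrite -expR0 -[in X in _ --> expR X](mul0r s).
  apply: continuous_comp; last exact: continuous_expR.
  by apply: cvgMl; exact: cvg_id.
have ct : (t ^+ n.+1)%R @[t --> (0%R : R)^'+] --> (0%R : R).
  apply: cvg_at_right_filter; rewrite -[X in _ --> X](expr0n _ n.+1).
  exact: exprn_continuous.
apply: (@squeeze_cvgr _ _ _ _ (fun t => expR (t * (- c)) * lap u - t ^+ n.+1)%R
  (fun t => expR (t * c) * lap u)%R).
- near=> t.
  have t0 : (0 < t)%R by near: t; exact: nbhs_right_gt.
  have tn0 : (0 < t ^+ n.+1)%R by rewrite exprn_gt0.
  have [_ h1 h2 _] := HB t t0.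
  apply/andP; split.
    have : (expR (- (t * c)) * (lap u / t ^+ n.+1) <= lattice_sum t + 1)%R.
      by rewrite expRN ler_pdivrMl ?expR_gt0.
    rewrite mulrA ler_pdivrMr// mulrN; lra.
  have : (lattice_sum t <= expR (t * c) * (lap u / t ^+ n.+1))%R by lra.
  by rewrite mulrA ler_pdivlMr// mulrC.
- rewrite -[X in _ --> X]subr0 -[X in _ --> (X - _)%R]mul1r.
  apply: cvgB => //; apply: cvgMl; exact: ce.
- rewrite -[X in _ --> X]mul1r; apply: cvgMl; exact: ce.
Unshelve. all: by end_near.
Qed.

(** A forward limit with total weight [zeta (n + 2)], then an inversion with total weight
    [zeta (n + 1)]; [1 <= n] puts the latter below 2. *)
Theorem cvg_prim_log_sum : (1 <= n)%N ->
  (t ^+ n.+1 * prim_log_sum t)%R @[t --> (0%R : R)^'+] -->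
  (zeta (n.+2%:R : R) * lap u / zeta (n.+1%:R : R))%R.
Proof.
move=> n1.
have [c [B [c0 B0 HB]]] := lattice_sum_bounds.
have [B1 B10 HB1] := log_sumE; have [B2 B20 HB2] := prim_log_sumE.
have cM : (t ^+ n.+1 * log_sum t)%R @[t --> (0%R : R)^'+] --> (zeta (n.+2%:R : R) * lap u)%R.
  apply: (@weighted_limit _ (zweight n.+2) scaled_lattice_sum _ _ B).
  - exact: zweight_ge0.
  - exact: cvg_zweight.
  - by [].
  - move=> s s0; have [_ _ _ h] := HB s s0.
    by rewrite ger0_norm// mulr_ge0// exprn_ge0// ltW.
  - exact: cvg_lattice_sum.
  - by move=> t t0; have [] := HB1 t t0.
apply: (@weighted_limit_inv _ (zweight n.+1) _ _ _ B2 _ _ _ _ _ _ _ cM).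
- exact: zweight_ge0.
- exact: zweight0.
- exact: cvg_zweight.
- exact: zeta_lt2.
- by [].
- move=> s s0; have [_ _ h0 h] := HB2 s s0.
  by rewrite ger0_norm// mulr_ge0// exprn_ge0// ltW.
- by move=> t t0; have [] := HB2 t t0.
Qed.

End lattice_sums.

(** * Counting zonotopes *)

Section generic_functionals.
Context {R : realType} {m : nat}.
Implicit Types (w th : 'rV[R]_m).

Lemma exists_small (T : eqType) (l : seq T) (a b : T -> R) :
  (forall x, x \in l -> a x != 0) ->
  exists2 t, 0 < t & forall x, x \in l -> t * `|b x| < `|a x|.
Proof.
elim: l => [|x l IH] H; first by exists 1.
have [|t t0 Ht] := IH; first by move=> y yl; apply: H; rewrite inE yl orbT.
have ax : 0 < `|a x| by rewrite normr_gt0 H// inE eqxx.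
have bx : 0 < `|b x| + 1 by rewrite ltr_wpDl.
exists (Num.min t (`|a x| / (`|b x| + 1))); first by rewrite lt_min t0 divr_gt0.
move=> y; rewrite inE => /orP[/eqP ->|yl]; last first.
  by apply: le_lt_trans (Ht y yl); rewrite ler_wpM2r// ge_min lexx.
apply: (@le_lt_trans _ _ (`|a x| / (`|b x| + 1) * `|b x|)).
  by rewrite ler_wpM2r// ge_min lexx orbT.
by rewrite mulrAC ltr_pdivrMr// ltr_pM2l// ltrDl.
Qed.

(** If the current [th] vanishes at the next [w], add a small multiple of the component of [w]
    orthogonal to [w0]; smallness preserves the earlier inequalities. *)
Lemma generic_orthogonal w0 (l : seq 'rV[R]_m) : w0 != 0 ->
  (forall w, w \in l -> forall t, w != t *: w0) ->
  exists2 th, dotr th w0 = 0 & forall w, w \in l -> dotr th w != 0.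
Proof.
move=> w00; have N0 := dotrr_gt0 w00.
elim: l => [|w l IH] H; first by exists 0; rewrite ?dotr0l.
have [|th th0 Hth] := IH; first by move=> y yl; apply: H; rewrite inE yl orbT.
have [thw|thw] := eqVneq (dotr th w) 0; last first.
  by exists th => // y; rewrite inE => /orP[/eqP ->//|]; exact: Hth.
pose eta := w - (dotr w w0 / dotr w0 w0) *: w0.
have eta0 : dotr eta w0 = 0 by rewrite dotrBl dotrZl divfK ?gt_eqF// subrr.
have etaw : dotr eta w != 0.
  have -> : dotr eta w = dotr eta eta.
    by rewrite [in RHS]dotrBr dotrZr eta0 mulr0 subr0.
  by rewrite gt_eqF// dotrr_gt0// subr_eq0 H// inE eqxx.
have [t t0 Ht] := exists_small (dotr eta) Hth.
exists (th + t *: eta); first by rewrite dotrDl dotrZl th0 eta0 mulr0 addr0.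
move=> y; rewrite inE => /orP[/eqP ->|yl].
  by rewrite dotrDl dotrZl thw add0r mulf_neq0// gt_eqF.
rewrite dotrDl dotrZl; apply/negP => /eqP E.
have := Ht y yl; rewrite -[X in X * _]gtr0_norm// -normrM.
have -> : t * dotr eta y = - dotr th y by lra.
by rewrite normrN ltxx.
Qed.

Definition pos_part (a : R) : R := Num.max a 0.

(* The second difference at [th] in the direction [w0] isolates the coefficient of [w0]. *)
Lemma pos_part_indep (T : finType) (w : T -> 'rV[R]_m) (a : T -> R) :
  (forall i, w i != 0) -> (forall i j, i != j -> forall t, w i != t *: w j) ->
  (forall th, \sum_i a i * pos_part (dotr th (w i)) = 0) -> forall i, a i = 0.
Proof.
move=> w0 wpar H i.
have [|th th0 Hth] := @generic_orthogonal (w i) [seq w j | j <- enum T & j != i] (w0 i).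
  by move=> w1 /mapP[j]; rewrite mem_filter => /andP[ji _] -> t; exact: wpar.
have Hth' j : j \in [seq j <- enum T | j != i] -> dotr th (w j) != 0.
  by move=> jl; apply: Hth; exact: map_f.
have [t t0 Ht] := exists_small (fun j => dotr (w i) (w j)) Hth'.
have N0 := dotrr_gt0 (w0 i).
have H' y : a i * pos_part (dotr y (w i)) + \sum_(j | j != i) a j * pos_part (dotr y (w j)) = 0.
  by have := H y; rewrite (bigD1 i).
have := H' (th + t *: w i); have := H' (th - t *: w i); have := H' th.
have e1 : dotr (th + t *: w i) (w i) = t * dotr (w i) (w i).
  by rewrite dotrDl dotrZl th0 add0r.
have e2 : dotr (th - t *: w i) (w i) = - (t * dotr (w i) (w i)).
  by rewrite dotrBl dotrZl th0 sub0r.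
rewrite e1 e2 th0.
set S0 := \sum_(j | _) _; set S1 := \sum_(j | _) _; set S2 := \sum_(j | _) _.
(* For [j != i] the perturbation does not change the sign of [dotr th (w j)], so the positive part
   is affine along it. *)
have SE : S1 + S2 = S0 + S0.
  rewrite /S0 /S1 /S2 -!big_split /=; apply: eq_bigr => j ji.
  rewrite dotrBl dotrDl dotrZl -!mulrDr; congr (_ * _).
  have := Ht j; rewrite mem_filter mem_enum ji => /(_ isT).
  have := Hth' j; rewrite mem_filter mem_enum ji => /(_ isT).
  rewrite -[X in X * _]gtr0_norm// -normrM.
  set A := dotr th (w j); set B := t * dotr (w i) (w j) => A0.
  rewrite /pos_part; have [Ap|An|/eqP] := ltgtP A 0; last by rewrite (negbTE A0).
    rewrite (ltr0_norm Ap) ltr_norml => /andP[h1 h2].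
    by rewrite !max_r; lra.
  rewrite (gtr0_norm An) ltr_norml => /andP[h1 h2].
  by rewrite !max_l; lra.
have tN : 0 < t * dotr (w i) (w i) by rewrite mulr_gt0.
rewrite /pos_part maxxx mulr0 add0r (max_l (ltW tN)) max_r ?oppr_le0 ?(ltW tN)// mulr0 add0r.
move=> E0 E1 E2; have : a i * (t * dotr (w i) (w i)) = 0 by lra.
by move=> /eqP; rewrite mulf_eq0 (gt_eqF tN) orbF => /eqP.
Qed.

End generic_functionals.

(** * Support functions of zonotopes *)

Section zonotope_support.
Context {R : realType} {d : nat}.

Definition support_fun m (v : 'I_m -> 'rV[int]_d) (th : 'rV[R]_d) : R :=
  \sum_i pos_part (dotr th (intvec (v i))).

Let dotr_comb m (v : 'I_m -> 'rV[int]_d) (al : 'I_m -> R) (th : 'rV[R]_d) :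
  dotr th (\sum_i al i *: intvec (v i)) = \sum_i al i * dotr th (intvec (v i)).
Proof.
by rewrite dotrC dotr_suml; apply: eq_bigr => i _; rewrite dotrZl dotrC.
Qed.

Lemma support_fun_ub m (v : 'I_m -> 'rV[int]_d) th (x : 'rV[R]_d) :
  zonotope v x -> dotr th x <= support_fun v th.
Proof.
move=> [al Hal <-]; rewrite dotr_comb; apply: ler_sum => i _.
have /andP[a0 a1] := Hal i; rewrite /pos_part.
set A := dotr _ _; apply: (@le_trans _ _ (al i * Num.max A 0)).
  by rewrite ler_wpM2l// le_max lexx.
by rewrite ler_piMl// le_max lexx orbT.
Qed.

Lemma support_fun_attained m (v : 'I_m -> 'rV[int]_d) th :
  exists2 x : 'rV[R]_d, zonotope v x & dotr th x = support_fun v th.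
Proof.
pose al i : R := (0 < dotr th (intvec (v i)))%R%:R.
exists (\sum_i al i *: intvec (v i)).
  by exists al => // i; rewrite /al; case: (0 < _); rewrite /= ?lexx ler01.
rewrite dotr_comb; apply: eq_bigr => i _; rewrite /al /pos_part.
by case: ltP => h; rewrite ?mul1r ?mul0r ?max_l ?max_r// ltW.
Qed.

Lemma zonotope_support_eq m1 m2 (v1 : 'I_m1 -> 'rV[int]_d) (v2 : 'I_m2 -> 'rV[int]_d) :
  zonotope v1 = zonotope v2 :> set 'rV[R]_d ->
  forall th : 'rV[R]_d, support_fun v1 th = support_fun v2 th.
Proof.
move=> E th; apply/eqP; rewrite eq_le; apply/andP; split.
  by have [x Zx <-] := support_fun_attained v1 th; apply: support_fun_ub; rewrite -E.
by have [x Zx <-] := support_fun_attained v2 th; apply: support_fun_ub; rewrite E.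
Qed.

End zonotope_support.

(** * Multiplicity functions and distinct zonotopes *)

Section counting.
Context {R : realType} {n : nat}.
Variable C : set 'rV[R]_n.+1.
Hypotheses (C_closed : closed C) (C_convex : convex_set C) (C_cone : is_cone C)
  (C_pointed : contains_no_line C) (C_solid : interior C !=set0).

Local Notation LP := (lattice_prim C).

(** Pointedness excludes [t <= 0]. For [t > 0], comparing a nonzero coordinate gives equal positive
    integer multiples of [v] and [w], and [primitive_unique] applies. *)
Lemma lattice_prim_nonparallel v w : LP v -> LP w -> v != w ->
  forall t : R, intvec v != t *: intvec w.
Proof.
move=> [vp Cv] [wp Cw] vw t; apply/negP => /eqP E.
have [v0 _] := vp; have [w0 _] := wp.
have t0 : 0 < t.
  rewrite ltNge; apply/negP => t0.
  have : C (- intvec v) by rewrite E -scaleNr; apply: C_cone => //; rewrite oppr_ge0.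
  move=> /(coneN C_cone C_pointed Cv)/eqP; rewrite intvec_eq0; exact/negP.
have [i wi] : exists i, w ord0 i != 0.
  apply: contrapT => N; case/negP: w0; apply/eqP/rowP => i; rewrite mxE.
  by apply: contrapT => /eqP wi; apply: N; exists i.
have Ei j : (v ord0 j)%:~R = t * (w ord0 j)%:~R.
  by move/rowP : E => /(_ j); rewrite !mxE.
have vi : v ord0 i != 0.
  by rewrite -(intr_eq0 R) Ei mulf_eq0 negb_or gt_eqF//= intr_eq0.
have E2 j : (v ord0 j * w ord0 i = w ord0 j * v ord0 i)%R.
  by apply/eqP; rewrite -(eqr_int R) !intrM !Ei; apply/eqP; ring.
have sg : (0 < w ord0 i) = (0 < v ord0 i).
  by rewrite -(ltr_int R) -[in RHS](ltr_int R) Ei pmulr_rgt0.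
have E3 : v *+ `|w ord0 i|%N = w *+ `|v ord0 i|%N.
  apply/rowP => j; rewrite !mulmxnE -[LHS]mulr_natr -[RHS]mulr_natr !natz !abszE.
  have [wp'|wn] := ltP 0 (w ord0 i).
    by rewrite !gtr0_norm -?sg// E2.
  have vn : v ord0 i <= 0 by rewrite leNgt -sg -leNgt.
  by rewrite !ler0_norm// !mulrN E2.
have [] := @primitive_unique _ v w `|w ord0 i|.-1 `|v ord0 i|.-1 vp wp.
  by rewrite !prednK ?absz_gt0.
by move=> vwE _; rewrite vwE eqxx in vw.
Qed.

Lemma finite_bounded_lattice (N : nat) :
  finite_set [set v : 'rV[int]_n.+1 | forall i, (`|v ord0 i| <= N)%N].
Proof.
pose f (g : {ffun 'I_n.+1 -> 'I_(2 * N).+1}) : 'rV[int]_n.+1 := \row_i ((g i)%:Z - N%:Z).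
apply: (@sub_finite_set _ _ (f @` [set: {ffun 'I_n.+1 -> 'I_(2 * N).+1}])); last first.
  by apply: finite_image; exact: finite_finset.
move=> v /= vN; exists [ffun i => inord `|(v ord0 i + N%:Z)%R|%N] => //.
apply/rowP => i; rewrite [LHS]mxE ffunE; have := vN i.
rewrite -[v 0 i]/(v ord0 i); move: (v ord0 i) => z zN.
by rewrite inordK; lia.
Qed.

Lemma finite_lattice_cap u (B : R) : strict_dual C u ->
  finite_set [set v : 'rV[int]_n.+1 | C (intvec v) /\ dotr u (intvec v) <= B].
Proof.
move=> uC; have [k k0 Hk] := strict_dual_coercive C_closed C_cone uC.
apply: (sub_finite_set _ (finite_bounded_lattice (Num.truncn (B / k)).+1)).
move=> v [Cv vB] i.
have h : `|intvec v : 'rV[R]_n.+1| <= B / k.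
  by rewrite ler_pdivlMr// mulrC (le_trans (Hk _ Cv)).
have := le_trans (coord_le_norm _ i) h; rewrite mxE -intr_norm -abszE => h2.
have := le_lt_trans h2 (truncnS_gt _).
by rewrite pmulrn ltr_nat => /ltnW.
Qed.

Section fixed_family.
Variable F : {fset 'rV[int]_n.+1}.
Hypothesis FP : forall w, w \in F -> LP w.

(** The endpoint of the zonotope with [c w] copies of each [w]. Truncating multiplicities at [M]
    keeps all sums finite. *)
Definition comb M (c : {ffun F -> 'I_M}) : 'rV[int]_n.+1 := \sum_(w : F) val w *+ c w.

Lemma comb_dotr u M (c : {ffun F -> 'I_M}) :
  dotr u (intvec (comb c)) = \sum_(w : F) (c w)%:R * dotr u (intvec (val w)) :> R.
Proof.
rewrite /comb intvec_sum dotrC dotr_suml; apply: eq_bigr => w _.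
by rewrite intvecMn dotrZl dotrC.
Qed.

Lemma sum_expR_comb u (t : R) M :
  \sum_(c : {ffun F -> 'I_M.+1}) expR (- (t * dotr u (intvec (comb c)))) =
  \prod_(w : F) \sum_(j < M.+1) expR (- (t * dotr u (intvec (val w)))) ^+ j.
Proof.
rewrite bigA_distr_bigA /=; apply: eq_bigr => c _.
rewrite comb_dotr mulr_sumr -sumrN expR_sum; apply: eq_bigr => w _.
by rewrite -expRM_natl; congr expR; ring.
Qed.

(** All these multiplicity functions are completed by the same vector [k - x]. Its term cancels
    between two support functions, even if it is zero or parallel to some [w], and [pos_part_indep]
    recovers the multiplicities. *)
Lemma card_comb_le_p (M : nat) (x k : 'rV[int]_n.+1) :
  finite_set (zonotopes C k) -> C (intvec (k - x)) ->
  (#|[set c : {ffun F -> 'I_M.+1} | comb c == x]%SET| <= p C k)%N.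
Proof.
move=> finZ Ckx.
pose v (c : {ffun F -> 'I_M.+1}) (i : 'I_#|{: F}|.+1) : 'rV[int]_n.+1 :=
  if unlift ord0 i is Some j then val (enum_val j) *+ c (enum_val j) else k - x.
have vsum (V : nmodType) (f : 'rV[int]_n.+1 -> V) c :
    \sum_i f (v c i) = f (k - x) + \sum_(w : F) f (val w *+ c w).
  rewrite big_ord_recl /v unlift_none; congr (_ + _).
  rewrite [RHS](reindex (enum_val (A := {: F}))) /=; last exact: onW_bij (enum_val_bij _).
  by apply: eq_bigr => i _; rewrite liftK.
pose Z c : set 'rV[R]_n.+1 := zonotope (v c).
have Zinj : injective Z.
  move=> c1 c2 /zonotope_support_eq E.
  have a0 := @pos_part_indep R n.+1 {: F} (fun w => intvec (val w))
    (fun w => (c1 w)%:R - (c2 w)%:R).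
  apply/ffunP => w; apply: val_inj; apply/eqP; rewrite -(eqr_nat R) -subr_eq0; apply/eqP.
  apply: a0 => [w'|w1 w2 w12 t|th].
  - by rewrite intvec_eq0; have [[]] := FP (valP w').
  - by apply: lattice_prim_nonparallel; rewrite ?(inj_eq val_inj)//; apply: FP; exact: valP.
  - have := E th; rewrite /support_fun.
    have SE c : \sum_i pos_part (dotr th (intvec (v c i))) =
        pos_part (dotr th (intvec (k - x))) +
        \sum_(w : F) (c w)%:R * pos_part (dotr th (intvec (val w))).
      rewrite (vsum _ (fun y => pos_part (dotr th (intvec y)))); congr (_ + _).
      apply: eq_bigr => w' _; rewrite intvecMn dotrZr /pos_part.
      by rewrite maxr_pMr// mulr0.
    rewrite !SE => /addrI E2.
    under eq_bigr do rewrite mulrBl.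
    by rewrite sumrB E2 subrr.
have sub : {subset [seq Z c | c <- enum [set c : {ffun F -> 'I_M.+1} | comb c == x]%SET]
    <= fset_set (zonotopes C k)}.
  move=> y /mapP[c]; rewrite mem_enum inE => /eqP cx ->.
  rewrite in_fset_set// inE; exists #|{: F}|.+1, (v c); split=> //.
    move=> i; rewrite /v; case: unlift => [j|//].
    rewrite intvecMn; apply: C_cone => //.
    by have [] := FP (valP (enum_val j)).
  by rewrite (vsum _ id) -/(comb c) cx subrK.
rewrite /p cardE -(size_map Z); apply: uniq_leq_size => //.
by rewrite map_inj_uniq ?enum_uniq.
Qed.

End fixed_family.
End counting.

(** * Comparing the count with the generating function *)

Section counting_bounds.
Context {R : realType} {n : nat}.
Variable C : set 'rV[R]_n.+1.
Hypotheses (C_closed : closed C) (C_convex : convex_set C) (C_cone : is_cone C)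
  (C_pointed : contains_no_line C) (C_solid : interior C !=set0).
Variable u : 'rV[R]_n.+1.
Hypothesis uC : strict_dual C u.

Local Notation LP := (lattice_prim C).
Local Notation du v := (dotr u (intvec v)).

Definition comb_zonotope (F : {fset 'rV[int]_n.+1}) M (c : {ffun F -> 'I_M}) :
    set 'rV[R]_n.+1 :=
  [set \sum_(w : F) (b w * (c w)%:R) *: intvec (val w) |
    b in [set b : F -> R | forall w, 0 <= b w <= 1]].

(** Segments in the same direction [w] add up to one segment, so only the total multiplicity [c w]
    matters. Nonnegative heights summing to [du k] confine the directions to [F] and the
    multiplicities below [M.+1]. *)
Lemma zonotope_comb (F : {fset 'rV[int]_n.+1}) (M : nat) (k : 'rV[int]_n.+1)
    (T : set 'rV[R]_n.+1) :
  (forall w, w \in F -> LP w) -> (forall w, LP w -> du w <= du k -> w \in F) ->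
  (forall w, w \in F -> du k < M.+1%:R * du w) -> zonotopes C k T ->
  exists2 c : {ffun F -> 'I_M.+1}, comb c = k & T = comb_zonotope c.
Proof.
move=> FP PF FM [N [v [Cv -> vk]]].
(* A zero generator is coded by [(0, 0)]; as 0 is not primitive it lies outside [F] and drops out of
   the regrouping. *)
have dec i : exists wj : 'rV[int]_n.+1 * nat, v i = wj.1 *+ wj.2 /\
    (v i != 0 -> primitive wj.1 /\ (0 < wj.2)%N) /\ (v i = 0 -> wj = (0, 0%N)).
  have [v0|v0] := eqVneq (v i) 0; first by exists (0, 0%N); rewrite v0 mul0rn.
  have [j [w [wp vE]]] := primitive_decomp v0.
  by exists (w, j.+1); split=> //; split=> // v0'; rewrite v0' eqxx in v0.
have [f fP] := choice dec.
pose wf i := (f i).1; pose jf i := (f i).2.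
have vE i : v i = wf i *+ jf i by have [] := fP i.
have duv i : 0 <= du (v i) by exact: strict_dual_ge0 uC (Cv i).
have wfF i : v i != 0 -> wf i \in F.
  move=> v0; have [_ [/(_ v0)[wp j0] _]] := fP i.
  have Cw : C (intvec (wf i)).
    have := C_cone (t := (jf i)%:R^-1) _ (Cv i); rewrite vE intvecMn scalerA mulVf.
      by rewrite scale1r; apply; rewrite invr_ge0.
    by rewrite pnatr_eq0 -lt0n.
  apply: PF; first by split.
  apply: (@le_trans _ _ (du (v i))).
    rewrite vE intvecMn dotrZr ler_peMl ?ler1n//; exact: strict_dual_ge0 uC Cw.
  rewrite -vk intvec_sum [leRHS]dotrC dotr_suml (bigD1 i)//= dotrC lerDl.
  by apply: sumr_ge0 => j _; rewrite dotrC.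
have wf0 i : v i = 0 -> wf i \notin F.
  move=> v0; have [_ [_ /(_ v0) fi]] := fP i; apply/negP => /FP[[]].
  by rewrite /wf fi eqxx.
pose c (w : F) : nat := \sum_(i | wf i == val w) jf i.
have pick_sum (V : nmodType) (g : 'I_N -> V) : (forall i, v i = 0 -> g i = 0) ->
    \sum_i g i = \sum_(w : F) \sum_(i | wf i == val w) g i.
  move=> g0; rewrite [RHS](exchange_big_dep xpredT)//=; apply: eq_bigr => i _.
  have [v0|v0] := eqVneq (v i) 0; first by rewrite g0// big1// => w _.
  by rewrite (big_pred1 [` wfF i v0]%fset)// => w; rewrite -val_eqE /= eq_sym.
have ck : \sum_(w : F) val w *+ c w = k.
  rewrite -vk pick_sum//; apply: eq_bigr => w _.
  rewrite /c -sumrMnr; apply: eq_bigr => i /eqP wi.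
  by rewrite vE wi.
have cM (w : F) : (c w < M.+1)%N.
  have := FM _ (valP w); rewrite -(ltr_nat R) => h.
  have dw : 0 < du (val w).
    have [[w0 _] Cw] := FP _ (valP w); apply: uC => //.
    by rewrite intvec_eq0.
  rewrite -(ltr_pM2r dw); apply: le_lt_trans h.
  rewrite -ck intvec_sum [leRHS]dotrC dotr_suml (bigD1 w)//= intvecMn dotrZl dotrC lerDl.
  apply: sumr_ge0 => w' _; rewrite intvecMn dotrZl mulr_ge0// dotrC.
  have [_ Cw'] := FP _ (valP w'); exact: strict_dual_ge0 uC Cw'.
exists [ffun w => inord (c w)].
  by rewrite -ck; apply: eq_bigr => w _; rewrite ffunE inordK.
apply/seteqP; split=> x.
- move=> [al Hal <-].
  pose s (w : F) : R := \sum_(i | wf i == val w) al i * (jf i)%:R.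
  have s0 w : 0 <= s w by apply: sumr_ge0 => i _; rewrite mulr_ge0//; have /andP[] := Hal i.
  have sc w : s w <= (c w)%:R.
    rewrite /s /c natr_sum; apply: ler_sum => i _.
    by rewrite ler_piMl//; have /andP[] := Hal i.
  (* If [c w = 0] the quotient is 0, consistently with [s w = 0]. *)
  exists (fun w => s w / (c w)%:R) => [w|].
    have [c0|c0] := eqVneq (c w) 0%N; first by rewrite c0 invr0 mulr0 lexx ler01.
    have cp : 0 < (c w)%:R :> R by rewrite ltr0n lt0n.
    by rewrite divr_ge0//= ler_pdivrMr// mul1r.
  rewrite pick_sum => [|i v0]; last by rewrite v0 intvec0 scaler0.
  apply: eq_bigr => w _; rewrite ffunE inordK//.
  have -> : s w / (c w)%:R * (c w)%:R = s w.
    have [c0|c0] := eqVneq (c w) 0%N; last by rewrite divfK// pnatr_eq0.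
    by rewrite c0 mulr0; apply/eqP; rewrite eq_le s0 -[X in _ <= X](_ : (c w)%:R = 0) ?sc// c0.
  rewrite /s scaler_suml; apply: eq_bigr => i /eqP wi.
  by rewrite vE intvecMn scalerA wi.
- move=> [b Hb <-].
  (* All generators along [w] receive the same coefficient [b w]. *)
  exists (fun i => if insub (wf i) is Some w then b w else 0) => [i|].
    by case: insub => [w|]; [exact: Hb|rewrite lexx ler01].
  rewrite pick_sum => [|i v0]; last by rewrite v0 intvec0 scaler0.
  apply: eq_bigr => w _; rewrite ffunE inordK// /c natr_sum mulr_sumr scaler_suml.
  apply: eq_bigr => i /eqP wi.
  by rewrite vE intvecMn scalerA wi valK.
Qed.

(** A finite range of directions and multiplicities that accounts for every zonotope with endpoint
    [k]: heights are at most [du k], and at least the gap [g] for nonzero vectors. *)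
Let cap_family (k : 'rV[int]_n.+1) : exists F : {fset 'rV[int]_n.+1}, exists M : nat,
  [/\ forall w, w \in F -> LP w, forall w, LP w -> du w <= du k -> w \in F &
      forall w, w \in F -> du k < M.+1%:R * du w].
Proof.
have fin : finite_set [set w | LP w /\ du w <= du k].
  apply: sub_finite_set (finite_lattice_cap C_closed C_cone (du k) uC).
  by move=> w [[_ Cw] h].
have [g g0 Hg] := lattice1_gap C_closed C_cone uC.
exists (fset_set [set w | LP w /\ du w <= du k]), (Num.truncn (du k / g)); split.
- by move=> w; rewrite in_fset_set// inE => -[].
- by move=> w Pw h; rewrite in_fset_set// inE.
- move=> w; rewrite in_fset_set// inE => -[[[w0 _] Cw] _].
  have gw : g <= du w by apply: Hg; split.
  apply: (@lt_le_trans _ _ ((Num.truncn (du k / g)).+1%:R * g)).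
    by rewrite -ltr_pdivrMr// truncnS_gt.
  by rewrite ler_pM2l.
Qed.

Lemma zonotopes_finite k : finite_set (zonotopes C k).
Proof.
have [F [M [FP PF FM]]] := cap_family k.
apply: (@sub_finite_set _ _ ((@comb_zonotope F M.+1) @` [set: {ffun F -> 'I_M.+1}])).
  by move=> T /(zonotope_comb FP PF FM)[c _ ->]; exists c.
by apply: finite_image; exact: finite_finset.
Qed.

Let geometric_le (x : R) M : 0 <= x -> x < 1 -> \sum_(j < M.+1) x ^+ j <= (1 - x)^-1.
Proof.
move=> x0 x1; have x10 : 0 < 1 - x by rewrite subr_gt0.
rewrite -[leRHS]mul1r ler_pdivlMr// mulrC.
have := subrX1 x M.+1; have := exprn_ge0 M.+1 x0.
move: (\sum_(i < M.+1) x ^+ i) (x ^+ M.+1) => S Y Y0 E.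
have -> : (1 - x) * S = 1 - Y by rewrite -[1 - x]opprB mulNr -E opprB.
by rewrite gerBl.
Qed.

Let du_gt0 w : LP w -> 0 < du w.
Proof. by move=> [[w0 _] Cw]; apply: uC => //; rewrite intvec_eq0. Qed.

Let expR_log_factor (y : R) : 0 < y -> expR (log_factor y) = (1 - expR (- y))^-1.
Proof.
move=> y0; rewrite /log_factor expRN lnK// posrE subr_gt0.
by rewrite -[X in _ < X]expR0 ltr_expR oppr_lt0.
Qed.

Let family_sum_le (t : R) (F : {fset 'rV[int]_n.+1}) : 0 < t -> (forall w, w \in F -> LP w) ->
  \sum_(w : F) log_factor (t * du (val w)) <= prim_log_sum C u t.
Proof.
move=> t0 FP.
have [B _ HB] := prim_log_sumE C_closed C_convex C_cone C_solid uC.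
have [E _ _ _] := HB t t0.
rewrite -lee_fin -E; apply: esum_ge; exists [set` F].
  by split; [exact: finite_fset|move=> w /= /FP].
rewrite fsbig_finite//= set_fsetK sumEFin lee_fin.
by rewrite (big_seq_fsetE _ _ xpredT (fun w => log_factor (t * du w))).
Qed.

Lemma sum_comb_le (t : R) (F : {fset 'rV[int]_n.+1}) M : 0 < t ->
  (forall w, w \in F -> LP w) ->
  \sum_(c : {ffun F -> 'I_M.+1}) expR (- (t * du (comb c))) <= expR (prim_log_sum C u t).
Proof.
move=> t0 FP; rewrite sum_expR_comb.
apply: (@le_trans _ _ (expR (\sum_(w : F) log_factor (t * du (val w))))); last first.
  by rewrite ler_expR; exact: family_sum_le.
rewrite expR_sum; apply: ler_prod => w _.
have y0 : 0 < t * du (val w) by apply: mulr_gt0 => //; apply: du_gt0; apply: FP; exact: valP.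
rewrite sumr_ge0 => [|j _]; last by rewrite exprn_ge0// expR_ge0.
rewrite expR_log_factor//; apply: geometric_le; first exact: expR_ge0.
by rewrite -[X in _ < X]expR0 ltr_expR oppr_lt0.
Qed.

(** A finite subfamily loses less than [ln 2] in the exponent; at fixed family the truncated
    geometric sums converge to the full factors, so the strict inequality survives for some finite
    [M]. *)
Lemma sum_comb_ge (t : R) : 0 < t -> exists F : {fset 'rV[int]_n.+1}, exists M : nat,
  (forall w, w \in F -> LP w) /\ expR (prim_log_sum C u t) / 2 <=
    \sum_(c : {ffun F -> 'I_M.+1}) expR (- (t * du (comb c))).
Proof.
move=> t0.
have [B _ HB] := prim_log_sumE C_closed C_convex C_cone C_solid uC.
have [E _ _ _] := HB t t0.
have : ((prim_log_sum C u t - ln 2)%:E < \esum_(v in LP) (log_factor (t * du v))%:E)%E.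
  by rewrite E lte_fin gtrBl ln_gt0// ltr1n.
move=> /ereal_sup_gt[_ [X [fX XP] <-]]; rewrite fsbig_finite//= sumEFin lte_fin => h.
exists (fset_set X).
have FP w : w \in fset_set X -> LP w by rewrite in_fset_set// inE => /XP.
have hc : (fun M => \sum_(c : {ffun fset_set X -> 'I_M.+1}) expR (- (t * du (comb c)))) @ \oo
    --> expR (\sum_(w : fset_set X) log_factor (t * du (val w))).
  under eq_cvg do rewrite sum_expR_comb.
  rewrite expR_sum; apply: (cvg_big (@mul_continuous R^o)) => w _.
  have y0 : 0 < t * du (val w) by apply: mulr_gt0 => //; apply: du_gt0; apply: FP; exact: valP.
  have x1 : expR (- (t * du (val w))) < 1 by rewrite -[X in _ < X]expR0 ltr_expR oppr_lt0.
  rewrite expR_log_factor// -[X in _ --> X]mul1r.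
  have := @cvg_geometric_series R 1 (expR (- (t * du (val w)))).
  rewrite ger0_norm ?expR_ge0// => /(_ x1).
  rewrite -cvg_shiftS => H.
  rewrite (_ : (fun M : nat => _) =
    (fun M => series (geometric 1 (expR (- (t * du (val w))))) M.+1))//.
  apply/funext => M; rewrite /series /= big_mkord.
  by apply: eq_bigr => j _; rewrite mul1r.
have lt2 : expR (prim_log_sum C u t) / 2 < expR (\sum_(w : fset_set X) log_factor (t * du (val w))).
  rewrite -[X in _ / X](@lnK _ 2) ?posrE// -expRN -expRD ltr_expR.
  by rewrite -(big_seq_fsetE _ _ xpredT (fun w => log_factor (t * du w))).
have [M0 _ HM] := cvgr_ge _ hc _ lt2.
exists M0; split=> //; exact: (HM M0 (leqnn M0)).
Qed.

(** Rankin's bound: in the generating sum keep only the multiplicity functions with endpoint [k]. *)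
Theorem p_upper (t : R) k : 0 < t ->
  (p C k)%:R <= expR (t * du k + prim_log_sum C u t).
Proof.
move=> t0; have [F [M [FP PF FM]]] := cap_family k.
have fin := zonotopes_finite k.
have le1 : (p C k <= #|[set c : {ffun F -> 'I_M.+1} | comb c == k]%SET|)%N.
  rewrite /p cardE -(size_map (@comb_zonotope F M.+1)).
  apply: uniq_leq_size; first exact: fset_uniq.
  move=> T; rewrite in_fset_set// inE => /(zonotope_comb FP PF FM)[c ck ->].
  by apply: map_f; rewrite mem_enum inE ck.
apply: (@le_trans _ _ (#|[set c : {ffun F -> 'I_M.+1} | comb c == k]%SET|)%:R).
  by rewrite ler_nat.
rewrite expRD mulrC -ler_pdivrMr ?expR_gt0// -expRN.
apply: le_trans (sum_comb_le M t0 FP).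
rewrite [leRHS](bigID (fun c => comb c == k)) /=.
apply: (@le_trans _ _ (\sum_(c : {ffun F -> 'I_M.+1} | comb c == k) expR (- (t * du k)))).
  rewrite sumr_const -[X in X * _]/(_ %:R) mulr_natl.
  by rewrite cardsE.
apply: ler_wpDr; first by apply: sumr_ge0 => c _; exact: expR_ge0.
by apply: ler_sum => c /eqP ->.
Qed.

(** Group by endpoint: a box holds at most [(2 N + 1) ^ n.+1] of them, and [card_comb_le_p] bounds
    each group. The map [h] codes endpoints in a finite type. *)
Lemma card_box_le (F : {fset 'rV[int]_n.+1}) (M N : nat) (k : 'rV[int]_n.+1)
    (P : pred 'rV[int]_n.+1) : (forall w, w \in F -> LP w) ->
  (forall x, P x -> C (intvec (k - x)) /\ forall i, (`|x ord0 i| <= N)%N) ->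
  (#|[set c : {ffun F -> 'I_M.+1} | P (comb c)]%SET| <= (2 * N).+1 ^ n.+1 * p C k)%N.
Proof.
move=> FP PC.
pose h (c : {ffun F -> 'I_M.+1}) : {ffun 'I_n.+1 -> 'I_(2 * N).+1} :=
  [ffun i => inord `|(comb c ord0 i + N%:Z)%R|%N].
pose x (g : {ffun 'I_n.+1 -> 'I_(2 * N).+1}) : 'rV[int]_n.+1 := \row_i ((g i)%:Z - N%:Z).
have hx c : P (comb c) -> x (h c) = comb c.
  move=> /PC[_ cN]; apply/rowP => i; rewrite [LHS]mxE ffunE; have := cN i.
  rewrite -[comb c 0 i]/(comb c ord0 i); move: (comb c ord0 i) => z zN.
  by rewrite inordK; lia.
rewrite -sum1dep_card (partition_big h xpredT)//=.
have -> : ((2 * N).+1 ^ n.+1 * p C k = \sum_(g : {ffun 'I_n.+1 -> 'I_(2 * N).+1}) p C k)%N.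
  by rewrite sum_nat_const card_ffun !card_ord.
apply: leq_sum => g _.
have [/existsP[c0 /andP[Pc0 /eqP hc0]]|/existsPn nc] :=
    boolP [exists c : {ffun F -> 'I_M.+1}, P (comb c) && (h c == g)]; last first.
  by rewrite big1// => c Pc; have := nc c; rewrite Pc.
have [Ck _] := PC _ Pc0.
apply: leq_trans (card_comb_le_p C_cone C_pointed FP M (zonotopes_finite k) Ck).
rewrite sum1dep_card; apply: subset_leq_card; apply/fintype.subsetP => c; rewrite !inE.
by move=> /andP[Pc /eqP hc]; rewrite -(hx _ Pc) -(hx _ Pc0) hc hc0.
Qed.

End counting_bounds.

(** * Asymptotics *)

Section asymptotics.
Context {R : realType} {n : nat}.
Hypothesis n1 : (1 <= n)%N.
Variable C : set 'rV[R]_n.+1.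
Hypotheses (C_closed : closed C) (C_convex : convex_set C) (C_cone : is_cone C)
  (C_pointed : contains_no_line C) (C_solid : interior C !=set0).

Local Notation lap := (laplace C).
Local Notation pls := (prim_log_sum C).

(** The natural scale: at [t = s / r N], both [t * N] and [pls v t] are of order [r N ^+ n.+1]. *)
Definition root_seq (N : nat) : R := N%:R `^ n.+2%:R^-1.
Local Notation r := root_seq.

Lemma root_seq_ge0 N : 0 <= r N.
Proof. exact: powR_ge0. Qed.

Lemma root_seq_pow N : r N ^+ n.+2 = N%:R.
Proof.
by rewrite -powR_mulrn ?powR_ge0// -powRrM mulVf ?pnatr_eq0// powRr1.
Qed.

Lemma root_seq_powR N : N%:R `^ (- (n.+1%:R / n.+2%:R)) = (r N ^+ n.+1)^-1.
Proof. by rewrite powRN -powR_mulrn ?powR_ge0// -powRrM mulrC. Qed.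

Lemma root_seq_ge (X : R) : \forall N \near \oo, X <= r N.
Proof.
have [X0|X0] := leP X 0; first by apply: nearW => N; exact: le_trans (root_seq_ge0 N).
near=> N; rewrite leNgt; apply/negP => rX.
have : N%:R < X ^+ n.+2.
  by rewrite -root_seq_pow ltrXn2r ?nnegrE ?root_seq_ge0// ltW.
apply/negP; rewrite -leNgt; near: N; exact: nbhs_infty_ger.
Unshelve. all: by end_near.
Qed.

(** The limit of [t ^+ n.+1 * pls v t] as [t] decreases to 0. *)
Definition log_density (v : 'rV[R]_n.+1) : R :=
  zeta (n.+2%:R : R) * lap v / zeta (n.+1%:R : R).

Lemma cvg_prim_log_root v (s : R) : 0 < s -> strict_dual C v ->
  (pls v (s / r N) / r N ^+ n.+1) @[N --> \oo] --> log_density v / s ^+ n.+1.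
Proof.
move=> s0 vC.
have /cvg_right0P H := cvg_prim_log_sum C_closed C_convex C_cone C_solid vC n1.
apply/cvgrPdist_le => e e0.
have sn0 : 0 < s ^+ n.+1 by rewrite exprn_gt0.
have [t0 t00 Ht] := H (e * s ^+ n.+1) (mulr_gt0 e0 sn0).
near=> N.
have rN : 2 * s / t0 <= r N by near: N; exact: root_seq_ge.
have r0 : 0 < r N by apply: lt_le_trans rN; rewrite divr_gt0// mulr_gt0.
have rn0 : 0 < r N ^+ n.+1 by rewrite exprn_gt0.
have := Ht (s / r N) (divr_gt0 s0 r0).
rewrite ltr_pdivrMr// mulrC -ltr_pdivrMr//.
have -> : s / t0 < r N.
  apply: lt_le_trans rN; rewrite ltr_pM2r ?invr_gt0//; lra.
move=> /(_ isT).
have -> : pls v (s / r N) / r N ^+ n.+1 =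
    ((s / r N) ^+ n.+1 * pls v (s / r N)) / s ^+ n.+1.
  rewrite expr_div_n; field; by rewrite !gt_eqF.
rewrite -mulrBl normrM (gtr0_norm (x := (s ^+ n.+1)^-1)) ?invr_gt0// ler_pdivrMr// distrC.
by rewrite /log_density.
Unshelve. all: by end_near.
Qed.

(** * Asymptotics for the multiples of a fixed endpoint *)

Section endpoint.
Variable k : 'rV[int]_n.+1.
Hypothesis hk : interior C (intvec k).

Local Notation a := (intvec k : 'rV[R]_n.+1).
Local Notation u := (gigena C a).

Let uC : strict_dual C u.
Proof. by have [] := gigenaP C_closed C_convex C_cone C_pointed C_solid hk. Qed.

Let uD i : laplace_moment C u (delta_mx 0 i) = n.+1%:R * lap u * a ord0 i.
Proof. by have [] := gigenaP C_closed C_convex C_cone C_pointed C_solid hk. Qed.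

Let ua : dotr u a = 1.
Proof. exact: dotr_gigena. Qed.

Lemma log_density_gt0 v : strict_dual C v -> 0 < log_density v.
Proof.
move=> vC; rewrite divr_gt0 ?mulr_gt0 ?(laplace_gt0 C_closed C_cone C_solid vC)//.
  by rewrite (lt_le_trans ltr01)// zeta_ge1.
by rewrite (lt_le_trans ltr01)// zeta_ge1.
Qed.

(** The minimiser of [s + log_density u / s ^+ n.+1] over [s > 0]. *)
Definition scale_const : R := (n.+1%:R * log_density u) `^ n.+2%:R^-1.
Local Notation s0 := scale_const.

Lemma scale_const_gt0 : 0 < s0.
Proof. by rewrite powR_gt0// mulr_gt0// log_density_gt0. Qed.

Lemma scale_const_pow : s0 ^+ n.+2 = n.+1%:R * log_density u.
Proof.
rewrite -powR_mulrn ?powR_ge0// -powRrM mulVf ?pnatr_eq0// powRr1//.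
by rewrite mulr_ge0// ltW// log_density_gt0.
Qed.

(** The right-hand side is the minimum value, since at the minimiser the second term is [s0 / n.+1].
    Both sides are nonnegative and are compared through their [(n + 2)]-th powers. *)
Lemma limit_constE : c_ R n.+1 * q C a = s0 * (n.+2%:R / n.+1%:R).
Proof.
have [q0 qE] := q_power C_closed C_convex C_cone C_pointed C_solid hk.
have z0 : 0 < zeta (n.+2%:R : R) / zeta (n.+1%:R : R).
  by rewrite divr_gt0// (lt_le_trans ltr01)// zeta_ge1.
have lhs0 : 0 <= c_ R n.+1 * q C a by rewrite mulr_ge0// powR_ge0.
have rhs0 : 0 <= s0 * (n.+2%:R / n.+1%:R) by rewrite mulr_ge0 ?divr_ge0// ltW// scale_const_gt0.
apply/eqP; rewrite -(eqrXn2 (n := n.+2))//; apply/eqP.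
rewrite [LHS]exprMn qE [RHS]exprMn scale_const_pow (exprS (n.+2%:R / n.+1%:R) n.+1) /log_density.
rewrite /c_ -powR_mulrn ?powR_ge0// -powRrM mulVf ?pnatr_eq0// powRr1; last first.
  by rewrite mulr_ge0 ?ler0n// ltW.
rewrite (factS n.+1) natrM.
move: ((n.+2%:R / n.+1%:R) ^+ n.+1) => Y.
have f0 : (n.+1)`!%:R != 0 :> R by rewrite pnatr_eq0 -lt0n fact_gt0.
have zz : zeta (n.+1%:R : R) != 0.
  by rewrite gt_eqF// (lt_le_trans ltr01)// zeta_ge1.
move: f0 zz; move: (n.+1)`!%:R (zeta n.+1%:R) => f z f0 zz.
field; by rewrite nat1r pnatr_eq0 f0 zz.
Qed.

Local Notation term N := (N%:R `^ (- (n.+1%:R / n.+2%:R)) * ln (p C (k *+ N))%:R).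

Lemma log_p_upper_bound (e : R) : 0 < e ->
  \forall N \near \oo, term N <= s0 * (n.+2%:R / n.+1%:R) + e.
Proof.
move=> e0.
have s00 := scale_const_gt0.
have H := cvg_prim_log_root s00 uC.
have E : log_density u / s0 ^+ n.+1 = s0 / n.+1%:R.
  have := scale_const_pow; rewrite exprS => E1.
  have -> : log_density u = s0 * s0 ^+ n.+1 / n.+1%:R.
    by rewrite E1 mulrC mulrA mulVf ?mul1r// pnatr_eq0.
  by rewrite mulrAC mulfK// expf_neq0// gt_eqF.
rewrite E in H.
have {}H : \forall N \near \oo, pls u (s0 / r N) / r N ^+ n.+1 <= s0 / n.+1%:R + e.
  by apply: (cvgr_le _ H); rewrite ltrDl.
near=> N.
have r1 : 1 <= r N by near: N; exact: root_seq_ge.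
have r0 : 0 < r N by exact: lt_le_trans r1.
have rn0 : 0 < r N ^+ n.+1 by rewrite exprn_gt0.
have HN : pls u (s0 / r N) / r N ^+ n.+1 <= s0 / n.+1%:R + e by near: N.
rewrite root_seq_powR.
(* For a zero count [ln 0] is 0 and the bound is nonnegative. *)
have [/eqP p0|p0] := posnP (p C (k *+ N)).
  rewrite (eqP p0) ln0// mulr0 addr_ge0 ?(ltW e0)// mulr_ge0 ?divr_ge0//; exact: ltW.
have := p_upper C_closed C_convex C_cone C_solid uC (k *+ N) (divr_gt0 s00 r0).
move=> pE.
have lnp : ln (p C (k *+ N))%:R <= s0 / r N * N%:R + pls u (s0 / r N).
  rewrite -[leRHS]expRK ler_ln ?posrE ?ltr0n ?expR_gt0//.
  by move: pE; rewrite intvecMn dotrZr ua mulr1.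
rewrite mulrC ler_pdivrMr// (le_trans lnp)//.
have -> : s0 * (n.+2%:R / n.+1%:R) + e = s0 + (s0 / n.+1%:R + e).
  have -> : n.+2%:R = n.+1%:R + 1 :> R by rewrite natr1.
  by field; rewrite nat1r pnatr_eq0.
rewrite mulrDl lerD//; last by rewrite -ler_pdivrMr.
rewrite -(root_seq_pow N) [r N ^+ n.+2]exprS.
by rewrite mulrA divfK// gt_eqF.
Unshelve. all: by end_near.
Qed.

(** The outward normals of the faces of a coordinate box. *)
Definition signed_delta (i : 'I_n.+1) (b : bool) : 'rV[R]_n.+1 := (-1) ^+ b *: delta_mx 0 i.

Lemma dotr_signed_delta i b x : dotr (signed_delta i b) x = (-1) ^+ b * x ord0 i.
Proof. by rewrite dotrZl dotr_delta. Qed.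

(* Exponential Chebyshev: under the Gibbs weights, a combination lands outside the box with
   small probability because tilting [u] by a small multiple of any [signed_delta i b] barely
   changes the partition function. *)
Lemma partition_function_le (t W lb : R) (X : 'rV[R]_n.+1) (N' : nat) (k' : 'rV[int]_n.+1) :
  0 < t ->
  (forall x : 'rV[int]_n.+1, (forall i, `|(x ord0 i)%:~R - X ord0 i| <= W) ->
    [/\ C (intvec (k' - x)), forall i, (`|x ord0 i| <= N')%N & lb <= dotr u (intvec x)]) ->
  (forall i b, exists2 h, 0 < h & strict_dual C (u - h *: signed_delta i b) /\
    pls (u - h *: signed_delta i b) t - t * h * (dotr (signed_delta i b) X + W) <=
    pls u t - ln (8 * n.+1%:R)) ->
  expR (pls u t) <= 4 * ((2 * N').+1 ^ n.+1)%:R * (p C k')%:R * expR (- (t * lb)).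
Proof.
move=> t0 boxP tilt.
have [F [M [FP Zge]]] := sum_comb_ge C_closed C_convex C_cone C_solid uC t0.
pose inbox (x : 'rV[int]_n.+1) := [forall i, `|(x ord0 i)%:~R - X ord0 i| <= W].
pose wt (c : {ffun F -> 'I_M.+1}) := expR (- (t * dotr u (intvec (comb c)))).
have wt0 c : 0 <= wt c by exact: expR_ge0.
pose viol (ib : 'I_n.+1 * bool) (c : {ffun F -> 'I_M.+1}) :=
  dotr (signed_delta ib.1 ib.2) X + W < dotr (signed_delta ib.1 ib.2) (intvec (comb c)).
(* There are [2 (n + 1)] faces, each violated with weight at most [1 / (8 (n + 1))] of the partition
   function. Since the truncated sum keeps at least one half of it, one quarter remains inside the
   box. *)
have out : \sum_(c | ~~ inbox (comb c)) wt c <= expR (pls u t) / 4.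
  apply: (@le_trans _ _ (\sum_(ib : 'I_n.+1 * bool) \sum_(c | viol ib c) wt c)).
    rewrite [leRHS](exchange_big_dep xpredT)//= [leRHS](bigID (fun c => inbox (comb c))) /=.
    apply: ler_wpDl; first by apply: sumr_ge0 => c _; exact: sumr_ge0.
    apply: ler_sum => c; rewrite negb_forall => /existsP[i]; rewrite -ltNge lter_normr.
    have mem ib : viol ib c -> wt c <= \sum_(ib | viol ib c) wt c.
      by move=> Hv; rewrite (bigD1 ib)//= lerDl sumr_ge0.
    move=> /orP[h|h].
      by apply: (mem (i, false)); rewrite /viol !dotr_signed_delta !mxE/= !expr0 !mul1r; lra.
    by apply: (mem (i, true)); rewrite /viol !dotr_signed_delta !mxE/= !expr1 !mulN1r; lra.
  apply: (@le_trans _ _ (\sum_(ib : 'I_n.+1 * bool) expR (pls u t) / (8 * n.+1%:R))).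
    apply: ler_sum => -[i b] _; have [h h0 [hC hle]] := tilt i b.
    (* Beyond the violated face the tilting factor is at least 1; elsewhere the added terms are
       nonnegative. *)
    apply: (@le_trans _ _ (\sum_(c : {ffun F -> 'I_M.+1})
        expR (- (t * dotr (u - h *: signed_delta i b) (intvec (comb c)))) *
        expR (- (t * h * (dotr (signed_delta i b) X + W))))).
      rewrite [leRHS](bigID (viol (i, b))) /=; apply: ler_wpDr.
        by apply: sumr_ge0 => c _; rewrite mulr_ge0 ?expR_ge0.
      apply: ler_sum => c; rewrite /viol /= => Hv; rewrite -expRD ler_expR dotrBl dotrZl.
      have : t * h * (dotr (signed_delta i b) X + W) <= t * h * dotr (signed_delta i b) (intvec (comb c)).
        by rewrite ler_pM2l ?mulr_gt0// ltW.
      lra.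
    rewrite -mulr_suml.
    apply: (@le_trans _ _ (expR (pls (u - h *: signed_delta i b) t) *
        expR (- (t * h * (dotr (signed_delta i b) X + W))))).
      by rewrite ler_wpM2r ?expR_ge0//; exact: sum_comb_le.
    have n80 : (0 : R) < 8 * n.+1%:R by rewrite mulr_gt0.
    have E8 : (8 * n.+1%:R)^-1 = expR (- ln (8 * n.+1%:R)) :> R by rewrite expRN lnK.
    rewrite E8 -[leLHS]expRD -[leRHS]expRD ler_expR.
    exact: hle.
  rewrite sumr_const card_prod card_ord card_bool -[_ *+ (_ * _)]mulr_natr natrM.
  by rewrite le_eqVlt; apply/orP; left; apply/eqP; field; rewrite nat1r pnatr_eq0.
have inb : \sum_(c | inbox (comb c)) wt c <=
    ((2 * N').+1 ^ n.+1)%:R * (p C k')%:R * expR (- (t * lb)).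
  apply: (@le_trans _ _ (\sum_(c : {ffun F -> 'I_M.+1} | inbox (comb c)) expR (- (t * lb)))).
    apply: ler_sum => c /forallP Pc; rewrite ler_expR lerN2 ler_pM2l//.
    by have [] := boxP _ Pc.
  rewrite sumr_const -[leLHS]mulr_natl ler_wpM2r ?expR_ge0// -natrM ler_nat.
  have := card_box_le C_closed C_cone C_pointed uC M (N := N') (k := k') (P := inbox) FP.
  rewrite cardsE; apply => x /forallP Px.
  by have [? ? _] := boxP _ Px.
have : \sum_c wt c = \sum_(c | inbox (comb c)) wt c + \sum_(c | ~~ inbox (comb c)) wt c.
  exact: bigID.
rewrite -/wt in Zge => E.
have : expR (pls u t) / 2 <= \sum_c wt c by exact: Zge.
rewrite E; move: inb out; set A := \sum_(c | _) _; set B := \sum_(c | _) _.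
have -> : 4 * ((2 * N').+1 ^ n.+1)%:R * (p C k')%:R * expR (- (t * lb)) =
    4 * (((2 * N').+1 ^ n.+1)%:R * (p C k')%:R * expR (- (t * lb))) by rewrite !mulrA.
move: (((2 * N').+1 ^ n.+1)%:R * _ * _) (expR (pls u t)) => Y Z; lra.
Qed.

(** The equation for [rho] says that the first-order mean of the endpoint is [rho N a], so the
    linear effect of the tilt cancels against the centre of the box. The width [del N] gains a term
    linear in [h], which beats the quadratic remainder for small [h]. *)
Lemma tilt_estimate i b (s rho del : R) : 0 < s -> 0 < del ->
  rho * s ^+ n.+2 = n.+1%:R * log_density u ->
  exists2 h, 0 < h & strict_dual C (u - h *: signed_delta i b) /\
    \forall N \near \oo, pls (u - h *: signed_delta i b) (s / r N) -
      s / r N * h * (dotr (signed_delta i b) ((rho * N%:R) *: a) + del * N%:R) <=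
      pls u (s / r N) - ln (8 * n.+1%:R).
Proof.
move=> s_gt0 del0 rhoE.
set e := signed_delta i b.
have [K [h0 [K0 h00 HK]]] := laplace_expansion C_closed C_cone C_solid e uC.
have z0 : 0 < zeta (n.+2%:R : R) / zeta (n.+1%:R : R).
  by rewrite divr_gt0// (lt_le_trans ltr01)// zeta_ge1.
set z := zeta _ / zeta _ in z0.
have sn0 : 0 < s ^+ n.+1 by rewrite exprn_gt0.
pose c := z * K / s ^+ n.+1.
have c0 : 0 <= c by apply: divr_ge0; [apply: mulr_ge0 => //; exact: ltW | exact: ltW].
(* The second bound makes the quadratic term [h * (c * h)] at most half of the gain
   [h * s * del]. *)
pose h := Num.min h0 (s * del / (2 * (c + 1))).
have c10 : 0 < 2 * (c + 1) by rewrite mulr_gt0// ltr_wpDl.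
have h_gt0 : 0 < h by rewrite lt_min h00 divr_gt0// mulr_gt0.
have [hC hle] : strict_dual C (u + - h *: e) /\
    lap (u + - h *: e) <= lap u - - h * laplace_moment C u e + K * (- h) ^+ 2.
  by apply: HK; rewrite normrN gtr0_norm// ge_min lexx.
have momE : laplace_moment C u e = n.+1%:R * lap u * dotr e a.
  rewrite /e /signed_delta laplace_moment_scale// uD dotr_signed_delta.
  by rewrite mulrCA.
exists h => //.
rewrite -scaleNr; split=> //.
set v := u + - h *: e in hC hle *.
have dens w : log_density w = z * lap w by rewrite /log_density /z mulrAC.
(* The gain is [2 g]: [g] pays for the quadratic term, [g / 2] for the error in the limit and
   [g / 2] for [ln (8 n.+1)]. *)
pose g := h * s * del / 2.
have g0 : 0 < g by rewrite divr_gt0// !mulr_gt0.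
have lim : (fun N => pls v (s / r N) / r N ^+ n.+1 - pls u (s / r N) / r N ^+ n.+1) @ \oo -->
    log_density v / s ^+ n.+1 - log_density u / s ^+ n.+1.
  by apply: cvgB; exact: cvg_prim_log_root.
have diff : log_density v / s ^+ n.+1 - log_density u / s ^+ n.+1 <=
    h * s * rho * dotr e a + g.
  rewrite -mulrBl !dens -mulrBr ler_pdivrMr//.
  apply: (@le_trans _ _ (z * (h * (n.+1%:R * lap u * dotr e a) + K * h ^+ 2))).
    rewrite ler_pM2l// -momE; move: hle; rewrite sqrrN; lra.
  have E1 : z * (n.+1%:R * lap u) = rho * s * s ^+ n.+1.
    by rewrite -mulrA -exprS rhoE dens; ring.
  have E2 : z * (h * (n.+1%:R * lap u * dotr e a) + K * h ^+ 2) =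
      h * s * rho * dotr e a * s ^+ n.+1 + h * (c * h) * s ^+ n.+1.
    have -> : z * (h * (n.+1%:R * lap u * dotr e a) + K * h ^+ 2) =
      h * (z * (n.+1%:R * lap u)) * dotr e a + h * (z * K * h) by ring.
    by rewrite E1 /c; field; rewrite gt_eqF.
  rewrite E2 -mulrDl ler_pM2r// lerD2l.
  have -> : g = h * (s * del / 2) by rewrite /g; ring.
  rewrite ler_pM2l//.
  apply: (@le_trans _ _ ((c + 1) * h)); first by rewrite ler_wpM2r ?(ltW h_gt0)// lerDl.
  have : h <= s * del / (2 * (c + 1)) by rewrite ge_min lexx orbT.
  rewrite ler_pdivlMr//; lra.
have {}lim : \forall N \near \oo,
    pls v (s / r N) / r N ^+ n.+1 - pls u (s / r N) / r N ^+ n.+1 <= h * s * rho * dotr e a + g + g / 2.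
  apply: (cvgr_le _ lim); apply: le_lt_trans diff _; rewrite ltrDl divr_gt0//.
near=> N.
have r1 : 1 <= r N by near: N; exact: root_seq_ge.
have r0 : 0 < r N by exact: lt_le_trans r1.
have rn0 : 0 < r N ^+ n.+1 by rewrite exprn_gt0.
have rg : ln (8 * n.+1%:R) / (g / 2) <= r N by near: N; exact: root_seq_ge.
have HN : pls v (s / r N) / r N ^+ n.+1 - pls u (s / r N) / r N ^+ n.+1 <= h * s * rho * dotr e a + g + g / 2.
  by near: N.
move: HN; rewrite -mulrBl ler_pdivrMr// => HN.
have rE : s / r N * h * (dotr e ((rho * N%:R) *: a) + del * N%:R) =
    (h * s * rho * dotr e a + 2 * g) * r N ^+ n.+1.
  rewrite dotrZr -(root_seq_pow N) [r N ^+ n.+2]exprS /g; field.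
  by rewrite gt_eqF.
rewrite rE.
have rr : r N <= r N ^+ n.+1 by rewrite exprS ler_peMr ?(ltW r0)// exprn_ege1.
have : ln (8 * n.+1%:R) <= (g / 2) * r N ^+ n.+1.
  have h8 := le_trans rg rr.
  have g20 : 0 < g / 2 by apply: divr_gt0.
  by move: h8; rewrite ler_pdivrMr// [X in _ <= X -> _]mulrC.
move: HN; rewrite !mulrDl; lra.
Unshelve. all: by end_near.
Qed.

(** The mean is pulled back to [(1 - eps) N k], so that every endpoint in the box leaves a defect in
    [C]; the cost of [eps] and of the box width tends to 0 with them. *)
Lemma log_p_lower_bound (e : R) : 0 < e ->
  \forall N \near \oo, s0 * (n.+2%:R / n.+1%:R) - e <= term N.
Proof.
move=> e0.
have s00 := scale_const_gt0.
pose D : R := n.+2%:R / n.+1%:R.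
have D1 : 1 <= D.
  by rewrite ler_pdivlMr// mul1r ler_nat.
have D0 : 0 < D by exact: lt_le_trans D1.
(* The relative loss allowed in the exponent: one half goes to [eps * D], the other to
   [del * norm1 u]. The minimum with 1 keeps [D - e1] nonnegative. *)
pose e1 := Num.min 1 (e / s0) / 2.
have me0 : 0 < Num.min 1 (e / s0) by rewrite lt_min ltr01 divr_gt0.
have e10 : 0 < e1 by rewrite divr_gt0.
have e11 : e1 <= 2^-1.
  by rewrite /e1 -[leRHS]mul1r ler_pM2r ?invr_gt0// ge_min lexx.
have e1e : s0 * e1 <= e / 2.
  rewrite /e1 mulrA ler_pM2r ?invr_gt0// mulrC -ler_pdivlMr//.
  by rewrite ge_min lexx orbT.
pose eps := e1 / (2 * D).
have eps0 : 0 < eps by rewrite divr_gt0// mulr_gt0.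
have epsD : eps * D = e1 / 2 by rewrite /eps; field; rewrite gt_eqF.
have eps1 : eps < 1.
  have : eps * 1 <= eps * D by rewrite ler_pM2l.
  rewrite mulr1 epsD; lra.
pose rho := 1 - eps.
have rho0 : 0 < rho by rewrite subr_gt0.
have [ri ri0 Hri] := interior_box hk.
have nu0 : 0 < norm1 u + 1 by rewrite ltr_wpDl ?norm1_ge0.
(* The first bound keeps the defect inside the dilated ball of [C] around [eps N a]; the second
   limits the variation of [dotr u] over the box. *)
pose del := Num.min (eps * ri) (e1 / 2 / (norm1 u + 1)).
have del0 : 0 < del by rewrite lt_min mulr_gt0// !divr_gt0.
have delu : del * norm1 u <= e1 / 2.
  apply: (@le_trans _ _ (del * (norm1 u + 1))); first by rewrite ler_wpM2l ?(ltW del0)// lerDl.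
  by rewrite -ler_pdivlMr// ge_min lexx orbT.
have delr : del <= eps * ri by rewrite ge_min lexx.
(* A slightly larger scale than [s0], for which the mean endpoint is [rho N a]. *)
pose s := (n.+1%:R * log_density u / rho) `^ n.+2%:R^-1.
have nd0 : 0 < n.+1%:R * log_density u by rewrite mulr_gt0// log_density_gt0.
have s_gt0 : 0 < s by rewrite powR_gt0// divr_gt0.
have spow : s ^+ n.+2 = n.+1%:R * log_density u / rho.
  by rewrite -powR_mulrn ?powR_ge0// -powRrM mulVf ?pnatr_eq0// powRr1// divr_ge0 ?ltW.
have rhoE : rho * s ^+ n.+2 = n.+1%:R * log_density u.
  by rewrite spow mulrC divfK// gt_eqF.
have ss0 : s0 <= s.
  apply: ge0_ler_powR; rewrite ?nnegrE ?invr_ge0 ?(ltW nd0) ?divr_ge0 ?(ltW nd0) ?(ltW rho0)//.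
  by rewrite ler_pdivlMr// ler_piMr ?(ltW nd0)// gerBl ltW.
have densE : log_density u / s ^+ n.+1 = s * rho / n.+1%:R.
  have -> : log_density u = rho * (s * s ^+ n.+1) / n.+1%:R.
    by rewrite -exprS rhoE mulrC mulrA mulVf ?mul1r// pnatr_eq0.
  by field; rewrite nat1r pnatr_eq0/= expf_neq0// gt_eqF.
have H := cvg_prim_log_root s_gt0 uC.
rewrite densE in H.
have {}H : \forall N \near \oo, s * rho / n.+1%:R - e / 4 <= pls u (s / r N) / r N ^+ n.+1.
  by apply: (cvgr_ge _ H); rewrite gtrBl divr_gt0.
pose A := (Num.truncn (`|a| + del)).+1.
have AP : `|a| + del < A%:R by exact: truncnS_gt.
(* Bounds the logarithm of the constant and of the number of endpoints in the box, in units of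
   [r N], using that [ln (r N)] is at most [r N]. *)
pose K : R := ln 4 + n.+1%:R * (ln (2 * A%:R + 1) + n.+2%:R).
have tiltN i b : exists2 h, 0 < h & strict_dual C (u - h *: signed_delta i b) /\
    \forall N \near \oo, pls (u - h *: signed_delta i b) (s / r N) -
      s / r N * h * (dotr (signed_delta i b) ((rho * N%:R) *: a) + del * N%:R) <=
      pls u (s / r N) - ln (8 * n.+1%:R) by exact: tilt_estimate.
have tiltA : \forall N \near \oo, forall ib : 'I_n.+1 * bool,
    exists2 h, 0 < h & strict_dual C (u - h *: signed_delta ib.1 ib.2) /\
    pls (u - h *: signed_delta ib.1 ib.2) (s / r N) -
      s / r N * h * (dotr (signed_delta ib.1 ib.2) ((rho * N%:R) *: a) + del * N%:R) <=
      pls u (s / r N) - ln (8 * n.+1%:R).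
  apply: filter_forall => -[i b]; have [h h0 [hC hN]] := tiltN i b.
  by near=> N; exists h => //; split=> //; near: N.
near=> N.
have r1 : 1 <= r N by near: N; exact: root_seq_ge.
have r0 : 0 < r N by exact: lt_le_trans r1.
have rn0 : 0 < r N ^+ n.+1 by rewrite exprn_gt0.
have rK : K / (e / 4) <= r N by near: N; exact: root_seq_ge.
have HN : s * rho / n.+1%:R - e / 4 <= pls u (s / r N) / r N ^+ n.+1 by near: N.
have N0 : 0 < N%:R :> R by rewrite -root_seq_pow exprn_gt0.
have t0 : 0 < s / r N by rewrite divr_gt0.
have boxP (x : 'rV[int]_n.+1) :
    (forall i, `|(x ord0 i)%:~R - ((rho * N%:R) *: a) ord0 i| <= del * N%:R) ->
    [/\ C (intvec (k *+ N - x)), forall i, (`|x ord0 i| <= N * A)%N &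
        N%:R * (rho - del * norm1 u) <= dotr u (intvec x)].
  move=> Hx.
  have Hy : `|(rho * N%:R) *: a - intvec x| <= del * N%:R.
    rewrite [leLHS]/Num.Def.normr /= mx_normrE; apply/bigmax_leP; split.
      by rewrite mulr_ge0 ?ltW.
    move=> [i j] _ /=; rewrite (ord1 i) !mxE distrC.
    by have := Hx j; rewrite !mxE.
  split.
  (* The defect is [eps N] times a point within distance [ri] of the interior point [a]. *)
  - have -> : intvec (k *+ N - x) = N%:R *: (eps *: (a + (eps^-1 / N%:R) *: ((rho * N%:R) *: a - intvec x))).
      rewrite intvecB intvecMn scalerDr !scalerA scalerDr !scalerA.
      have -> : N%:R * (eps * (eps^-1 / N%:R)) = 1 :> R.
        by field; rewrite !gt_eqF.
      rewrite scale1r addrA -scalerDl /rho; congr (_ *: _ - _); ring.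
    apply: C_cone; first exact: ltW.
    apply: C_cone; first exact: ltW.
    apply: Hri; rewrite normrZ gtr0_norm ?divr_gt0 ?invr_gt0//.
    apply: (@le_trans _ _ (eps^-1 / N%:R * (eps * ri * N%:R))).
      rewrite ler_pM2l ?divr_gt0 ?invr_gt0//; apply: le_trans Hy _.
      by rewrite ler_pM2r.
    by rewrite le_eqVlt; apply/orP; left; apply/eqP; field; rewrite !gt_eqF.
  - move=> i; rewrite -(ler_nat R) natr_absz intr_norm.
    have := Hx i; rewrite !mxE => h.
    have ai := coord_le_norm a i; rewrite mxE in ai.
    have : `|(x ord0 i)%:~R| <= del * N%:R + rho * N%:R * `|(k ord0 i)%:~R| :> R.
      rewrite -[(x ord0 i)%:~R](subrK (rho * N%:R * (k ord0 i)%:~R)).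
      rewrite (le_trans (ler_normD _ _))// lerD// normrM gtr0_norm ?mulr_gt0//.
    move=> /le_trans; apply.
    apply: (@le_trans _ _ (N%:R * (`|a| + del))); last by rewrite natrM ler_pM2l// ltW.
    rewrite mulrDr addrC [del * _]mulrC lerD2r [rho * _]mulrC -mulrA ler_pM2l//.
    apply: le_trans ai; rewrite ler_piMl// gerBl ltW//.
  - have := dotr_le_norm u ((rho * N%:R) *: a - intvec x).
    rewrite dotrBr dotrZr ua mulr1 ler_norml => /andP[_ h].
    have : norm1 u * `|(rho * N%:R) *: a - intvec x| <= norm1 u * (del * N%:R).
      by rewrite ler_wpM2l ?norm1_ge0.
    lra.
have tiltT i b : exists2 h, 0 < h & strict_dual C (u - h *: signed_delta i b) /\
    pls (u - h *: signed_delta i b) (s / r N) -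
      s / r N * h * (dotr (signed_delta i b) ((rho * N%:R) *: a) + del * N%:R) <=
      pls u (s / r N) - ln (8 * n.+1%:R).
  have TA : forall ib : 'I_n.+1 * bool,
    exists2 h, 0 < h & strict_dual C (u - h *: signed_delta ib.1 ib.2) /\
    pls (u - h *: signed_delta ib.1 ib.2) (s / r N) -
      s / r N * h * (dotr (signed_delta ib.1 ib.2) ((rho * N%:R) *: a) + del * N%:R) <=
      pls u (s / r N) - ln (8 * n.+1%:R) by near: N.
  exact: (TA (i, b)).
have main := partition_function_le t0 boxP tiltT.
set P := (p C (k *+ N))%:R in main *.
have P0 : 0 < P.
  rewrite ltr0n lt0n; apply/negP => /eqP p0; move: main.
  by rewrite /P p0 mulr0 mul0r leNgt expR_gt0.
rewrite root_seq_powR [leRHS]mulrC ler_pdivlMr//.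
have poly0 : 0 < ((2 * (N * A)).+1 ^ n.+1)%:R :> R by rewrite ltr0n expn_gt0.
have lnmain : pls u (s / r N) <= ln 4 + ln ((2 * (N * A)).+1 ^ n.+1)%:R + ln P -
    s / r N * (N%:R * (rho - del * norm1 u)).
  have := main; rewrite -ler_ln ?posrE ?expR_gt0 ?mulr_gt0 ?expR_gt0// expRK.
  by rewrite !lnM ?posrE ?mulr_gt0 ?expR_gt0// expRK.
have lnpoly : ln ((2 * (N * A)).+1 ^ n.+1)%:R <= n.+1%:R * (ln (2 * A%:R + 1) + n.+2%:R * r N).
  rewrite natrX lnXn ?ltr0n// mulr_natl lerMn2r/=.
  apply: (@le_trans _ _ (ln ((2 * A%:R + 1) * r N ^+ n.+2))).
    rewrite ler_ln ?posrE ?ltr0n ?mulr_gt0 ?exprn_gt0// ?ltr_wpDl ?mulr_ge0//.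
    have := exprn_ege1 n.+2 r1; rewrite root_seq_pow -[_.+1]addn1 natrD !natrM; lra.
  rewrite lnM ?posrE ?exprn_gt0 ?ltr_wpDl ?mulr_ge0// lerD2l lnXn//.
  by rewrite -[leLHS]mulr_natl ler_wpM2l// ltW// ln_sublinear.
(* Here [1 <= n] matters: the losses of order [r N] are negligible against the main term
   [r N ^+ n.+1]. *)
have rr : r N * r N <= r N ^+ n.+1.
  rewrite -expr2 -(subnKC (n1 : (2 <= n.+1)%N)) exprD ler_peMr ?exprn_ge0 ?(ltW r0)//.
  exact: exprn_ege1.
have Kr : K * r N <= e / 4 * r N ^+ n.+1.
  apply: (@le_trans _ _ (e / 4 * (r N * r N))); last by rewrite ler_pM2l// divr_gt0.
  rewrite mulrA ler_pM2r//.
  by rewrite mulrC -ler_pdivrMr// divr_gt0.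
have KE : ln 4 + n.+1%:R * (ln (2 * A%:R + 1) + n.+2%:R * r N) <= K * r N.
  rewrite /K [leRHS]mulrDl lerD//.
    by rewrite ler_peMr// ln_ge0// ler1n.
  rewrite -mulrA ler_wpM2l// [leRHS]mulrDl lerD2r ler_peMr// ln_ge0//.
  by rewrite lerDr mulr_ge0.
have HN' : (s * rho / n.+1%:R - e / 4) * r N ^+ n.+1 <= pls u (s / r N).
  by rewrite -ler_pdivlMr.
have tN : s / r N * (N%:R * (rho - del * norm1 u)) = s * (rho - del * norm1 u) * r N ^+ n.+1.
  by rewrite -(root_seq_pow N) [r N ^+ n.+2]exprS; field; rewrite gt_eqF.
rewrite tN in lnmain.
(* Error budget: [e / 4] for the limit of [pls], [e / 4] for the polynomial factor and [e / 2] for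
   [s0 * e1]. *)
have fin : (s0 * D - e) <= s * rho / n.+1%:R - e / 4 + s * (rho - del * norm1 u) - e / 4.
  have -> : s * rho / n.+1%:R - e / 4 + s * (rho - del * norm1 u) - e / 4 =
      s * (rho * D - del * norm1 u) - e / 2.
    rewrite /D (_ : n.+2%:R = n.+1%:R + 1 :> R) ?natr1//.
    by field; rewrite nat1r pnatr_eq0.
  have low : D - e1 <= rho * D - del * norm1 u.
    by rewrite /rho mulrBl mul1r epsD; lra.
  have De : 0 <= D - e1 by lra.
  have : s0 * (D - e1) <= s * (rho * D - del * norm1 u).
    by apply: ler_pM => //; exact: ltW.
  rewrite mulrBr; lra.
have : (s0 * D - e) * r N ^+ n.+1 <=
    (s * rho / n.+1%:R - e / 4 + s * (rho - del * norm1 u) - e / 4) * r N ^+ n.+1.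
  by rewrite ler_pM2r.
rewrite -/D; move: HN' lnmain lnpoly KE Kr.
move: (s * rho / n.+1%:R) (s * (rho - _)) (s0 * D) (r N ^+ n.+1) (K * r N) (pls _ _).
move: (ln P) (ln _%:R) (n.+1%:R * _) (ln 4) => x1 x2 x3 x4 x5 x6 x7 x8 x9 x10.
lra.
Unshelve. all: by end_near.
Qed.

Theorem zonotope_asymptotics : (fun N : nat => term N) @ \oo --> c_ R n.+1 * q C a.
Proof.
rewrite limit_constE; apply/cvgrPdist_le => e e0.
near=> N.
have h1 : term N <= s0 * (n.+2%:R / n.+1%:R) + e by near: N; exact: log_p_upper_bound.
have h2 : s0 * (n.+2%:R / n.+1%:R) - e <= term N by near: N; exact: log_p_lower_bound.
by rewrite distrC ler_distl h1 h2.
Unshelve. all: by end_near.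
Qed.

End endpoint.
End asymptotics.

Theorem theorem1p2 (R : realType) (d : nat) (hd : (2 <= d)%N)
    (C : set 'rV[R]_d) (C_closed : closed C) (C_convex : convex_set C)
    (C_cone : is_cone C) (C_pointed : contains_no_line C)
    (C_solid : interior C !=set0)
    (k : 'rV[int]_d) (hk : interior C (intvec k)) :
  (fun n : nat => n%:R `^ (- (d%:R / d.+1%:R)) * ln (p C (k *+ n))%:R)
    @ \oo --> c_ R d * q C (intvec k).
Proof.
case: d hd C C_closed C_convex C_cone C_pointed C_solid k hk => [//|d] hd C *.
exact: zonotope_asymptotics.
Qed.
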